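(* Let $d\in\{1,2,\dots\}$ and let $X$ be a splittable stationary random field on $\mathbb{R}^d$. Then there exists a unique number $\sigma_X\in[0,\infty)$ such that for every continuous compactly supported function $\varphi:\mathbb{R}^d\to\mathbb{R}$, $$\lim_{\substack{r\to\infty,\ \lambda\to0\\ \lambda\log^d r\to0}}\ \frac1{r^d\lambda^2}\log\mathbb{E}\exp\Big(\lambda\int_{\mathbb{R}^d}\varphi\Big(\frac1r t\Big)X_t\,dt\Big)=\frac12\|\varphi\|^2\sigma_X^2,$$ where $\|\varphi\|^2=\int_{\mathbb{R}^d}\varphi^2(t)\,dt$.
   Context: Random fields. A locally finite signed Borel measure (LFSBM) on $\mathbb{R}^d$ is a real-valued set function on the bounded Borel subsets of $\mathbb{R}^d$ whose restriction to the Borel subsets of any bounded Borel set is a (countably additive, finite) signed measure. The set of LFSBMs carries the $\sigma$-field generated by the maps $\mu\mapsto\int f\,d\mu$, $f$ continuous with compact support. A random field $X$ on $\mathbb{R}^d$ (and on a probability space $\Omega$) is a measurable map from $\Omega$ to the space of LFSBMs on $\mathbb{R}^d$; it is denoted as if it had a density: $B\mapsto\int_B X_t\,dt$. The (random, positive, locally finite) variation measure is denoted $B\mapsto\int_B|X_t|\,dt$; it extends to all Borel sets with values in $[0,\infty]$. For locally bounded Borel $\varphi$, $\varphi X=(\varphi(t)X_t)_t$ is the measure with density $\varphi$ relative to $X$. For a coordinate permutation composed with a shift, $\alpha:\mathbb{R}^d\to\mathbb{R}^d$, the field $(X_{\alpha(t)})_t$ is defined by $\int_B X_{\alpha(t)}\,dt=\int_{\alpha(B)}X_t\,dt$.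 $X$ is stationary if $(X_{t+s})_t$ has the same distribution as $X$ for every $s\in\mathbb{R}^d$. Identically distributed fields may live on different probability spaces. Split and leak. A split of a random field $X$ on $\mathbb{R}^d$ is a triple $(X^0,X^-,X^+)$ of random fields on $\mathbb{R}^d$, all defined on one probability space $\tilde\Omega$ (possibly different from that of $X$), such that $X^-,X^+$ are independent and each of $X^0,X^-,X^+$ is distributed like $X$. Its leak is the random field $Y$ on $\tilde\Omega$ with $Y_t=X^-_t-X^0_t$ when $t_1<0$ and $Y_t=X^+_t-X^0_t$ when $t_1\ge0$ (equality of measures on the two half-spaces). A random field $Y$ on any probability space is a leak for $X$ if it is distributed like the leak of some split of $X$. Splittability. Let $k\in\{1,\dots,d\}$. A random field $X$ on $\mathbb{R}^d$ is $(1,k)$-splittable (recursively in $k$) if: (a) for every $s\in\mathbb{R}^k$, $\mathbb{E}\exp\int_{([0,1)^k+s)\times\mathbb{R}^{d-k}}|X_t|\,dt\le2$; (b) $\mathbb{E}\int_A X_t\,dt=0$ for every bounded Borel $A\subset\mathbb{R}^d$; (c) for every $i\in\{1,\dots,k\}$ and $r\in\mathbb{R}$ the random field $\tilde X_{t_1,\dots,t_d}=X_{t_2,\dots,t_i,t_1+r,t_{i+1},\dots,t_d}$ has a leak $\tilde Y$ such that the random field $Y_{t_1,\dots,t_d}=\tilde Y_{t_k,t_1,\dots,t_{k-1},t_{k+1},\dots,t_d}$ is $(1,k-1)$-splittable if $k>1$, and satisfies $\mathbb{E}\exp\int_{\mathbb{R}^d}|Y_t|\,dt\le2$ if $k=1$.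 For $C\in(0,\infty)$, $X$ is $(C,k)$-splittable if $\frac1CX$ is $(1,k)$-splittable; $X$ is $C$-splittable if it is $(C,d)$-splittable; $X$ is splittable if it is $C$-splittable for some $C\in(0,\infty)$. Limit. The limit is over $r\in(0,\infty)$, $\lambda\in\mathbb{R}\setminus\{0\}$: for every $\eta>0$ there are $R,\delta>0$ such that the expression is within $\eta$ of the limit whenever $r>R$, $0<|\lambda|<\delta$ and $|\lambda|\log^d r<\delta$. Here $\log^d r=(\log r)^d$. *)

(* Defs.v *)
From HB Require Import structures.
From mathcomp Require Import all_boot all_order all_algebra all_fingroup.
From mathcomp Require Import all_classical all_reals all_analysis.

Set Implicit Arguments.
Unset Strict Implicit.
Unset Printing Implicit Defensive.

Import Order.TTheory GRing.Theory Num.Theory.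
Import numFieldNormedType.Exports.

Local Open Scope classical_set_scope.
Local Open Scope ring_scope.

(* R^n as a measurable space with its Borel sigma-algebra; this is 'rV[R]_n
   up to conversion, with the library topology of 'rV[R]_n. *)
Notation borel_rV R n := (g_sigma_algebraType (@open 'rV[R]_n)).

(* n-dimensional Lebesgue measure, as an iterated product. *)
Fixpoint lebesgue_rV (R : realType) (n : nat) : set (borel_rV R n) -> \bar R :=
  match n with
  | 0 => dirac ((0 : 'rV[R]_0) : borel_rV R 0)
  | m.+1 => pushforward (lebesgue_measure \x @lebesgue_rV R m)%E
              (fun p : R * borel_rV R m =>
                 row_mx (p.1%:M : 'rV[R]_1) (p.2 : 'rV[R]_m) : borel_rV R m.+1)
  end.

Definition sqnorm_rV (R : realType) (n : nat) (phi : 'rV[R]_n -> R) : R :=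
  fine (\int[@lebesgue_rV R n]_t (phi t ^+ 2)%:E).

Definition compactly_supported (R : realType) (n : nat) (f : 'rV[R]_n -> R) :=
  compact (closure [set t | f t != 0]).

Definition bounded_borel (R : realType) (n : nat) : set (set 'rV[R]_n) :=
  [set A | measurable (A : set (borel_rV R n)) /\ bounded_set A].

(* Locally finite signed Borel measures. The underlying function is total on
   sets, but its values outside the bounded Borel sets carry no information:
   no definition below reads them. *)
Record lfsbm (R : realType) (n : nat) := LFSBM {
  lfsbm_val :> set 'rV[R]_n -> R;
  lfsbm_charge : forall B, bounded_borel B ->
    semi_sigma_additive
      (fun A : set (borel_rV R n) => (lfsbm_val (A `&` B))%:E) }.

Section lfsbm_integration.
Context {R : realType} {n : nat}.
Implicit Types (mu : lfsbm R n) (A : set 'rV[R]_n) (f : 'rV[R]_n -> R).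

(* The Jordan decomposition mu = upper - lower, given by the upper and lower
   variations; it determines the variation measure on all Borel sets. *)
Definition upper_variation mu A : \bar R :=
  ereal_sup [set (mu B)%:E | B in [set B | bounded_borel B /\ B `<=` A]].

Definition lower_variation mu A : \bar R :=
  ereal_sup [set (- mu B)%:E | B in [set B | bounded_borel B /\ B `<=` A]].

Definition lfsbm_variation mu A : \bar R :=
  (upper_variation mu A + lower_variation mu A)%E.

Definition lfsbm_integral mu f : R :=
  fine (\int[upper_variation mu : set (borel_rV R n) -> \bar R]_t (f t)%:E) -
  fine (\int[lower_variation mu : set (borel_rV R n) -> \bar R]_t (f t)%:E).

End lfsbm_integration.

Section lfsbm_constructions.
Context {R : realType} {n : nat}.
Implicit Types (s : 'S_n) (v t u : 'rV[R]_n).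

Lemma lfsbm0_charge (B : set 'rV[R]_n) : bounded_borel B ->
  semi_sigma_additive (fun A : set (borel_rV R n) => (0 : R)%:E).
Proof.
move=> _ F _ _ _; rewrite [X in X @ _](_ : _ = fun=> 0%E); first exact: cvg_cst.
by apply/funext => m; rewrite big1.
Qed.

Definition lfsbm0 : lfsbm R n := @LFSBM R n (fun=> 0) lfsbm0_charge.

Lemma scale_lfsbm_charge (c : R) (mu : lfsbm R n) (B : set 'rV[R]_n) :
  bounded_borel B ->
  semi_sigma_additive (fun A : set (borel_rV R n) => (c * mu (A `&` B))%:E).
Proof.
move=> bB F mF tF mUF.
have := @lfsbm_charge _ _ mu _ bB F mF tF mUF.
rewrite [X in X @ _](_ : _ = EFin \o
  (fun m => \sum_(0 <= i < m) mu (F i `&` B))); last first.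
  by apply/funext => m /=; rewrite sumEFin.
rewrite [X in _ -> X @ _ --> _](_ : _ = EFin \o
  (fun m => c * \sum_(0 <= i < m) mu (F i `&` B))); last first.
  by apply/funext => m /=; rewrite sumEFin mulr_sumr.
move=> /fine_cvgP[_ h]; apply: cvg_EFin; first by near=> x.
exact: cvgMl_tmp.
Unshelve. all: end_near. Qed.

Definition scale_lfsbm (c : R) (mu : lfsbm R n) : lfsbm R n :=
  @LFSBM R n (fun B => c * mu B) (@scale_lfsbm_charge c mu).

(* alpha (t_1, ..., t_n) = (t_(s 1), ..., t_(s n)) + v *)
Definition perm_shift (s : 'S_n) (v t : 'rV[R]_n) : 'rV[R]_n :=
  \row_j t ord0 (s j) + v.

Lemma perm_shiftK s v :
  cancel (perm_shift s v) (perm_shift s^-1%g (- \row_j v ord0 (s^-1%g j))).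
Proof. by move=> t; apply/rowP => j; rewrite !mxE permKV addrK. Qed.

Lemma perm_shiftVK s v :
  cancel (perm_shift s^-1%g (- \row_j v ord0 (s^-1%g j))) (perm_shift s v).
Proof. by move=> t; apply/rowP => j; rewrite !mxE permK subrK. Qed.

Lemma norm_perm_shift s v t : `|perm_shift s v t| <= `|t| + `|v|.
Proof.
apply: le_trans (ler_normD _ _) _; rewrite lerD2r.
rewrite /Num.norm /= !mx_normrE; apply/bigmax_leP; split=> [|[i j] _] /=.
  by apply/bigmax_geP; left.
rewrite mxE; apply/bigmax_geP; right.
by exists (ord0, s j).
Qed.

Lemma perm_shiftB s v t u : perm_shift s v t - perm_shift s v u =
  perm_shift s 0 (t - u).
Proof. by apply/rowP => j; rewrite !mxE addr0 opprD addrACA subrr addr0. Qed.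

Lemma continuous_perm_shift s v : continuous (perm_shift s v).
Proof.
move=> t; apply/(@cvgrPdist_lt _ _ _ _ (nbhs_filter t)) => e e0.
apply: filterS (nbhsx_ballx t e e0) => u.
rewrite -ball_normE /= perm_shiftB; apply: le_lt_trans.
by rewrite (le_trans (norm_perm_shift _ _ _))// normr0 addr0.
Qed.

Lemma image_perm_shift s v (A : set 'rV[R]_n) : perm_shift s v @` A =
  perm_shift s^-1%g (- \row_j v ord0 (s^-1%g j)) @^-1` A.
Proof.
apply/seteqP; split=> [_ [t At <-]|t At] /=; first by rewrite perm_shiftK.
by exists (perm_shift s^-1%g (- \row_j v ord0 (s^-1%g j)) t) => //;
  rewrite perm_shiftVK.
Qed.

Lemma measurable_perm_shift s v (A : set 'rV[R]_n) :
  measurable (A : set (borel_rV R n)) ->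
  measurable (perm_shift s v @` A : set (borel_rV R n)).
Proof.
rewrite image_perm_shift; set g := perm_shift _ _ => mA.
rewrite -[X in measurable X]setTI.
have : measurable_fun setT (g : borel_rV R n -> borel_rV R n).
  apply: (@measurability _ _ (borel_rV R n) (borel_rV R n) setT g open) => //.
  move=> _ [U oU <-].
  rewrite setTI; apply: sub_sigma_algebra.
  by apply: open_comp => // t _; exact: continuous_perm_shift.
by apply.
Qed.

Lemma bounded_borel_perm_shift s v (A : set 'rV[R]_n) :
  bounded_borel A -> bounded_borel (perm_shift s v @` A).
Proof.
move=> [mA [M [Mreal AM]]]; split; first exact: measurable_perm_shift.
exists (M + 1 + `|v|); split; first exact: num_real.
move=> x Mx _ [t At <-]; apply: le_trans (norm_perm_shift _ _ _) _.
apply: le_trans (ltW Mx); rewrite lerD2r; apply: AM At.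
by rewrite ltrDl.
Qed.

Lemma reparam_charge s v (mu : lfsbm R n) (B : set 'rV[R]_n) :
  bounded_borel B ->
  semi_sigma_additive
    (fun A : set (borel_rV R n) => (mu (perm_shift s v @` (A `&` B)))%:E).
Proof.
move=> bB F mF tF mUF; set a := perm_shift s v.
have aI : injective a by exact: can_inj (perm_shiftK s v).
have aSI (A C : set 'rV[R]_n) : a @` (A `&` C) = a @` A `&` a @` C.
  apply/seteqP; split=> [_ [t [At Ct] <-]|_ [[t At <-] [u Cu /aI ut]]].
    by split; exists t.
  by exists t => //; split=> //; rewrite -ut.
have baB := bounded_borel_perm_shift s v bB.
have := @lfsbm_charge _ _ mu _ baB (fun i => a @` F i).
rewrite -image_bigcup -aSI.
under [X in X @ _ --> _]eq_fun do under eq_bigr do rewrite -aSI.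
apply=> [i||].
- exact: measurable_perm_shift.
- apply/trivIsetP => i j _ _ ij; rewrite -aSI.
  by move/trivIsetP: tF => /(_ i j I I ij) ->; rewrite image_set0.
- exact: measurable_perm_shift.
Qed.

(* The field (X_(alpha t))_t for alpha = perm_shift s v:
   its value on B is X(alpha(B)). *)
Definition reparam s v (mu : lfsbm R n) : lfsbm R n :=
  @LFSBM R n (fun B => mu (perm_shift s v @` B)) (@reparam_charge s v mu).

End lfsbm_constructions.

HB.instance Definition _ (R : realType) n := gen_eqMixin (lfsbm R n).
HB.instance Definition _ (R : realType) n := gen_choiceMixin (lfsbm R n).
HB.instance Definition _ (R : realType) n :=
  isPointed.Build (lfsbm R n) (@lfsbm0 R n).

(* The maps mu |-> \int f dmu, f continuous with compact support, generate the
   sigma-algebra of the space of locally finite signed Borel measures. *)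
Definition lfsbm_generators (R : realType) (n : nat) : set (set (lfsbm R n)) :=
  \bigcup_(f in [set f : 'rV[R]_n -> R | continuous f /\ compactly_supported f])
    preimage_set_system setT (fun mu : lfsbm R n => lfsbm_integral mu f)
      measurable.

Notation lfsbm_space R n := (g_sigma_algebraType (@lfsbm_generators R n)).

Definition random_field (R : realType) (n : nat) (disp : measure_display)
    (Omega : measurableType disp) (X : Omega -> lfsbm R n) : Prop :=
  measurable_fun setT (X : Omega -> lfsbm_space R n).

Definition same_law (R : realType) (n : nat)
    (disp : measure_display) (Omega : measurableType disp)
    (P : probability Omega R) (X : Omega -> lfsbm R n)
    (disp' : measure_display) (Omega' : measurableType disp')
    (P' : probability Omega' R) (X' : Omega' -> lfsbm R n) : Prop :=
  forall A : set (lfsbm_space R n), measurable A ->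
    P (X @^-1` A) = P' (X' @^-1` A).

Definition independent_fields (R : realType) (n : nat) (disp : measure_display)
    (Omega : measurableType disp) (P : probability Omega R)
    (X Y : Omega -> lfsbm R n) : Prop :=
  forall A B : set (lfsbm_space R n), measurable A -> measurable B ->
    P (X @^-1` A `&` Y @^-1` B) = (P (X @^-1` A) * P (Y @^-1` B))%E.

Definition stationary (R : realType) (n : nat) (disp : measure_display)
    (Omega : measurableType disp) (P : probability Omega R)
    (X : Omega -> lfsbm R n) : Prop :=
  forall s : 'rV[R]_n, same_law P (fun w => reparam 1%g s (X w)) P X.

(* From here on the dimension is d = n.+1, the coordinates t_1, ..., t_d are
   t 0 0, ..., t 0 n, and indices are shifted by one accordingly. *)

Definition is_split (R : realType) (n : nat)
    (disp : measure_display) (Omega : measurableType disp)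
    (P : probability Omega R) (X : Omega -> lfsbm R n.+1)
    (disp' : measure_display) (Omega' : measurableType disp')
    (P' : probability Omega' R) (X0 Xm Xp : Omega' -> lfsbm R n.+1) : Prop :=
  [/\ random_field X0, random_field Xm & random_field Xp] /\
  independent_fields P' Xm Xp /\
  [/\ same_law P' X0 P X, same_law P' Xm P X & same_law P' Xp P X].

Definition is_leak_of_split (R : realType) (n : nat) (Omega' : Type)
    (X0 Xm Xp Y : Omega' -> lfsbm R n.+1) : Prop :=
  forall w (B : set 'rV[R]_n.+1), bounded_borel B ->
    (B `<=` [set t : 'rV[R]_n.+1 | t ord0 ord0 < 0] ->
       Y w B = Xm w B - X0 w B) /\
    (B `<=` [set t : 'rV[R]_n.+1 | 0 <= t ord0 ord0] ->
       Y w B = Xp w B - X0 w B).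

Definition is_leak (R : realType) (n : nat)
    (disp : measure_display) (Omega : measurableType disp)
    (P : probability Omega R) (X : Omega -> lfsbm R n.+1)
    (disp' : measure_display) (Omega' : measurableType disp')
    (P' : probability Omega' R) (Y : Omega' -> lfsbm R n.+1) : Prop :=
  random_field Y /\
  exists (disp2 : measure_display) (Omega2 : measurableType disp2)
    (P2 : probability Omega2 R) (X0 Xm Xp Z : Omega2 -> lfsbm R n.+1),
    [/\ is_split P X P2 X0 Xm Xp, random_field Z,
        is_leak_of_split X0 Xm Xp Z & same_law P' Y P2 Z].

(* ([0,1)^k + s) x R^(d-k) *)
Definition strip (R : realType) (n k : nat) (s : 'rV[R]_k) :
    set 'rV[R]_n.+1 :=
  [set t : 'rV[R]_n.+1 | forall (j : 'I_n.+1) (jk : (j < k)%N),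
    s ord0 (Ordinal jk) <= t ord0 j < s ord0 (Ordinal jk) + 1].

(* (1,k)-splittability, with k = 0 standing for the terminal condition
   E exp \int_(R^d) |Y_t| dt <= 2 of the case k = 1.
   The permutation lift_perm i ord0 1 sends i to the first index, sends j < i to
   j + 1 and fixes j > i, so that perm_shift (lift_perm i ord0 1)
   (r *: delta_mx ord0 i) is
     t |-> (t_2, ..., t_i, t_1 + r, t_(i+1), ..., t_d);
   with k = k'.+1, the inverse permutation lift_perm ord0 (inord k') 1 gives
     t |-> (t_k, t_1, ..., t_(k-1), t_(k+1), ..., t_d). *)
Fixpoint splittable1 (R : realType) (n k : nat)
    (disp : measure_display) (Omega : measurableType disp)
    (P : probability Omega R) (X : Omega -> lfsbm R n.+1) {struct k} : Prop :=
  match k with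
  | 0 => (\int[P]_w expeR (lfsbm_variation (X w) setT) <= 2%:E)%E
  | k'.+1 =>
    [/\ forall s : 'rV[R]_k'.+1,
          (\int[P]_w expeR (lfsbm_variation (X w) (strip s)) <= 2%:E)%E,
        forall A : set 'rV[R]_n.+1, bounded_borel A ->
          ('E_P[fun w => X w A] = 0)%E &
        forall (i : 'I_n.+1) (r : R), (i < k'.+1)%N ->
          exists (disp' : measure_display) (Omega' : measurableType disp')
            (P' : probability Omega' R) (Y : Omega' -> lfsbm R n.+1),
            is_leak P
              (fun w => reparam (lift_perm i ord0 1%g) (r *: delta_mx ord0 i)
                          (X w))
              P' Y /\
            splittable1 k' P'
              (fun w => reparam (lift_perm ord0 (inord k') 1%g) 0 (Y w))]
  end.

Definition Ck_splittable (R : realType) (n : nat) (C : R) (k : nat)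
    (disp : measure_display) (Omega : measurableType disp)
    (P : probability Omega R) (X : Omega -> lfsbm R n.+1) : Prop :=
  splittable1 k P (fun w => scale_lfsbm C^-1 (X w)).

Definition splittable (R : realType) (n : nat) (disp : measure_display)
    (Omega : measurableType disp) (P : probability Omega R)
    (X : Omega -> lfsbm R n.+1) : Prop :=
  exists2 C : R, 0 < C & Ck_splittable C n.+1 P X.

(* Main.v *)
(* Hoelder's inequality with an exponent [p] close to 1 shows that cutting a
   cube into two halves changes [log E exp (\int f dX)] only by the factor [p]
   and by the contribution of the leak. The leak is a field that is splittable
   in one dimension less, so its exponential moments on the cut are bounded by
   induction on the number of dimensions. Iterating over dyadic scales, with
   exponents whose product stays bounded because [|lambda| log^d r] is small,
   compares [log E exp (lambda \int phi (t / r) dX)] from above and from below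
   with the sum of the same quantities over cubes of a fixed side [2 ^ j], up to
   a relative error [O((3/4)^j)]. On such a cube a Taylor expansion as
   [lambda -> 0] leaves [lambda^2 phi^2 / 2] times the variance of [X] on the
   cube, which by stationarity is the same for all of them. The normalized
   logarithm is thus eventually within [O((3/4)^j)] of [||phi||^2 v_j / 2], where
   [v_j] is this variance per unit of volume; comparing two values of [j] for
   one [phi] shows that [v_j] is a Cauchy sequence, and [sigma^2] is its limit. *)

Require Import Defs.
From HB Require Import structures.
From mathcomp Require Import all_boot all_order all_algebra all_fingroup.
From mathcomp Require Import all_classical all_reals all_analysis.
From mathcomp Require Import measurable_realfun ring lra.

Set Implicit Arguments.
Unset Strict Implicit.
Unset Printing Implicit Defensive.

Import Order.TTheory GRing.Theory Num.Theory.
Import numFieldNormedType.Exports.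

Local Open Scope classical_set_scope.
Local Open Scope ring_scope.

(** The power of the logarithm comes from the budget of exponents. In dimension [k], a cut at scale
    [2 ^ m] with exponent [p = expR y] has a conjugate exponent [q] of order [1 / y]. The leak,
    multiplied by [q], must stay in the range of the bound for dimension [k - 1], so [y] has to
    exceed a constant times [a * m ^ (k - 1)], where [a] bounds the integrand. Over about [log r]
    scales these terms add up to [a * (log r) ^ k]: one more power per dimension. The leak also has
    to be cheap. Its cost [q * a ^ 2 * 2 ^ (m * (k - 1))] is [q * a ^ 2 / 2 ^ m] per unit of volume,
    and a summand [(3 / 4) ^ m] in [y] makes this [O((2 / 3) ^ m)] while remaining summable.

    Exponential moments may be infinite, and every leak lives on a probability space of its own. The
    induction therefore runs on relations between a function and the upper bounds of its logarithmic
    moment ([splits]), and a lower bound is stated as a bound on all these upper bounds. *)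

(** * Signed measures and their variations *)

Section variation.
Context {R : realType} {n : nat}.
Implicit Types (mu : lfsbm R n) (A B : set 'rV[R]_n).
Local Notation B_ := (borel_rV R n).

Lemma bounded_setP A : bounded_set A <-> exists M : R, forall t, A t -> `|t| <= M.
Proof.
split=> [[M [Mr AM]]|[M AM]].
  by exists (M + 1) => t At; apply: AM At; rewrite ltrDl.
exists M; split; first exact: num_real.
by move=> x Mx t At; exact: le_trans (AM _ At) (ltW Mx).
Qed.

Lemma bounded_borelS A B : measurable (A : set B_) -> bounded_borel B ->
  A `<=` B -> bounded_borel A.
Proof. move=> mA [mB /bounded_setP[M BM]] AB; split=> //.
by apply/bounded_setP; exists M => t /AB/BM. Qed.

Lemma bounded_borel0 : bounded_borel (set0 : set 'rV[R]_n).
Proof. by split; [exact: measurable0|apply/bounded_setP; exists 0]. Qed.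

Lemma bounded_borelI A B : measurable (A : set B_) -> bounded_borel B ->
  bounded_borel (A `&` B).
Proof.
move=> mA [mB bB]; apply: (@bounded_borelS _ B) => //.
exact: (@measurableI _ B_).
Qed.

Lemma bounded_borelU A B : bounded_borel A -> bounded_borel B ->
  bounded_borel (A `|` B).
Proof.
move=> [mA /bounded_setP[M AM]] [mB /bounded_setP[N BN]]; split.
  exact: (@measurableU _ B_).
apply/bounded_setP; exists (Num.max M N) => t [/AM|/BN] tM; rewrite le_max tM//.
by rewrite orbT.
Qed.

(** Countable additivity along the constant sequence of empty sets makes [mu set0 *+ m] converge, so
    its constant increment vanishes. *)
Lemma lfsbm_set0 mu : mu set0 = 0.
Proof.
have := @lfsbm_charge _ _ mu _ bounded_borel0 (fun=> set0)
  (fun=> measurable0).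
rewrite bigcup0//= set0I => /(_ (@trivIset_set0 _ _ _) measurable0).
rewrite [X in X @ _ --> _](_ : _ = fun m => (mu set0 *+ m)%:E); last first.
  by apply/funext => m; rewrite sumEFin sumr_const_nat subn0.
move=> /fine_cvgP[_ h].
have h1 : (fun m => mu set0 *+ m.+1 - mu set0 *+ m) @ \oo --> mu set0 - mu set0.
  by apply: cvgB => //; rewrite (cvg_shiftS (fun m => mu set0 *+ m)).
rewrite subrr in h1.
have h2 : (fun m : nat => mu set0 *+ m.+1 - mu set0 *+ m) @ \oo --> mu set0.
  rewrite [X in X @ _](_ : _ = fun=> mu set0); first exact: cvg_cst.
  by apply/funext => m; rewrite mulrS addrK.
exact: (cvg_unique _ h2 h1).
Qed.

(** The trace of [mu] on a bounded Borel set is a finite charge, to which the Hahn decomposition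
    applies. The proof of boundedness is an argument so that the charge structure can be inferred
    from the term. *)
Definition restr_lfsbm mu B & bounded_borel B : set B_ -> \bar R :=
  fun A => (mu (A `&` B))%:E.

Section restr.
Variables (mu : lfsbm R n) (B : set 'rV[R]_n) (bB : bounded_borel B).
Let nu0 : restr_lfsbm mu bB set0 = 0%E.
Proof. by rewrite /restr_lfsbm set0I lfsbm_set0. Qed.
Let nufin A : measurable (A : set B_) -> restr_lfsbm mu bB A \is a fin_num.
Proof. by []. Qed.
Let nusig : semi_sigma_additive (restr_lfsbm mu bB).
Proof. exact: lfsbm_charge. Qed.
HB.instance Definition _ := isCharge.Build _ B_ R (restr_lfsbm mu bB)
  nu0 nufin nusig.
End restr.

Lemma restr_lfsbmE mu A B (bB : bounded_borel B) : A `<=` B ->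
  restr_lfsbm mu bB A = (mu A)%:E.
Proof. by move=> AB; rewrite /restr_lfsbm setIidl. Qed.

Lemma lfsbmU mu A B : bounded_borel A -> bounded_borel B -> A `&` B = set0 ->
  mu (A `|` B) = mu A + mu B.
Proof.
move=> bA bB AB; have bU := bounded_borelU bA bB.
apply: EFin_inj; rewrite EFinD -!(@restr_lfsbmE mu _ _ bU)//.
by apply: chargeU => //; [exact: bA.1|exact: bB.1].
Qed.

Lemma upper_variation_ge0 mu A : (0 <= upper_variation mu A)%E.
Proof.
apply: ereal_sup_ubound => /=; exists set0; last by rewrite lfsbm_set0.
by split=> //; exact: bounded_borel0.
Qed.

Lemma le_upper_variation mu A B : A `<=` B ->
  (upper_variation mu A <= upper_variation mu B)%E.
Proof.
move=> AB; apply: ge_ereal_sup => _ [C [bC CA] <-].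
apply: ereal_sup_ubound => /=; exists C => //; split=> //.
exact: subset_trans AB.
Qed.

Lemma upper_variation0 mu : upper_variation mu set0 = 0%E.
Proof.
apply/eqP; rewrite eq_le upper_variation_ge0 andbT.
by apply: ge_ereal_sup => _ [C [_ C0] <-]; move: C0; rewrite subset0 => ->; rewrite lfsbm_set0.
Qed.

(** The supremum is bounded by the charge of a Hahn positive set [P]: removing the part of [C] in
    [N] and then adding the rest of [P] only increases the charge. *)
Lemma upper_variation_lty mu B : bounded_borel B ->
  (upper_variation mu B < +oo)%E.
Proof.
move=> bB; have [P [N [[mP Ppos] [mN Nneg] PN PN0]]] :=
  Hahn_decomposition (restr_lfsbm mu bB).
apply: (@le_lt_trans _ _ (restr_lfsbm mu bB P)); last by rewrite ltry.
apply: ge_ereal_sup => _ [C [[mC bC] CB] <-].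
rewrite -(@restr_lfsbmE mu _ _ bB CB).
rewrite (@charge_partition _ _ _ (restr_lfsbm mu bB) C P N mC mP mN PN PN0).
have CP : (restr_lfsbm mu bB (C `&` N) <= 0)%E.
  by apply: Nneg => //; exact: (@measurableI _ B_).
apply: (@le_trans _ _ (restr_lfsbm mu bB (C `&` P))).
  by rewrite geeDl.
rewrite [leRHS](@chargeDI _ B_ _ (restr_lfsbm mu bB) P C mP mC) setIC leeDr//.
by apply: Ppos; [exact: (@measurableD _ B_)|exact: subDsetl].
Qed.

Lemma upper_variationU mu A B :
  measurable (A : set B_) -> measurable (B : set B_) -> A `&` B = set0 ->
  (upper_variation mu A + upper_variation mu B <= upper_variation mu (A `|` B))%E.
Proof.
move=> mA mB AB0.
(* An infinite value is set aside because the two suprema are separated below by subtracting this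
   term. *)
have [Boo|Boo] := eqVneq (upper_variation mu B) +oo%E.
  suff -> : upper_variation mu (A `|` B) = +oo%E by rewrite leey.
  by apply/eqP; rewrite -leye_eq -Boo; exact/le_upper_variation/subsetUr.
have Bfin : upper_variation mu B \is a fin_num.
  by rewrite ge0_fin_numE ?upper_variation_ge0// ltey.
rewrite -leeBrDr//; apply: ge_ereal_sup => _ [C [bC CA] <-].
rewrite leeBrDr// addeC -leeBrDr//; apply: ge_ereal_sup => _ [D [bD DB] <-].
rewrite leeBrDr// -EFinD addrC -lfsbmU//; last first.
  by rewrite -subset0 -AB0; exact: setISS.
apply: ereal_sup_ubound => /=; exists (C `|` D) => //.
by split; [exact: bounded_borelU|exact: setUSS].
Qed.

(** Superadditivity on finite disjoint unions gives one inequality. For the other, a bounded [C] in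
    the union is decomposed by the sets [F i], and [mu] is countably additive inside [C]. *)
Lemma upper_variation_sigma_additive mu :
  semi_sigma_additive (upper_variation mu : set B_ -> \bar R).
Proof.
move=> F mF tF mUF.
have F0 i : (0 <= upper_variation mu (F i))%E by exact: upper_variation_ge0.
suff -> : upper_variation mu (\bigcup_i F i) =
    (\sum_(i <oo) upper_variation mu (F i))%E.
  by apply: is_cvg_ereal_nneg_natsum.
apply/eqP; rewrite eq_le; apply/andP; split; last first.
  apply: lime_le; first exact: is_cvg_ereal_nneg_natsum.
  apply: nearW => N; rewrite big_mkord.
  suff : (\sum_(i < N) upper_variation mu (F i) <=
      upper_variation mu (\big[setU/set0]_(i < N) F i))%E.
    move=> /le_trans; apply; apply: le_upper_variation.
    exact: bigsetU_bigcup.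
  elim: N => [|N ih]; first by rewrite !big_ord0 upper_variation0.
  rewrite !big_ord_recr/=; apply: le_trans (@upper_variationU _ _ _ _ _ _).
  - by rewrite leeD2r.
  - exact: (@bigsetU_measurable _ B_).
  - exact: mF.
  - rewrite -bigcup_mkord -subset0 => t [[i /= iN Fi] FN].
    by move: iN; rewrite (tF i N I I (ex_intro _ t (conj Fi FN))) ltnn.
apply: ge_ereal_sup => _ [C [bC CF] <-].
have mC : measurable (C : set B_) by exact: bC.1.
have h : ((fun N => \sum_(0 <= i < N) restr_lfsbm mu bC (F i `&` C))%E @ \oo
    --> (mu C)%:E)%E.
  have <- : restr_lfsbm mu bC (\bigcup_i (F i `&` C)) = (mu C)%:E.
    by rewrite -setI_bigcupl (setIidr CF) restr_lfsbmE.
  apply: (@charge_semi_sigma_additive _ _ _ (restr_lfsbm mu bC) (fun i => F i `&` C)).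
  - by move=> i; exact: (@measurableI _ B_).
  - exact: trivIset_setIr.
  - by rewrite -setI_bigcupl; exact: (@measurableI _ B_).
rewrite -(cvg_lim _ h)//; apply: lee_lim.
- by apply/cvg_ex; exists (mu C)%:E.
- exact: is_cvg_ereal_nneg_natsum.
apply: nearW => N; apply: lee_sum => i _; rewrite restr_lfsbmE; last exact: subIsetr.
apply: ereal_sup_ubound => /=; exists (F i `&` C) => //; split.
  exact: bounded_borelI.
exact: subIsetl.
Qed.

Lemma lower_variationE mu : lower_variation mu = upper_variation (scale_lfsbm (-1) mu).
Proof.
apply/funext => A; rewrite /lower_variation /upper_variation; congr ereal_sup.
by apply/seteqP; split=> _ [C hC <-]; exists C => //=; rewrite mulN1r.
Qed.

(** For a Hahn decomposition [P], [N] of the trace on [B], the two suprema are attained at the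
    intersections of [P] and [N] with [B]. *)
Lemma variation_charge mu B : bounded_borel B ->
  (mu B)%:E = (upper_variation mu B - lower_variation mu B)%E.
Proof.
move=> bB; have [P [N [[mP Ppos] [mN Nneg] PN PN0]]] :=
  Hahn_decomposition (restr_lfsbm mu bB).
have mB : measurable (B : set B_) by exact: bB.1.
have bP : bounded_borel (P `&` B) by exact: bounded_borelI.
have bN : bounded_borel (N `&` B) by exact: bounded_borelI.
have muI A : (mu (A `&` B))%:E = restr_lfsbm mu bB A by [].
have part C : measurable (C : set B_) ->
    restr_lfsbm mu bB C = (restr_lfsbm mu bB (C `&` P) + restr_lfsbm mu bB (C `&` N))%E.
  by move=> mC; exact: (@charge_partition _ _ _ (restr_lfsbm mu bB) C P N).
have diff A C : measurable (A : set B_) -> measurable (C : set B_) ->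
    restr_lfsbm mu bB A = (restr_lfsbm mu bB (A `\` C) + restr_lfsbm mu bB (A `&` C))%E.
  by move=> mA mC; exact: (@chargeDI _ B_ _ (restr_lfsbm mu bB) A C).
have -> : upper_variation mu B = (mu (P `&` B))%:E.
  apply/eqP; rewrite eq_le; apply/andP; split; last first.
    by apply: ereal_sup_ubound => /=; exists (P `&` B) => //; split => //; exact: subIsetr.
  apply: ge_ereal_sup => _ [C [[mC bC] CB] <-].
  rewrite -(@restr_lfsbmE mu _ _ bB CB) muI part// [leRHS](diff P C)//.
  rewrite addeC (setIC P C); apply: leeD => //.
  apply: (@le_trans _ _ 0%E); first by apply: Nneg => //; exact: (@measurableI _ B_).
  by apply: Ppos; [exact: (@measurableD _ B_)|exact: subDsetl].
have -> : lower_variation mu B = (- mu (N `&` B))%:E.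
  apply/eqP; rewrite eq_le; apply/andP; split; last first.
    by apply: ereal_sup_ubound => /=; exists (N `&` B) => //; split => //; exact: subIsetr.
  apply: ge_ereal_sup => _ [C [[mC bC] CB] <-].
  rewrite !EFinN leeN2 muI -(@restr_lfsbmE mu _ _ bB CB) (part C mC) (diff N C)//.
  rewrite [leRHS]addeC (setIC N C) [leLHS]addeC; apply: leeD => //.
  apply: (@le_trans _ _ 0%E); last by apply: Ppos => //; exact: (@measurableI _ B_).
  by apply: Nneg; [exact: (@measurableD _ B_)|exact: subDsetl].
rewrite -[in LHS](@restr_lfsbmE mu _ _ bB (@subset_refl _ B)) part//.
by rewrite /restr_lfsbm -!setIA !(setIC B) -!setIA !setIid EFinN oppeK.
Qed.

Lemma lower_variation_ge0 mu A : (0 <= lower_variation mu A)%E.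
Proof. by rewrite lower_variationE upper_variation_ge0. Qed.

Lemma lower_variation0 mu : lower_variation mu set0 = 0%E.
Proof. by rewrite lower_variationE upper_variation0. Qed.

Lemma lower_variation_sigma_additive mu :
  semi_sigma_additive (lower_variation mu : set B_ -> \bar R).
Proof. rewrite lower_variationE; exact: upper_variation_sigma_additive. Qed.

Lemma lower_variation_lty mu B : bounded_borel B ->
  (lower_variation mu B < +oo)%E.
Proof. by move=> bB; rewrite lower_variationE upper_variation_lty. Qed.

(** A constant to which the measure structure is attached, convertible with the set function in
    [lfsbm_integral]. *)
Definition upper_measure mu : set B_ -> \bar R := upper_variation mu.

Definition lower_measure mu : set B_ -> \bar R := lower_variation mu.

HB.instance Definition _ mu := isMeasure.Build _ B_ R (upper_measure mu)
  (upper_variation0 mu) (upper_variation_ge0 mu) (@upper_variation_sigma_additive mu).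

HB.instance Definition _ mu := isMeasure.Build _ B_ R (lower_measure mu)
  (lower_variation0 mu) (lower_variation_ge0 mu) (@lower_variation_sigma_additive mu).

End variation.

Section integral.
Context {R : realType} {n : nat}.
Implicit Types (mu : lfsbm R n) (A B S : set 'rV[R]_n) (f g : 'rV[R]_n -> R).
Local Notation B_ := (borel_rV R n).

(** Unlike the continuous functions with compact support, this class is stable under restriction to
    half-spaces and boxes, which is what the cuts require. *)
Definition test_fun (a : R) S f := [/\ bounded_borel S,
  measurable_fun setT (f : B_ -> R), forall t, `|f t| <= a &
  forall t, ~ S t -> f t = 0].

Lemma test_fun_integrable (nu : {measure set B_ -> \bar R}) a S f :
  test_fun a S f -> (nu S < +oo)%E -> nu.-integrable setT (EFin \o f).
Proof.
move=> [[mS _] mf fa fS] Soo.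
have -> : EFin \o f = (EFin \o f) \_ S.
  by apply/funext => t; rewrite patchE; case: ifPn => //; rewrite notin_setE => /fS /= ->.
rewrite -integrable_mkcond//; apply: measurable_bounded_integrable => //.
  exact: measurable_funTS.
by exists a; split; [exact: num_real|move=> x ax t _; exact: le_trans (fa t) (ltW ax)].
Qed.

Lemma test_fun_integral_le (nu : {measure set B_ -> \bar R}) a S f :
  test_fun a S f -> (nu S < +oo)%E ->
  (\int[nu]_t `|(f t)%:E| <= a%:E * nu S)%E.
Proof.
move=> [[mS _] mf fa fS] Soo.
have a0 : 0 <= a by exact: le_trans (normr_ge0 _) (fa 0).
apply: (@le_trans _ _ (\int[nu]_t (cst a%:E \_ S) t)%E).
  apply: ge0_le_integral => //.
  - by apply/measurable_EFinP; exact: measurableT_comp.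
  - by apply/(measurable_restrictT _ _).1 => //; exact: measurable_cst.
  - move=> t _; rewrite patchE; case: ifPn => [_|]; first by rewrite lee_fin.
    by rewrite notin_setE => /fS ->; rewrite abse0.
by rewrite -integral_mkcond integral_cst.
Qed.

Lemma lfsbm_integralE mu f : lfsbm_integral mu f =
  (\int[upper_measure mu]_t f t - \int[lower_measure mu]_t f t)%R.
Proof. by []. Qed.

Lemma test_fun_upper mu a S f : test_fun a S f ->
  (upper_measure mu).-integrable setT (EFin \o f).
Proof.
move=> tf; apply: test_fun_integrable (tf) _; apply: upper_variation_lty.
by case: tf.
Qed.

Lemma test_fun_lower mu a S f : test_fun a S f ->
  (lower_measure mu).-integrable setT (EFin \o f).
Proof.
move=> tf; apply: test_fun_integrable (tf) _; apply: lower_variation_lty.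
by case: tf.
Qed.

Lemma lfsbm_integralD mu a b S T f g : test_fun a S f -> test_fun b T g ->
  lfsbm_integral mu (fun t => f t + g t) = lfsbm_integral mu f + lfsbm_integral mu g.
Proof.
move=> tf tg; rewrite !lfsbm_integralE !RintegralD//.
- by rewrite opprD addrACA.
- exact: test_fun_lower tf.
- exact: test_fun_lower tg.
- exact: test_fun_upper tf.
- exact: test_fun_upper tg.
Qed.

Lemma lfsbm_integralZ mu a S f c : test_fun a S f ->
  lfsbm_integral mu (fun t => c * f t) = c * lfsbm_integral mu f.
Proof.
move=> tf; rewrite !lfsbm_integralE !RintegralZl//; first by rewrite mulrBr.
- exact: test_fun_lower tf.
- exact: test_fun_upper tf.
Qed.

Lemma lfsbm_integral_le mu a S f : test_fun a S f ->
  ((`|lfsbm_integral mu f|)%:E <= a%:E * lfsbm_variation mu S)%E.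
Proof.
move=> tf; have [bS mf fa fS] := tf.
have a0 : 0 <= a by exact: le_trans (normr_ge0 _) (fa 0).
rewrite /lfsbm_variation ge0_muleDr ?upper_variation_ge0 ?lower_variation_ge0//.
rewrite lfsbm_integralE; apply: (@le_trans _ _
  ((`|\int[upper_measure mu]_t f t|)%:E + (`|\int[lower_measure mu]_t f t|)%:E)%E).
  by rewrite -EFinD lee_fin ler_normB.
apply: leeD.
  rewrite EFin_normr_Rintegral//; last exact: test_fun_upper tf.
  apply: le_trans (@test_fun_integral_le (upper_measure mu) _ _ _ tf (upper_variation_lty mu bS)).
  by apply: le_abse_integral => //; exact/measurable_EFinP.
rewrite EFin_normr_Rintegral//; last exact: test_fun_lower tf.
apply: le_trans (@test_fun_integral_le (lower_measure mu) _ _ _ tf (lower_variation_lty mu bS)).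
by apply: le_abse_integral => //; exact/measurable_EFinP.
Qed.

Lemma lfsbm_variation_lty mu S : bounded_borel S -> (lfsbm_variation mu S < +oo)%E.
Proof.
by move=> bS; rewrite lte_add_pinfty ?upper_variation_lty ?lower_variation_lty.
Qed.

Lemma lfsbm_variation_ge0 mu S : (0 <= lfsbm_variation mu S)%E.
Proof. by rewrite adde_ge0 ?upper_variation_ge0 ?lower_variation_ge0. Qed.

Lemma lfsbm_variationS mu S T : S `<=` T ->
  (lfsbm_variation mu S <= lfsbm_variation mu T)%E.
Proof.
by move=> ST; apply: leeD; [|rewrite !lower_variationE]; exact: le_upper_variation.
Qed.

Lemma lfsbm_integral_le_fine mu a S f : test_fun a S f ->
  `|lfsbm_integral mu f| <= a * fine (lfsbm_variation mu S).
Proof.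
move=> tf; have := lfsbm_integral_le mu tf; rewrite -{1}[lfsbm_variation mu S]fineK//.
by rewrite ge0_fin_numE ?lfsbm_variation_ge0// lfsbm_variation_lty//; case: tf.
Qed.

Lemma lfsbm_integral_indic mu A : bounded_borel A -> lfsbm_integral mu \1_A = mu A.
Proof.
move=> bA; have mA : measurable (A : set B_) by exact: bA.1.
rewrite lfsbm_integralE /Rintegral !integral_indic// !setIT.
apply: EFin_inj; rewrite (@variation_charge _ _ mu A bA) EFinB.
rewrite !fineK//.
  by rewrite ge0_fin_numE ?lower_variation_lty// lower_variation_ge0.
by rewrite ge0_fin_numE ?upper_variation_lty// upper_variation_ge0.
Qed.

End integral.

(** * Integration of bounded functions with bounded support *)

Section test_fun.
Context {R : realType} {n : nat}.
Implicit Types (mu : lfsbm R n) (A B S T : set 'rV[R]_n) (f g : 'rV[R]_n -> R).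
Local Notation B_ := (borel_rV R n).

Lemma test_funS a b S T f : test_fun a S f -> a <= b -> S `<=` T ->
  bounded_borel T -> test_fun b T f.
Proof.
move=> [_ mf fa fS] ab ST bT; split=> // [t|t Tt].
  exact: le_trans (fa t) ab.
by apply: fS => /ST.
Qed.

Lemma test_fun_ge0 a S f : test_fun a S f -> 0 <= a.
Proof. by move=> [_ _ fa _]; exact: le_trans (normr_ge0 _) (fa 0). Qed.

Lemma test_funZ c a S f : test_fun a S f -> test_fun (`|c| * a) S (fun t => c * f t).
Proof.
move=> [bS mf fa fS]; split=> // [|t|t /fS ->]; last by rewrite mulr0.
  exact: measurable_funM.
by rewrite normrM ler_wpM2l.
Qed.

Lemma test_funD a b S f g : test_fun a S f -> test_fun b S g ->
  test_fun (a + b) S (fun t => f t + g t).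
Proof.
move=> [bS mf fa fS] [_ mg gb gS]; split=> // [|t|t St].
- exact: measurable_funD.
- by rewrite (le_trans (ler_normD _ _))// lerD.
- by rewrite fS// gS// addr0.
Qed.

Lemma test_fun_restr a S A f : test_fun a S f -> measurable (A : set B_) ->
  test_fun a (S `&` A) (fun t => f t * \1_A t).
Proof.
move=> tf mA; have a0 := test_fun_ge0 tf.
move: tf => [bS mf fa fS]; split=> // [||t|t].
- by rewrite setIC; exact: bounded_borelI.
- exact: measurable_funM.
- rewrite indicE; case: (t \in A); rewrite ?mulr1//.
  by rewrite mulr0 normr0.
- move=> /not_andP[/fS ->|At]; first by rewrite mul0r.
  by rewrite indicE memNset// mulr0.
Qed.

Lemma test_fun_indic S A : bounded_borel S -> measurable (A : set B_) -> A `<=` S ->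
  test_fun 1 S \1_A.
Proof.
move=> bS mA AS; split=> // t; rewrite indicE.
  by case: (t \in A); rewrite ?normr1 ?normr0.
by move=> St; rewrite memNset// => /AS.
Qed.

Lemma test_fun_sum S m (c : 'I_m -> R) (A : 'I_m -> set 'rV[R]_n) :
  bounded_borel S -> (forall i, measurable (A i : set B_) /\ A i `<=` S) ->
  test_fun (\sum_i `|c i|) S (fun t => \sum_i c i * \1_(A i) t).
Proof.
move=> bS; elim: m c A => [|m ih] c A hA.
  rewrite (_ : (fun _ => _) = cst 0); first by split=> // t; rewrite big_ord0 normr0.
  by apply/funext => t; rewrite big_ord0.
rewrite big_ord_recl (_ : (fun _ => _) = (fun t => c ord0 * \1_(A ord0) t +
  \sum_i c (lift ord0 i) * \1_(A (lift ord0 i)) t)); last first.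
  by apply/funext => t; rewrite big_ord_recl.
apply: test_funD; last exact: ih.
rewrite -[X in test_fun X _ _]mulr1; apply: test_funZ.
by have [mA AS] := hA ord0; exact: test_fun_indic.
Qed.

Lemma test_fun_step a S f (e : R) : test_fun a S f -> 0 < e ->
  exists m (c : 'I_m -> R) (A : 'I_m -> set 'rV[R]_n),
    (forall i, measurable (A i : set B_) /\ A i `<=` S) /\
    test_fun e S (fun t => f t - \sum_i c i * \1_(A i) t).
Proof.
move=> tf e0; have a0 := test_fun_ge0 tf; have [bS mf fa fS] := tf.
have mS : measurable (S : set B_) by exact: bS.1.
(* The levels [c i] run from [- M * e] to [(M - 1) * e] in steps of [e]; since [a < M * e], their
   intervals cover the range of [f]. *)
pose M := (Num.truncn (a / e)).+1.
have aM : a < M%:R * e by rewrite -ltr_pdivrMr// truncnS_gt.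
pose c (i : 'I_(M + M)) : R := (i%:R - M%:R) * e.
pose A (i : 'I_(M + M)) := S `&` (f : B_ -> R) @^-1` `[c i, c i + e[%classic.
have mA i : measurable (A i : set B_).
  apply: (@measurableI _ B_) => //; rewrite -[X in measurable X]setTI.
  by apply: mf => //; exact: measurable_itv.
have AS i : A i `<=` S by exact: subIsetl.
exists (M + M)%N, c, A; split=> //.
have mg := test_fun_sum c bS (fun i => conj (mA i) (AS i)).
have fsum t : S t -> exists2 i, \sum_i c i * \1_(A i) t = c i & c i <= f t < c i + e.
  move=> St; pose k := Num.truncn ((f t + M%:R * e) / e).
  have fM : 0 <= (f t + M%:R * e) / e.
    rewrite divr_ge0// ?(ltW e0)//.
    have := fa t; rewrite ler_norml => /andP[af _].
    by rewrite -lerBlDr sub0r (le_trans _ af)// lerN2 ltW.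
  have kM : (k < M + M)%N.
    rewrite truncn_lt_nat// ltr_pdivrMr// natrD mulrDl ltrD2r.
    by rewrite (le_lt_trans _ aM)// (le_trans (ler_norm _)).
  have hk : c (Ordinal kM) <= f t < c (Ordinal kM) + e.
    have := truncn_itv fM; rewrite -/k ler_pdivlMr// ltr_pdivrMr// -natr1 /c/=.
    by move=> /andP[h1 h2]; apply/andP; split; lra.
  exists (Ordinal kM) => //.
  rewrite (bigD1 (Ordinal kM))//= big1 ?addr0; last first.
    move=> i ik; rewrite indicE memNset ?mulr0//; move=> [_ /=].
    rewrite in_itv/= => hi; move/negP: ik; apply; apply/eqP/val_inj => /=.
    have : forall j1 j2 : nat, (j1%:R - M%:R) * e <= f t -> f t < (j2%:R - M%:R) * e + e -> (j1 <= j2)%N.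
      move=> j1 j2 h1 h2; have : (j1%:R - j2.+1%:R) * e < 0 by rewrite -natr1; lra.
      by rewrite pmulr_llt0// subr_lt0 ltr_nat.
    move=> hj; apply/eqP; rewrite eqn_leq; case/andP: hi => hi1 hi2; case/andP: hk => hk1 hk2.
    by rewrite (hj _ _ hi1 hk2) (hj _ _ hk1 hi2).
  rewrite indicE mem_set ?mulr1//; split=> //=; by rewrite in_itv/=.
split=> // [|t|t St].
- by apply: measurable_funB => //; case: mg.
- have [St|St] := pselect (S t).
    have [i -> /andP[h1 h2]] := fsum _ St.
    by rewrite ger0_norm ?subr_ge0// lerBlDl ltW.
  rewrite fS// sub0r normrN big1 ?normr0 ?ltW// => i _.
  by rewrite indicE memNset ?mulr0// => /AS.
- rewrite fS// sub0r big1 ?oppr0// => i _.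
  by rewrite indicE memNset ?mulr0// => /AS.
Qed.

(** The device behind the identities between integrals against different signed measures: their
    difference is a bounded linear functional of [f], so it vanishes once it vanishes on
    indicators. *)
Lemma test_fun_functional0 S (F : ('rV[R]_n -> R) -> R) (K : R) :
  bounded_borel S ->
  (forall a b f g, test_fun a S f -> test_fun b S g ->
    F (fun t => f t + g t) = F f + F g) ->
  (forall a f c, test_fun a S f -> F (fun t => c * f t) = c * F f) ->
  (forall a f, test_fun a S f -> `|F f| <= K * a) ->
  (forall A, bounded_borel A -> A `<=` S -> F \1_A = 0) ->
  forall a f, test_fun a S f -> F f = 0.
Proof.
move=> bS FD FZ FK F1 a f tf.
have Fsum m (c : 'I_m -> R) (A : 'I_m -> set 'rV[R]_n) :
    (forall i, measurable (A i : set B_) /\ A i `<=` S) ->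
    F (fun t => \sum_i c i * \1_(A i) t) = 0.
  elim: m c A => [|m ih] c A hA.
    rewrite (_ : (fun _ => _) = (fun t => 0 * (\1_set0 : _ -> R) t)); last first.
      by apply/funext => t; rewrite big_ord0 mul0r.
    rewrite (FZ 1) ?mul0r//; apply: test_fun_indic => //.
  rewrite (_ : (fun _ => _) = (fun t => c ord0 * \1_(A ord0) t +
    \sum_i c (lift ord0 i) * \1_(A (lift ord0 i)) t)); last first.
    by apply/funext => t; rewrite big_ord_recl.
  have [mA AS] := hA ord0; have tA := test_fun_indic bS mA AS.
  rewrite (FD _ _ _ _ (test_funZ (c ord0) tA) (test_fun_sum _ bS (fun i => hA _))).
  rewrite ih// addr0 (FZ _ _ _ tA) F1 ?mulr0//.
  exact: bounded_borelS AS.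
apply/eqP; rewrite -normr_le0; apply/ler_addgt0Pr => e e0.
have [m [c [A [hA tg]]]] := test_fun_step tf (divr_gt0 e0 (ltr_pwDr ltr01 (normr_ge0 K))).
rewrite add0r (_ : f = (fun t => f t - \sum_i c i * \1_(A i) t +
   \sum_i c i * \1_(A i) t)); last by apply/funext => t; rewrite subrK.
rewrite (FD _ _ _ _ tg (test_fun_sum c bS hA)) Fsum// addr0.
apply: le_trans (FK _ _ tg) _; rewrite mulrA ler_pdivrMr; last first.
  by rewrite ltr_pwDr.
rewrite mulrC ler_wpM2l ?(ltW e0)// (le_trans (ler_norm _))// lerDl//.
Qed.

(** A negative [c] exchanges the two variations, so the identity is checked on indicators and not on
    each variation. *)
Lemma lfsbm_integral_scale (c : R) mu a S f : test_fun a S f ->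
  lfsbm_integral (scale_lfsbm c mu) f = c * lfsbm_integral mu f.
Proof.
move=> tf; have bS : bounded_borel S by case: tf.
apply/eqP; rewrite -subr_eq0; apply/eqP.
apply: (@test_fun_functional0 S (fun f => lfsbm_integral (scale_lfsbm c mu) f - c * lfsbm_integral mu f)
  (fine (lfsbm_variation (scale_lfsbm c mu) S) + `|c| * fine (lfsbm_variation mu S)) bS _ _ _ _ a f tf).
- move=> b d g h tg th; rewrite !(lfsbm_integralD _ tg th); lra.
- by move=> b g d tg; rewrite !(lfsbm_integralZ _ _ tg); lra.
- move=> b g tg; rewrite (le_trans (ler_normB _ _))// mulrDl; apply: lerD.
    by rewrite mulrC; exact: lfsbm_integral_le_fine.
  by rewrite normrM -mulrA ler_wpM2l// mulrC; exact: lfsbm_integral_le_fine.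
- by move=> A bA AS; rewrite !lfsbm_integral_indic//= subrr.
Qed.

Lemma measurable_fun_perm_shift s (v : 'rV[R]_n) :
  measurable_fun setT (perm_shift s v : B_ -> B_).
Proof.
apply: (@measurability _ _ B_ B_ setT _ open) => // _ [U oU <-].
rewrite setTI; apply: sub_sigma_algebra.
by apply: open_comp => // t _; exact: continuous_perm_shift.
Qed.

Lemma preimage_perm_shift s v A : perm_shift s v @^-1` A =
  perm_shift s^-1%g (- \row_j v ord0 (s^-1%g j)) @` A.
Proof.
apply/seteqP; split=> [t At|_ [t At <-]] /=; last by rewrite perm_shiftVK.
by exists (perm_shift s v t) => //; rewrite perm_shiftK.
Qed.

Lemma bounded_borel_preimage_perm_shift s v A :
  bounded_borel A -> bounded_borel (perm_shift s v @^-1` A).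
Proof. by rewrite preimage_perm_shift; exact: bounded_borel_perm_shift. Qed.

Lemma test_fun_perm_shift s v a S f : test_fun a S f ->
  test_fun a (perm_shift s v @^-1` S) (f \o perm_shift s v).
Proof.
move=> [bS mf fa fS]; split => [|||t St].
- exact: bounded_borel_preimage_perm_shift.
- by apply: (measurableT_comp mf); exact: measurable_fun_perm_shift.
- by move=> t; exact: fa.
- exact: fS.
Qed.

Lemma lfsbm_integral_reparam s v mu a S f : test_fun a S f ->
  lfsbm_integral (reparam s v mu) (f \o perm_shift s v) = lfsbm_integral mu f.
Proof.
move=> tf; have bS : bounded_borel S by case: tf.
apply/eqP; rewrite -subr_eq0; apply/eqP.
apply: (@test_fun_functional0 S (fun f =>
    lfsbm_integral (reparam s v mu) (f \o perm_shift s v) - lfsbm_integral mu f)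
  (fine (lfsbm_variation (reparam s v mu) (perm_shift s v @^-1` S)) +
   fine (lfsbm_variation mu S)) bS _ _ _ _ a f tf).
- move=> b d g h tg th; rewrite !(lfsbm_integralD _ tg th)/=.
  by rewrite (lfsbm_integralD _ (test_fun_perm_shift s v tg) (test_fun_perm_shift s v th)); lra.
- move=> b g d tg; rewrite !(lfsbm_integralZ _ _ tg)/=.
  by rewrite (lfsbm_integralZ _ _ (test_fun_perm_shift s v tg)); lra.
- move=> b g tg; rewrite (le_trans (ler_normB _ _))// mulrDl.
  apply: lerD; rewrite mulrC; last exact: lfsbm_integral_le_fine.
  by apply: lfsbm_integral_le_fine; exact: test_fun_perm_shift.
- move=> A bA AS; rewrite lfsbm_integral_indic//.
  have -> : \1_A \o perm_shift s v = \1_(perm_shift s v @^-1` A) :> (_ -> R).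
    by apply/funext => t /=; rewrite !indicE.
  rewrite lfsbm_integral_indic; last exact: bounded_borel_preimage_perm_shift.
  rewrite /= (_ : [set _ | _ in _] = A) ?subrr//; apply/seteqP; split=> [_ [t At <-]//|t At].
  exists (perm_shift s^-1%g (- \row_j v ord0 (s^-1%g j)) t); last exact: perm_shiftVK.
  by rewrite /preimage/= perm_shiftVK.
Qed.

End test_fun.

(** * Measurability of evaluation and integration on the space of measures *)

Section measurability.
Context {R : realType} {n : nat}.
Implicit Types (mu : lfsbm R n.+1) (A B S T W : set 'rV[R]_n.+1) (f g : 'rV[R]_n.+1 -> R).
Local Notation B_ := (borel_rV R n.+1).
Local Notation L_ := (lfsbm_space R n.+1).

Lemma measurable_lfsbm_integral_cc f : continuous f -> compactly_supported f ->
  measurable_fun setT (fun mu : L_ => lfsbm_integral mu f).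
Proof.
move=> cf sf _ Y mY; apply: sub_sigma_algebra; exists f => //.
by exists Y.
Qed.

Definition dist_compl W (t : 'rV[R]_n.+1) : R := inf [set `|t - y| | y in ~` W].

(** The infimum in [dist_compl] thus runs over a nonempty set, the dimension being positive. *)
Lemma bounded_compl W : bounded_set W -> exists y, ~ W y.
Proof.
move=> /bounded_setP[M WM]; pose y : 'rV[R]_n.+1 := const_mx (`|M| + 1).
exists y => /WM; apply/negP; rewrite -ltNge.
have : `|y ord0 ord0| <= `|y|.
  by rewrite [leRHS]/Num.norm/= mx_normrE; exact: (le_bigmax _ _ (ord0, ord0)).
apply: lt_le_trans; rewrite mxE ger0_norm ?addr_ge0//.
by rewrite (le_lt_trans (ler_norm M))// ltrDl.
Qed.

Lemma dist_compl_inf W t : bounded_set W -> has_inf [set `|t - y| | y in ~` W].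
Proof.
move=> /bounded_compl[y Wy]; split; first by exists `|t - y|, y.
by exists 0 => _ [z _ <-].
Qed.

Lemma dist_compl_ge0 W t : bounded_set W -> 0 <= dist_compl W t.
Proof.
move=> bW; apply: lb_le_inf; first exact: (dist_compl_inf t bW).1.
by move=> _ [z _ <-].
Qed.

Lemma dist_compl_out W t : bounded_set W -> ~ W t -> dist_compl W t = 0.
Proof.
move=> bW Wt; apply/eqP; rewrite eq_le dist_compl_ge0// andbT.
apply: ge_inf; first exact: (dist_compl_inf t bW).2.
by exists t => //; rewrite subrr normr0.
Qed.

Lemma dist_compl_in W t : bounded_set W -> open W -> W t -> 0 < dist_compl W t.
Proof.
move=> bW oW Wt; have /nbhs_ballP[e/= e0 eW] : nbhs t W by exact: open_nbhs_nbhs.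
apply: (lt_le_trans e0); apply: lb_le_inf; first exact: (dist_compl_inf t bW).1.
move=> _ [y Wy <-]; rewrite leNgt; apply/negP => ye; apply: Wy; apply: eW.
by rewrite -ball_normE /=.
Qed.

Lemma dist_compl_lip W t u : bounded_set W ->
  `|dist_compl W t - dist_compl W u| <= `|t - u|.
Proof.
move=> bW.
have h a b : dist_compl W a <= dist_compl W b + `|a - b|.
  rewrite -lerBlDr; apply: lb_le_inf; first exact: (dist_compl_inf b bW).1.
  move=> _ [y Wy <-]; rewrite lerBlDr.
  apply: (@le_trans _ _ `|a - y|).
    by apply: ge_inf; [exact: (dist_compl_inf a bW).2|exists y].
  by rewrite -[a - y](subrKA b) addrC (le_trans (ler_normD _ _))// addrC.
rewrite ler_norml; apply/andP; split.
  by have := h u t; rewrite -(distrC t); lra.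
by have := h t u; lra.
Qed.

(** For a bounded open [W], continuous functions that increase to the indicator of [W] as [k]
    grows. *)
Definition open_approx W (k : nat) (t : 'rV[R]_n.+1) : R :=
  Num.min 1 (k%:R * dist_compl W t).

Lemma lipschitz_continuous (f : 'rV[R]_n.+1 -> R) (K : R) :
  (forall t u, `|f t - f u| <= K * `|t - u|) -> continuous f.
Proof.
move=> fK t; apply/(@cvgrPdist_lt _ _ _ _ (nbhs_filter t)) => e e0.
have K0 : 0 < `|K| + 1 by rewrite ltr_pwDr.
apply: filterS (nbhsx_ballx t (e / (`|K| + 1)) (divr_gt0 e0 K0)) => u.
rewrite -ball_normE /= ltr_pdivlMr// mulrC; apply: le_lt_trans.
by rewrite (le_trans (fK _ _))// ler_wpM2r// (le_trans (ler_norm K))// lerDl.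
Qed.

Lemma continuous_open_approx W k : bounded_set W -> continuous (open_approx W k).
Proof.
move=> bW; apply: (@lipschitz_continuous _ k%:R) => t u.
rewrite /open_approx; set x := k%:R * dist_compl W t; set y := k%:R * dist_compl W u.
have : `|x - y| <= k%:R * `|t - u|.
  by rewrite -mulrBr normrM ger0_norm// ler_wpM2l// dist_compl_lip.
apply: le_trans; have := ler_norm (x - y); have := ler_norm (y - x).
rewrite distrC ler_norml.
have xy0 : 0 <= `|x - y| by [].
by rewrite !minEle; case: ifP; case: ifP => *; apply/andP; split; lra.
Qed.

Lemma continuous_borel f : continuous f -> measurable_fun setT (f : B_ -> R).
Proof.
move=> cf; apply: (measurability _ (RGenOpens.measurableE R)).
move=> _ [_ [a [b ->] <-]]; rewrite setTI; apply: sub_sigma_algebra.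
by apply: open_comp => [t _|]; [exact: cf|exact: interval_open].
Qed.

Lemma open_approx_test W k : bounded_borel W -> test_fun 1 W (open_approx W k).
Proof.
move=> bbW; have bW := bbW.2; split => //.
- by apply: continuous_borel; exact: continuous_open_approx.
- move=> t; rewrite ger0_norm ?ge_min ?lexx// le_min ler01/=.
  by rewrite mulr_ge0// dist_compl_ge0.
- by move=> t Wt; rewrite /open_approx dist_compl_out// mulr0 min_r.
Qed.

Lemma open_approx_cc W k : bounded_set W -> compactly_supported (open_approx W k).
Proof.
move=> bW; have /bounded_setP[M WM] := bW.
have WB : closure [set t | open_approx W k t != 0] `<=` closed_ball_ Num.norm (0 : 'rV[R]_n.+1) (`|M| + 1).
  apply: (@subset_trans _ (closure (closed_ball_ Num.norm (0 : 'rV[R]_n.+1) (`|M| + 1)))).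
    apply: closure_subset => t /= ht; rewrite /closed_ball_/= sub0r normrN.
    rewrite (@le_trans _ _ M)//; last by rewrite (le_trans (ler_norm M))// lerDl.
    apply: WM; apply: contrapT => Wt; move/negP: ht; apply.
    by rewrite /open_approx dist_compl_out// mulr0 min_r.
  by rewrite -(proj1 (closure_id _) (@closed_closed_ball_ _ _ _ _)).
apply: bounded_closed_compact; last exact: closed_closure.
apply/bounded_setP; exists (`|M| + 1) => t /WB; rewrite /closed_ball_/= sub0r normrN.
by [].
Qed.

Lemma cvg_Rintegral_test (nu : {measure set B_ -> \bar R}) a S
    (h : nat -> 'rV[R]_n.+1 -> R) f :
  (nu S < +oo)%E -> (forall k, test_fun a S (h k)) -> test_fun a S f ->
  (forall t, h k t @[k --> \oo] --> f t) ->
  (\int[nu]_t h k t)%R @[k --> \oo] --> (\int[nu]_t f t)%R.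
Proof.
move=> Soo th tf hf; have a0 := test_fun_ge0 tf; have [bS mf fa fS] := tf.
have := @dominated_convergence _ B_ R nu setT measurableT
  (fun k t => (h k t)%:E) (EFin \o f) (EFin \o (fun t => a * \1_S t)).
case.
- by move=> k; apply/measurable_EFinP; case: (th k).
- exact/measurable_EFinP.
- by apply: aeW => t _; apply: cvg_EFin; [exact: nearW|exact: hf].
- apply: (@test_fun_integrable _ _ nu a S) => //; split=> // [|t|t St].
  + by apply: measurable_funM => //; apply: measurable_indic; exact: bS.1.
  + rewrite normrM (ger0_norm a0) -[leRHS]mulr1 ler_wpM2l// indicE.
    by case: (t \in S); rewrite ?normr1 ?normr0.
  + by rewrite indicE memNset// mulr0.
- apply: aeW => t k _; rewrite lee_fin indicE.
  have [_ _ ha hS] := th k.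
  have [St|St] := pselect (S t); first by rewrite mem_set// mulr1 ha.
  by rewrite memNset// mulr0 hS// normr0.
move=> fi _ hc.
have fin : (\int[nu]_t (f t)%:E)%E \is a fin_num by exact: integrable_fin_num.
by move: hc; rewrite /= -(fineK fin) => /fine_cvgP[_].
Qed.

Lemma cvg_lfsbm_integral mu a S (h : nat -> 'rV[R]_n.+1 -> R) f :
  (forall k, test_fun a S (h k)) -> test_fun a S f ->
  (forall t, h k t @[k --> \oo] --> f t) ->
  lfsbm_integral mu (h k) @[k --> \oo] --> lfsbm_integral mu f.
Proof.
move=> th tf hf; have bS : bounded_borel S by case: tf.
apply: cvgB.
  by apply: (cvg_Rintegral_test (nu := upper_measure mu) _ th tf hf); exact: upper_variation_lty.
by apply: (cvg_Rintegral_test (nu := lower_measure mu) _ th tf hf); exact: lower_variation_lty.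
Qed.

Lemma measurable_lfsbm_open W : bounded_set W -> open W ->
  measurable_fun setT (fun mu : L_ => mu W).
Proof.
move=> bW oW; have bbW : bounded_borel W.
  by split => //; exact: sub_sigma_algebra.
apply: (@measurable_fun_cvg _ L_ R setT
  (fun k (mu : L_) => lfsbm_integral mu (open_approx W k))).
  move=> k; apply: measurable_lfsbm_integral_cc.
    exact: continuous_open_approx.
  exact: open_approx_cc.
move=> mu _; rewrite -(lfsbm_integral_indic mu bbW).
apply: (@cvg_lfsbm_integral _ 1 W).
- by move=> k; exact: open_approx_test.
- by apply: test_fun_indic => //; exact: bbW.1.
move=> t; rewrite indicE; have [Wt|Wt] := pselect (W t); last first.
  rewrite memNset//= (_ : (fun k => _) = fun=> 0); first exact: cvg_cst.
  by apply/funext => k; rewrite /open_approx dist_compl_out// mulr0 min_r.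
rewrite mem_set//=; have d0 := dist_compl_in bW oW Wt.
apply: cvg_near_cst; near=> k; rewrite /open_approx min_l//.
rewrite -ler_pdivrMr//; near: k; exact: nbhs_infty_ger.
Unshelve. all: by end_near. Qed.

(** Dynkin's argument from open sets. All sets are cut with a ball [W] containing [A], because [mu]
    can be applied to complements and countable unions only inside a bounded set. *)
Lemma measurable_lfsbm_val A : bounded_borel A ->
  measurable_fun setT (fun mu : L_ => mu A).
Proof.
move=> bA; have /bounded_setP[M AM] := bA.2.
pose W : set 'rV[R]_n.+1 := ball (0 : 'rV[R]_n.+1) (`|M| + 1).
have oW : open W by exact: ball_open.
have bW : bounded_set W.
  apply/bounded_setP; exists (`|M| + 1) => t; rewrite /W -ball_normE/= sub0r normrN.
  exact: ltW.
have bbW : bounded_borel W by split=> //; exact: sub_sigma_algebra.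
have AW : A `<=` W.
  move=> t /AM tM; rewrite /W -ball_normE/= sub0r normrN (le_lt_trans tM)//.
  by rewrite (le_lt_trans (ler_norm M))// ltrDl.
rewrite -(setIidl AW).
apply: (@dynkin_induction _ B_ open
  (fun A : set B_ => measurable_fun setT (fun mu : L_ => mu (A `&` W)))) => //.
- by move=> U V; exact: openI.
- by rewrite setTI; exact: measurable_lfsbm_open.
- move=> U oU; apply: measurable_lfsbm_open; last exact: openI.
  by apply: (bounded_borelI _ bbW).2; exact: sub_sigma_algebra.
- move=> U mU hU.
  rewrite (_ : (fun _ => _) = (fun mu : L_ => mu W - mu (U `&` W))).
    by apply: measurable_funB => //; exact: measurable_lfsbm_open.
  apply/funext => mu; have bU := bounded_borelI mU bbW.
  have bC : bounded_borel (~` U `&` W).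
    by apply: bounded_borelI => //; exact: (@measurableC _ B_).
  apply/eqP; rewrite eq_sym subr_eq -lfsbmU//; last by rewrite setIACA setICl set0I.
  by rewrite -setIUl setvU setTI.
- move=> F mF tF hF.
  apply: (@measurable_fun_cvg _ L_ R setT
    (fun k (mu : L_) => \sum_(0 <= i < k) mu (F i `&` W))).
    by move=> k; apply: measurable_sum.
  move=> mu _; have := @lfsbm_charge _ _ mu _ bbW F mF tF (bigcupT_measurable _ mF).
  rewrite (_ : (fun _ => _) = (fun k => (\sum_(0 <= i < k) mu (F i `&` W))%:E)).
    by move=> /fine_cvgP[].
  by apply/funext => k; rewrite sumEFin.
- exact: bA.1.
Qed.

(** A uniform approximation of [f] by step functions is enough: for each fixed [mu] the error is
    controlled by the finite variation of [mu] on [S]. *)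
Lemma measurable_lfsbm_integral a S f : test_fun a S f ->
  measurable_fun setT (fun mu : L_ => lfsbm_integral mu f).
Proof.
move=> tf; have bS : bounded_borel S by case: tf.
have st (k : nat) : exists g, measurable_fun setT (fun mu : L_ => lfsbm_integral mu g) /\
    exists b, test_fun b S g /\ test_fun (k.+1%:R^-1) S (fun t => f t - g t).
  have k0 : 0 < k.+1%:R^-1 :> R by rewrite invr_gt0.
  have [m [c [A [hA tg]]]] := test_fun_step tf k0.
  have ts := test_fun_sum c bS hA.
  exists (fun t => \sum_i c i * \1_(A i) t); split; last first.
    by eexists; split; [exact: ts|exact: tg].
  rewrite (_ : (fun _ => _) = (fun mu : L_ => \sum_i c i * mu (A i))).
    apply: measurable_sum => i; apply: measurable_funM => //.
    apply: measurable_lfsbm_val; have [mA AS] := hA i.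
    exact: bounded_borelS AS.
  apply/funext => mu; clear -hA bS.
  elim: m c A hA => [|m ih] c A hA.
    rewrite big_ord0 (_ : (fun _ => _) = (fun t => 0 * (\1_set0 : _ -> R) t)); last first.
      by apply/funext => t; rewrite big_ord0 mul0r.
    rewrite (@lfsbm_integralZ _ _ _ 1 S) ?mul0r//; exact: test_fun_indic.
  rewrite (_ : (fun _ => _) = (fun t => c ord0 * \1_(A ord0) t +
    \sum_i c (lift ord0 i) * \1_(A (lift ord0 i)) t)); last first.
    by apply/funext => t; rewrite big_ord_recl.
  have [mA AS] := hA ord0; have tA := test_fun_indic bS mA AS.
  rewrite (lfsbm_integralD _ (test_funZ (c ord0) tA) (test_fun_sum _ bS (fun i => hA _))).
  rewrite ih// (lfsbm_integralZ _ _ tA) lfsbm_integral_indic ?big_ord_recl//.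
  exact: bounded_borelS AS.
have /choice[g hg] := st.
apply: (@measurable_fun_cvg _ L_ R setT (fun k (mu : L_) => lfsbm_integral mu (g k))).
  by move=> k; case: (hg k).
move=> mu _; apply/cvgrPdist_le => e e0; near=> k.
have [_ [b [tb tk]]] := hg k.
have -> : lfsbm_integral mu f - lfsbm_integral mu (g k) =
    lfsbm_integral mu (fun t => f t - g k t).
  rewrite -[in LHS](_ : (fun t => (f t - g k t) + g k t) = f).
    by rewrite (lfsbm_integralD _ tk tb) addrK.
  by apply/funext => t; rewrite subrK.
apply: le_trans (lfsbm_integral_le_fine mu tk) _.
rewrite mulrC ler_pdivrMr// mulrC -ler_pdivrMr//.
near: k; apply: filterS (nbhs_infty_ger (fine (lfsbm_variation mu S) / e)) => k hk.
by rewrite (le_trans hk)// ler_nat.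
Unshelve. all: by end_near. Qed.

Lemma bounded_setP0 (A : set R) : bounded_set A -> exists M : R, forall t, A t -> `|t| <= M.
Proof. by move=> [M [Mr AM]]; exists (M + 1) => t At; apply: AM At; rewrite ltrDl. Qed.

Lemma cc_test_fun f : continuous f -> compactly_supported f ->
  exists a, test_fun a (closure [set t | f t != 0]) f.
Proof.
move=> cf sf; have := continuous_compact (continuous_subspaceT cf) sf.
move=> /compact_bounded/bounded_setP0[a fa].
exists `|a|; split.
- split; last by have /compact_bounded := sf.
  rewrite -[X in measurable X]setCK; apply: (@measurableC _ B_).
  by apply: sub_sigma_algebra; exact/closed_openC/closed_closure.
- exact: continuous_borel.
- move=> t; have [ft0|ft0] := eqVneq (f t) 0; first by rewrite ft0 normr0.
  rewrite (le_trans _ (ler_norm a))// fa//; exists t => //.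
  exact: subset_closure.
- by move=> t ht; apply: contrapT => /eqP f0; apply: ht; exact: subset_closure.
Qed.

Lemma measurable_lfsbm_map (T : lfsbm R n.+1 -> lfsbm R n.+1) :
  (forall a S f, test_fun a S f ->
    measurable_fun setT (fun mu : L_ => lfsbm_integral (T mu) f)) ->
  measurable_fun setT (T : L_ -> L_).
Proof.
move=> hT; apply: (@measurability _ _ L_ L_ setT _ (@lfsbm_generators R n.+1)) => //.
move=> _ [_ [f [cf sf] [Y mY <-]] <-].
rewrite setTI setTI.
have [a tS] := cc_test_fun cf sf.
rewrite -[X in measurable X]setTI; exact: (hT _ _ _ tS).
Qed.

End measurability.

(** * Exponential inequalities *)

Section exp_inequalities.
Context {R : realType}.
Implicit Types x y z w : R.

(** Both values of the exponential lie above its tangent at the barycentre [m]. *)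
Lemma expR_convex p q x y : 0 < p -> 0 < q -> p^-1 + q^-1 = 1 ->
  expR (x / p + y / q) <= expR x / p + expR y / q.
Proof.
move=> p0 q0 pq; set m := x / p + y / q.
have hx : expR m * (1 + (x - m)) <= expR x.
  have -> : expR x = expR m * expR (x - m) by rewrite -expRD addrC subrK.
  by rewrite ler_wpM2l ?expR_ge0// expR_ge1Dx.
have hy : expR m * (1 + (y - m)) <= expR y.
  have -> : expR y = expR m * expR (y - m) by rewrite -expRD addrC subrK.
  by rewrite ler_wpM2l ?expR_ge0// expR_ge1Dx.
have pi0 : 0 <= p^-1 by rewrite invr_ge0 ltW.
have qi0 : 0 <= q^-1 by rewrite invr_ge0 ltW.
apply: le_trans (lerD (ler_wpM2r pi0 hx) (ler_wpM2r qi0 hy)).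
rewrite le_eqVlt; apply/orP; left; apply/eqP.
have -> : expR m * (1 + (x - m)) / p + expR m * (1 + (y - m)) / q =
  expR m * ((p^-1 + q^-1) * (1 - m) + m) by rewrite /m; ring.
by rewrite pq mul1r subrK mulr1.
Qed.

Lemma norm_expRB1 w : `|expR w - 1| <= `|w| * expR `|w|.
Proof.
have [w0|w0] := leP 0 w.
  rewrite !ger0_norm// ?subr_ge0 ?expR_ge1//; last first.
    by rewrite -[leLHS]expR0 ler_expR.
  have : expR w * (1 - w) <= 1.
    rewrite -[leRHS](expRxMexpNx_1 w) ler_wpM2l ?expR_ge0//.
    exact: expR_ge1Dx.
  by rewrite mulrBr mulr1 mulrC; lra.
rewrite ltr0_norm; last by rewrite subr_lt0 expR_lt1.
rewrite ltr0_norm// opprB; apply: (@le_trans _ _ (- w)).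
  have := expR_ge1Dx w; lra.
rewrite -[leLHS]mulr1 ler_wpM2l ?oppr_ge0 1?ltW//.
by rewrite expR_gt1 oppr_gt0.
Qed.

Lemma expR_taylor1 w : expR w <= 1 + w + w ^+ 2 * expR `|w|.
Proof.
have h : expR w - 1 - w <= w * (expR w - 1).
  have : expR w * (1 - w) <= 1.
    rewrite -[leRHS](expRxMexpNx_1 w) ler_wpM2l ?expR_ge0//.
    exact: expR_ge1Dx.
  by rewrite mulrBr mulr1 [expR w * w]mulrC mulrBr mulr1; lra.
have := le_trans (ler_norm _) (_ : `|w * (expR w - 1)| <= `|w| * (`|w| * expR `|w|)).
rewrite normrM => /(_ (ler_wpM2l (normr_ge0 _) (norm_expRB1 w))).
by rewrite mulrA -expr2 real_normK ?num_real//; lra.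
Qed.

(** The quadratic term of the series at [|x| / 2] is [x ^ 2 / 8]. Only half of the exponent is
    spent, the other half being left to the remainder in [expR_quadratic]. *)
Lemma sqr_le_expR x : x ^+ 2 <= 8 * expR (`|x| / 2).
Proof.
rewrite -(real_normK (num_real x)).
have := @expR_ge1Dxn R (`|x| / 2) 1; rewrite divr_ge0// => /(_ isT).
rewrite !factS fact0 expr_div_n; lra.
Qed.

Lemma expR_quadratic (a z : R) : 0 <= a -> a <= 2^-1 ->
  expR (a * z) <= 1 + a * z + 8 * a ^+ 2 * expR `|z|.
Proof.
move=> a0 a2; apply: le_trans (expR_taylor1 _) _; rewrite lerD2l exprMn.
have h : expR `|a * z| <= expR (`|z| / 2).
  by rewrite ler_expR normrM ger0_norm// mulrC ler_wpM2l.
have : z ^+ 2 * expR `|a * z| <= 8 * expR (`|z| / 2) * expR (`|z| / 2).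
  by apply: ler_pM; rewrite ?sqr_ge0 ?expR_ge0 ?sqr_le_expR.
rewrite -mulrA -expRD -splitr => /(ler_wpM2l (sqr_ge0 a)); lra.
Qed.

End exp_inequalities.

(** * Hoelder's inequality for exponentials, and products of independent variables *)

Section integral_facts.
Context d (T : measurableType d) (R : realType).

(** The splittability conditions integrate [expeR] of a variation, a supremum over uncountably many
    sets that is never shown to be measurable here. *)
Lemma le_integral_nonmeas (mu : {measure set T -> \bar R}) (f g : T -> \bar R) :
  (forall x, (0 <= f x)%E) -> (forall x, (f x <= g x)%E) ->
  (\int[mu]_x f x <= \int[mu]_x g x)%E.
Proof.
move=> f0 fg; have g0 x : (0 <= g x)%E by exact: le_trans (f0 x) (fg x).
rewrite !ge0_integralTE//; apply: ereal_sup_le => _ [h hf <-].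
by exists h => // x; exact: le_trans (hf x) (fg x).
Qed.

(** Condition (b) of splittability only says that an expectation is 0. This already excludes an
    infinite integral of the positive or negative part, since no difference with an infinite term
    equals 0 in [\bar R]. *)
Lemma integral0_integrable (mu : {measure set T -> \bar R}) (f : T -> R) :
  measurable_fun setT f -> (\int[mu]_x (f x)%:E = 0)%E ->
  mu.-integrable setT (EFin \o f).
Proof.
move=> mf; rewrite integralE => f0.
have mf' : measurable_fun setT (EFin \o f) by exact/measurable_EFinP.
have p0 : (0 <= \int[mu]_x ((EFin \o f) ^\+ x))%E by apply: integral_ge0.
have n0 : (0 <= \int[mu]_x ((EFin \o f) ^\- x))%E by apply: integral_ge0.
apply/integrableP; split => //.
have -> : (fun x => `|(EFin \o f) x|)%E = ((EFin \o f) ^\+ \+ (EFin \o f) ^\-)%E.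
  by rewrite -fune_abse.
rewrite ge0_integralD//; [|exact: measurable_funepos|exact: measurable_funeneg].
move: f0 p0 n0; rewrite /=.
by case: (\int[mu]_x _)%E => [r||]; case: (\int[mu]_x _)%E => [s||] //= _ _ _; rewrite ltry.
Qed.

Section real_integrable.
Variable mu : {measure set T -> \bar R}.
Implicit Types f g : T -> R.

Lemma integrableD_real f g : mu.-integrable setT (EFin \o f) ->
  mu.-integrable setT (EFin \o g) ->
  mu.-integrable setT (EFin \o (fun w => f w + g w)).
Proof. by move=> hf hg; have := integrableD measurableT hf hg. Qed.

Lemma integrableZ_real c f : mu.-integrable setT (EFin \o f) ->
  mu.-integrable setT (EFin \o (fun w => c * f w)).
Proof. by move=> hf; have := integrableZl measurableT c hf. Qed.

Lemma le_integrable_real f g : measurable_fun setT f -> (forall w, `|f w| <= g w) ->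
  mu.-integrable setT (EFin \o g) -> mu.-integrable setT (EFin \o f).
Proof.
move=> mf fg; apply: le_integrable => //; first exact/measurable_EFinP.
by move=> w _ /=; rewrite lee_fin (le_trans (fg w))// ler_norm.
Qed.

Lemma integral_fineK f : mu.-integrable setT (EFin \o f) ->
  (\int[mu]_w (f w)%:E = (\int[mu]_w f w)%R%:E)%E.
Proof. by move=> hf; rewrite /Rintegral fineK//; exact: integrable_fin_num. Qed.

Lemma ge0_integrable f (K : R) : measurable_fun setT f -> (forall w, 0 <= f w) ->
  (\int[mu]_w (f w)%:E <= K%:E)%E -> mu.-integrable setT (EFin \o f).
Proof.
move=> mf f0 hK; apply/integrableP; split; first exact/measurable_EFinP.
apply: le_lt_trans (ltry K); apply: le_trans hK.
by apply: le_integral_nonmeas => // w /=; rewrite ger0_norm.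
Qed.

End real_integrable.

Lemma integrable_cst_prob (P : probability T R) (c : R) :
  P.-integrable setT (EFin \o (fun=> c)).
Proof. exact: finite_measure_integrable_cst. Qed.

Lemma Rintegral_cst_prob (P : probability T R) (c : R) : (\int[P]_w c)%R = c.
Proof.
transitivity (c * fine (P setT)); first exact: Rintegral_cst.
by rewrite probability_setT mulr1.
Qed.

(** Young's inequality for [p * U - x] and [q * V - y], integrated. The given bounds take the place
    of the norms in the normalization. *)
Lemma expR_hoelder (P : {measure set T -> \bar R}) (U V : T -> R) (p q x y : R) :
  measurable_fun setT U -> measurable_fun setT V ->
  0 < p -> 0 < q -> p^-1 + q^-1 = 1 ->
  (\int[P]_w (expR (p * U w))%:E <= (expR x)%:E)%E ->
  (\int[P]_w (expR (q * V w))%:E <= (expR y)%:E)%E ->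
  (\int[P]_w (expR (U w + V w))%:E <= (expR (x / p + y / q))%:E)%E.
Proof.
move=> mU mV p0 q0 pq hU hV.
have me (W : T -> R) : measurable_fun setT W ->
    measurable_fun setT (fun w => (expR (W w))%:E).
  by move=> mW; apply/measurable_EFinP; exact: measurableT_comp.
have mc c (W : T -> R) : measurable_fun setT W -> measurable_fun setT (fun w => c * W w).
  by move=> mW; exact: measurable_funM.
set c := expR (x / p + y / q).
pose A w := ((c / p * expR (- x))%:E * (expR (p * U w))%:E)%E.
pose B w := ((c / q * expR (- y))%:E * (expR (q * V w))%:E)%E.
have cp0 : 0 <= c / p * expR (- x) by rewrite mulr_ge0 ?divr_ge0 ?expR_ge0// ltW.
have cq0 : 0 <= c / q * expR (- y) by rewrite mulr_ge0 ?divr_ge0 ?expR_ge0// ltW.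
have ex0 (r : R) : (0 <= (expR r)%:E)%E by rewrite lee_fin expR_ge0.
apply: (@le_trans _ _ (\int[P]_w (A w + B w))%E).
  apply: le_integral_nonmeas => // w; rewrite /A /B -!EFinM -EFinD lee_fin.
  have := expR_convex (p * U w - x) (q * V w - y) p0 q0 pq.
  have -> : (p * U w - x) / p + (q * V w - y) / q = U w + V w - (x / p + y / q).
    by field; rewrite !gt_eqF.
  move=> /(ler_wpM2l (expR_ge0 (x / p + y / q))); rewrite -expRD addrC subrK.
  move=> /le_trans; apply; rewrite (expRD (p * U w)) (expRD (q * V w)) -/c.
  by rewrite le_eqVlt; apply/orP; left; apply/eqP; ring.
rewrite ge0_integralD//; last first.
- by apply: emeasurable_funM => //; apply: me; exact: mc.
- by move=> w _; rewrite /B mule_ge0.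
- by apply: emeasurable_funM => //; apply: me; exact: mc.
- by move=> w _; rewrite /A mule_ge0.
rewrite /A /B !ge0_integralZl//; [|by apply: me; exact: mc|by apply: me; exact: mc].
apply: (@le_trans _ _ ((c / p * expR (- x))%:E * (expR x)%:E +
                       (c / q * expR (- y))%:E * (expR y)%:E)%E).
  by apply: leeD; apply: lee_pmul => //; apply: integral_ge0.
rewrite -!EFinM -EFinD lee_fin -!mulrA [expR (- x) * _]mulrC [expR (- y) * _]mulrC.
by rewrite !expRxMexpNx_1 !mulr1 -mulrDr pq mulr1.
Qed.

(** By uniqueness of the product measure the joint law is the product of the laws, and Tonelli's
    theorem applies. *)
Lemma integral_indep_mul (P : probability T R) (f g : T -> R) :
  measurable_fun setT f -> measurable_fun setT g ->
  (forall w, 0 <= f w) -> (forall w, 0 <= g w) ->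
  (forall A B : set R, measurable A -> measurable B ->
    P (f @^-1` A `&` g @^-1` B) = (P (f @^-1` A) * P (g @^-1` B))%E) ->
  (\int[P]_w (f w * g w)%:E = \int[P]_w (f w)%:E * \int[P]_w (g w)%:E)%E.
Proof.
move=> mf mg f0 g0 fg.
pose F : {mfun T >-> R} := mfun_Sub (mem_set mf).
pose G : {mfun T >-> R} := mfun_Sub (mem_set mg).
have mh : measurable_fun setT (fun w => (f w, g w)) by exact: measurable_fun_pair.
pose H : {mfun T >-> (R * R)%type} := mfun_Sub (mem_set mh).
have prodE := @product_measure_unique _ _ _ _ _ (distribution P F) (distribution P G)
  (distribution P H) fg.
(* Absolute values make [phi] nonnegative on the whole plane; on the values of [f] and [g] they
   change nothing. *)
pose phi (z : R * R) : \bar R := (`|z.1| * `|z.2|)%:E.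
have mphi : measurable_fun setT phi.
  apply/measurable_EFinP; apply: measurable_funM.
    by apply: measurableT_comp => //; exact: measurable_fst.
  by apply: measurableT_comp => //; exact: measurable_snd.
have phi0 z : (0 <= phi z)%E by rewrite lee_fin mulr_ge0.
have mn : measurable_fun setT (fun x : R => `|x|%:E) by apply/measurable_EFinP.
transitivity (\int[P]_w ((phi \o H) w))%E.
  by apply: eq_integral => w _; rewrite /phi/= !ger0_norm.
rewrite -(@ge0_integral_pushforward _ _ _ _ _ H _ P setT)//.
transitivity (\int[(distribution P F \x distribution P G)%E]_z phi z)%E.
  by apply: eq_measure_integral => A mA _; exact/esym/prodE.
rewrite fubini_tonelli1// /fubini_F.
transitivity (\int[distribution P F]_x (`|x|%:E * \int[distribution P G]_y `|y|%:E))%E.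
  apply: eq_integral => x _; rewrite -ge0_integralZl//.
rewrite ge0_integralZr//; last by apply: integral_ge0.
by congr (_ * _)%E; rewrite (@ge0_integral_pushforward _ _ _ _ _ _ _ P setT)//;
  apply: eq_integral => w _ /=; rewrite ger0_norm.
Qed.

End integral_facts.

(** * Exponential moments of random fields *)

Section fields.
Context {R : realType} {n : nat}.
Implicit Types (S : set 'rV[R]_n.+1) (f g : 'rV[R]_n.+1 -> R).
Local Notation B_ := (borel_rV R n.+1).
Local Notation L_ := (lfsbm_space R n.+1).

(** A relation instead of a number: an infinite moment simply has no bound. *)
Definition mgf_le d (T : measurableType d) (P : probability T R)
    (X : T -> lfsbm R n.+1) f (x : R) : Prop :=
  (\int[P]_w (expR (lfsbm_integral (X w) f))%:E <= (expR x)%:E)%E.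

Definition mean0 d (T : measurableType d) (P : probability T R)
    (X : T -> lfsbm R n.+1) : Prop :=
  forall A, bounded_borel A -> (\int[P]_w (X w A)%:E = 0)%E.

Lemma test_fun_unit a S f : test_fun a S f ->
  exists2 g, test_fun 1 S g & f = (fun t => a * g t).
Proof.
move=> tf; have bS : bounded_borel S by case: tf.
have := test_fun_ge0 tf; rewrite le_eqVlt => /orP[/eqP a0|a0].
  exists \1_set0; first exact: test_fun_indic.
  apply/funext => t; rewrite -a0 mul0r; apply/eqP.
  by case: tf => _ _ /(_ t) + _; rewrite -a0 normr_le0.
exists (fun t => a^-1 * f t).
  by have := test_funZ a^-1 tf; rewrite gtr0_norm ?invr_gt0// mulVf ?gt_eqF.
by apply/funext => t; rewrite mulrA mulfV ?mul1r ?gt_eqF.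
Qed.

Section one_field.
Context d (T : measurableType d) (P : probability T R) (X : T -> lfsbm R n.+1).
Hypothesis mX : random_field X.

Lemma measurable_field a S f : test_fun a S f ->
  measurable_fun setT (fun w => lfsbm_integral (X w) f).
Proof.
by move=> tf; apply: (measurableT_comp (measurable_lfsbm_integral tf) mX).
Qed.

Lemma measurable_field_val A : bounded_borel A ->
  measurable_fun setT (fun w => X w A).
Proof.
by move=> bA; apply: (measurableT_comp (measurable_lfsbm_val bA) mX).
Qed.

Lemma measurable_field_exp a S f : test_fun a S f ->
  measurable_fun setT (fun w => (expR (lfsbm_integral (X w) f))%:E).
Proof.
move=> tf; apply/measurable_EFinP; apply: measurableT_comp => //.
exact: measurable_field tf.
Qed.

Lemma mgf_gt0 a S f : test_fun a S f ->
  (0 < \int[P]_w (expR (lfsbm_integral (X w) f))%:E)%E.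
Proof.
move=> tf; rewrite lt_neqAle; apply/andP; split; last first.
  by apply: integral_ge0 => w _; rewrite lee_fin expR_ge0.
apply/negP => /eqP/esym h0.
have := @ae_eq_integral_abs _ T R P setT measurableT _ (measurable_field_exp tf).
move=> [] /(_ _) + _; rewrite (_ : (\int[P]_(x in _) _)%E = 0%E); last first.
  rewrite -[RHS]h0; apply: eq_integral => w _.
  by rewrite gee0_abs// lee_fin expR_ge0.
move=> /(_ erefl)[N [mN PN hN]].
have : setT `<=` N.
  apply: subset_trans hN => w _ /= /(_ I) /eqP.
  by rewrite eqe expR_eq0.
move=> TN; have : (P setT <= P N)%E by apply: le_measure; rewrite ?inE.
by rewrite PN probability_setT lee_fin ler10.
Qed.

Lemma integrable_mean0 : mean0 P X -> forall A, bounded_borel A ->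
  P.-integrable setT (fun w => (X w A)%:E).
Proof.
move=> X0 A bA; apply: (@integral0_integrable _ _ _ P (fun w => X w A)).
  exact: measurable_field_val.
exact: X0.
Qed.

(** The expectation is a linear functional of [f], bounded by the assumed estimate in mean, so
    vanishing on sets passes to functions. *)
Lemma field_mean0 S (K : R) : bounded_borel S -> mean0 P X ->
  (forall a f, test_fun a S f ->
    (\int[P]_w `|lfsbm_integral (X w) f|%:E <= (K * a)%:E)%E) ->
  forall a f, test_fun a S f ->
  P.-integrable setT (EFin \o (fun w => lfsbm_integral (X w) f)) /\
  (\int[P]_w lfsbm_integral (X w) f)%R = 0.
Proof.
move=> bS X0 hK a f tf.
have int b g : test_fun b S g ->
    P.-integrable setT (EFin \o (fun w => lfsbm_integral (X w) g)).
  move=> tg; apply/integrableP; split.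
    by apply/measurable_EFinP; exact: measurable_field tg.
  exact: le_lt_trans (hK _ _ tg) (ltry _).
split; first exact: int tf.
apply: (@test_fun_functional0 _ _ S (fun f => (\int[P]_w lfsbm_integral (X w) f)%R) K
  bS _ _ _ _ a f tf).
- move=> b c g h tg th; rewrite -RintegralD//; [|exact: int tg|exact: int th].
  by apply: eq_Rintegral => w _; rewrite (lfsbm_integralD _ tg th).
- move=> b g c tg; rewrite -RintegralZl//; last exact: int tg.
  by apply: eq_Rintegral => w _; rewrite (lfsbm_integralZ _ _ tg).
- move=> b g tg; rewrite -lee_fin; apply: le_trans (hK _ _ tg).
  rewrite EFin_normr_Rintegral//; last exact: int tg.
  by apply: le_abse_integral => //; apply/measurable_EFinP; exact: measurable_field tg.
- move=> A bA AS; rewrite /Rintegral.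
  under eq_integral do rewrite lfsbm_integral_indic//.
  by rewrite X0.
Qed.

(** Supplies the bound in mean that [field_mean0] asks for, from [x <= expR x] and homogeneity. *)
Lemma field_abs_bound S (c K : R) : 0 < c ->
  (forall f, test_fun 1 S f ->
    (\int[P]_w (expR (c * `|lfsbm_integral (X w) f|))%:E <= K%:E)%E) ->
  forall a f, test_fun a S f ->
    (\int[P]_w `|lfsbm_integral (X w) f|%:E <= (K / c * a)%:E)%E.
Proof.
move=> c0 h1 a f tf; have := test_fun_ge0 tf; rewrite le_eqVlt => /orP[/eqP a0|a0].
  rewrite -a0 mulr0 (_ : (\int[P]_w _)%E = 0%E)//; apply: integral0_eq => w _.
  by have := lfsbm_integral_le_fine (X w) tf; rewrite -a0 mul0r normr_le0 => /eqP ->; rewrite normr0.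
have tg : test_fun 1 S (fun t => a^-1 * f t).
  by have := test_funZ a^-1 tf; rewrite gtr0_norm ?invr_gt0// mulVf ?gt_eqF.
have -> : f = (fun t => a * (a^-1 * f t)).
  by apply/funext => t; rewrite mulrA mulfV ?mul1r ?gt_eqF.
set g := fun t => a^-1 * f t in tg *.
have ac0 : 0 < a / c by rewrite divr_gt0.
apply: (@le_trans _ _ (\int[P]_w ((a / c)%:E * (expR (c * `|lfsbm_integral (X w) g|))%:E))%E).
  apply: le_integral_nonmeas => // w; rewrite (lfsbm_integralZ _ _ tg) normrM gtr0_norm//.
  have -> : a * `|lfsbm_integral (X w) g| = a / c * (c * `|lfsbm_integral (X w) g|).
    by field; rewrite gt_eqF.
  rewrite -EFinM lee_fin ler_wpM2l ?(ltW ac0)//.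
  by have := expR_ge1Dx (c * `|lfsbm_integral (X w) g|); lra.
rewrite ge0_integralZl//; last 2 first.
- apply/measurable_EFinP; apply: measurableT_comp => //; apply: measurable_funM => //.
  by apply: measurableT_comp => //; exact: measurable_field tg.
- by rewrite lee_fin ltW.
have -> : K / c * a = a / c * K by ring.
by rewrite (EFinM (a / c) K) lee_pmul2l// h1.
Qed.

(** The mean value 0 removes the linear term of [expR_quadratic], and [8 * a ^ 2] times the
    exponential moment 2 gives the constant 16 of [splits]. *)
Lemma field_unit_bound S : bounded_borel S -> mean0 P X ->
  (forall f, test_fun 1 S f ->
    (\int[P]_w (expR `|lfsbm_integral (X w) f|)%:E <= 2%:E)%E) ->
  forall a f, test_fun a S f -> a <= 2^-1 -> mgf_le P X f (16 * a ^+ 2).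
Proof.
move=> bS X0 h1 a f tf a2; have a0 := test_fun_ge0 tf.
have [g tg fE] := test_fun_unit tf.
have h1' g' : test_fun 1 S g' ->
    (\int[P]_w (expR (1 * `|lfsbm_integral (X w) g'|))%:E <= 2%:E)%E.
  by under eq_integral do rewrite mul1r; exact: h1.
have [ig Eg] := field_mean0 bS X0 (field_abs_bound ltr01 h1') tg.
pose Z w := lfsbm_integral (X w) g.
have mZ : measurable_fun setT Z by exact: measurable_field tg.
have mZe : measurable_fun setT (fun w => (expR `|Z w|)%:E).
  by apply/measurable_EFinP; do 2 apply: measurableT_comp => //.
have ie : P.-integrable setT (EFin \o (fun w => expR `|Z w|)).
  apply: (ge0_integrable (K := 2)) (h1 _ tg) => //; first exact/measurable_EFinP.
have i1 : P.-integrable setT (EFin \o (fun w => 1 + a * Z w)).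
  by apply: integrableD_real; [exact: integrable_cst_prob|exact: integrableZ_real].
have i2 : P.-integrable setT (EFin \o (fun w => 8 * a ^+ 2 * expR `|Z w|)).
  exact: integrableZ_real.
apply: (@le_trans _ _ (\int[P]_w (1 + a * Z w + 8 * a ^+ 2 * expR `|Z w|)%:E)%E).
  apply: le_integral_nonmeas => w; first by rewrite lee_fin expR_ge0.
  by rewrite lee_fin fE (lfsbm_integralZ _ _ tg); exact: expR_quadratic.
rewrite (integral_fineK (integrableD_real i1 i2)) lee_fin.
rewrite (RintegralD measurableT i1 i2).
rewrite (RintegralD measurableT (integrable_cst_prob P 1) (integrableZ_real a ig)).
rewrite (RintegralZl _ measurableT ig) (RintegralZl _ measurableT ie).
rewrite Rintegral_cst_prob Eg mulr0 addr0 (le_trans _ (expR_ge1Dx _))// lerD2l.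
have : \int[P]_w expR `|Z w| <= 2.
  by rewrite -lee_fin -(integral_fineK ie); exact: h1 tg.
by move=> /(ler_wpM2l (_ : 0 <= 8 * a ^+ 2)) h; rewrite (le_trans (h _))//; [rewrite mulr_ge0// sqr_ge0|lra].
Qed.

End one_field.

Section two_fields.
Context d (T : measurableType d) (P : probability T R) (X : T -> lfsbm R n.+1).
Context d' (T' : measurableType d') (P' : probability T' R) (X' : T' -> lfsbm R n.+1).
Hypotheses (mX : random_field X) (mX' : random_field X').
Hypothesis XX' : same_law P X P' X'.

Lemma same_law_integral (phi : L_ -> \bar R) : measurable_fun setT phi ->
  (\int[P]_w phi (X w) = \int[P']_w phi (X' w))%E.
Proof.
move=> mphi.
have h (psi : L_ -> \bar R) : measurable_fun setT psi -> (forall x, (0 <= psi x)%E) ->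
    (\int[P]_w psi (X w) = \int[P']_w psi (X' w))%E.
  move=> mpsi psi0.
  rewrite -(@ge0_integral_pushforward _ _ _ L_ R X mX P setT psi)//.
  rewrite -(@ge0_integral_pushforward _ _ _ L_ R X' mX' P' setT psi)//.
  by apply: eq_measure_integral => A mA _; exact: XX'.
rewrite integralE [RHS]integralE.
have posE U (Y : U -> L_) : ((fun x => phi (Y x)) ^\+ = (fun x => phi ^\+ (Y x)))%E.
  by apply/funext => x; rewrite !funeposE.
have negE U (Y : U -> L_) : ((fun x => phi (Y x)) ^\- = (fun x => phi ^\- (Y x)))%E.
  by apply/funext => x; rewrite !funenegE.
rewrite (posE _ X) (posE _ X') (negE _ X) (negE _ X'); congr (_ - _)%E.
  exact: h (measurable_funepos mphi) (funepos_ge0 phi).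
exact: h (measurable_funeneg mphi) (funeneg_ge0 phi).
Qed.

Lemma same_law_mgf a S f : test_fun a S f ->
  (\int[P]_w (expR (lfsbm_integral (X w) f))%:E =
   \int[P']_w (expR (lfsbm_integral (X' w) f))%:E)%E.
Proof.
move=> tf; apply: (same_law_integral (phi := fun mu => (expR (lfsbm_integral mu f))%:E)).
apply/measurable_EFinP; apply: measurableT_comp => //.
exact: measurable_lfsbm_integral tf.
Qed.

Lemma same_law_mgf_le a S f x : test_fun a S f -> mgf_le P X f x -> mgf_le P' X' f x.
Proof. by move=> tf; rewrite /mgf_le (same_law_mgf tf). Qed.

Lemma same_law_mean0 : mean0 P X -> mean0 P' X'.
Proof.
move=> X0 A bA; rewrite -(X0 A bA); apply/esym.
apply: (same_law_integral (phi := fun mu => (mu A)%:E)).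
by apply/measurable_EFinP; exact: measurable_lfsbm_val.
Qed.

End two_fields.

Lemma mgf_le_mono d (T : measurableType d) (P : probability T R) X f x y :
  mgf_le P X f x -> x <= y -> mgf_le P X f y.
Proof. by move=> h xy; apply: le_trans h _; rewrite lee_fin ler_expR. Qed.

Lemma independent_mgf d (T : measurableType d) (P : probability T R)
    (X Y : T -> lfsbm R n.+1) a b S S' f g :
  random_field X -> random_field Y -> independent_fields P X Y ->
  test_fun a S f -> test_fun b S' g ->
  (\int[P]_w (expR (lfsbm_integral (X w) f + lfsbm_integral (Y w) g))%:E =
   \int[P]_w (expR (lfsbm_integral (X w) f))%:E *
   \int[P]_w (expR (lfsbm_integral (Y w) g))%:E)%E.
Proof.
move=> mX mY XY tf tg; under eq_integral do rewrite expRD.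
have mf : measurable_fun setT (fun mu : L_ => expR (lfsbm_integral mu f)).
  by apply: measurableT_comp => //; exact: measurable_lfsbm_integral tf.
have mg : measurable_fun setT (fun mu : L_ => expR (lfsbm_integral mu g)).
  by apply: measurableT_comp => //; exact: measurable_lfsbm_integral tg.
apply: integral_indep_mul.
- exact: (measurableT_comp mf mX).
- exact: (measurableT_comp mg mY).
- by move=> w; exact: expR_ge0.
- by move=> w; exact: expR_ge0.
move=> A B mA mB.
have := XY ((fun mu => expR (lfsbm_integral mu f)) @^-1` A)
           ((fun mu => expR (lfsbm_integral mu g)) @^-1` B); apply.
- by rewrite -[X in measurable X]setTI; exact: mf.
- by rewrite -[X in measurable X]setTI; exact: mg.
Qed.

Definition half_lt (i : 'I_n.+1) (r : R) : set 'rV[R]_n.+1 := [set t | t ord0 i < r].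
Definition half_ge (i : 'I_n.+1) (r : R) : set 'rV[R]_n.+1 := [set t | r <= t ord0 i].

Lemma continuous_coord (i : 'I_n.+1) : continuous (fun t : 'rV[R]_n.+1 => t ord0 i).
Proof.
apply: (@lipschitz_continuous _ _ _ 1) => t u; rewrite mul1r.
have -> : t ord0 i - u ord0 i = (t - u) ord0 i by rewrite !mxE.
rewrite [leRHS]/Num.norm/= mx_normrE; exact: (le_bigmax _ _ (ord0, i)).
Qed.

Lemma measurable_coord (i : 'I_n.+1) :
  measurable_fun setT (fun t : B_ => (t : 'rV[R]_n.+1) ord0 i).
Proof. exact: (continuous_borel (@continuous_coord i)). Qed.

Lemma measurable_half_lt i r : measurable (half_lt i r : set B_).
Proof.
rewrite -[X in measurable X]setTI (_ : half_lt i r =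
  (fun t : B_ => (t : 'rV[R]_n.+1) ord0 i) @^-1` `]-oo, r[%classic); last first.
  by apply/seteqP; split=> t /=; rewrite in_itv.
by apply: measurable_coord => //; exact: measurable_itv.
Qed.

Lemma half_geE i r : half_ge i r = ~` half_lt i r.
Proof.
apply/funext => t; apply/propext; rewrite /half_ge /half_lt /setC/= leNgt.
by split => /negP.
Qed.

Lemma measurable_half_ge i r : measurable (half_ge i r : set B_).
Proof.
by rewrite half_geE; apply: (@measurableC _ B_); exact: measurable_half_lt.
Qed.

(** The leak is defined by values on bounded Borel sets of the two half-spaces;
    [test_fun_functional0] turns this into a statement on integrals. *)
Lemma leak_integral (T : Type) (X0 Xm Xp Z : T -> lfsbm R n.+1) a S f w :
  is_leak_of_split X0 Xm Xp Z -> test_fun a S f ->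
  lfsbm_integral (Z w) f =
  lfsbm_integral (Xm w) (fun t => f t * \1_(half_lt ord0 0) t) +
  lfsbm_integral (Xp w) (fun t => f t * \1_(half_ge ord0 0) t) -
  lfsbm_integral (X0 w) f.
Proof.
move=> hZ tf; have bS : bounded_borel S by case: tf.
have mlt := measurable_half_lt ord0 0; have mge := measurable_half_ge ord0 0.
pose r A f := fun t : 'rV[R]_n.+1 => f t * (\1_A t : R).
have trl b g : test_fun b S g -> test_fun b S (r (half_lt ord0 0) g).
  by move=> tg; apply: test_funS (test_fun_restr tg mlt) _ _ bS => //; exact: subIsetl.
have trg b g : test_fun b S g -> test_fun b S (r (half_ge ord0 0) g).
  by move=> tg; apply: test_funS (test_fun_restr tg mge) _ _ bS => //; exact: subIsetl.
have rD A g h : r A (fun t => g t + h t) = (fun t => r A g t + r A h t).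
  by apply/funext => t; rewrite /r mulrDl.
have rZ A c g : r A (fun t => c * g t) = (fun t => c * r A g t).
  by apply/funext => t; rewrite /r mulrA.
apply/eqP; rewrite -subr_eq0; apply/eqP.
apply: (@test_fun_functional0 _ _ S (fun f =>
    lfsbm_integral (Z w) f - (lfsbm_integral (Xm w) (r (half_lt ord0 0) f) +
      lfsbm_integral (Xp w) (r (half_ge ord0 0) f) - lfsbm_integral (X0 w) f))
  (fine (lfsbm_variation (Z w) S) + fine (lfsbm_variation (Xm w) S) +
   fine (lfsbm_variation (Xp w) S) + fine (lfsbm_variation (X0 w) S)) bS _ _ _ _ a f tf).
- move=> b c g h tg th; rewrite !rD.
  rewrite (lfsbm_integralD (Z w) tg th) (lfsbm_integralD (X0 w) tg th).
  rewrite (lfsbm_integralD (Xm w) (trl _ _ tg) (trl _ _ th)).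
  by rewrite (lfsbm_integralD (Xp w) (trg _ _ tg) (trg _ _ th)); ring.
- move=> b g c tg; rewrite !rZ (lfsbm_integralZ (Z w) _ tg) (lfsbm_integralZ (X0 w) _ tg).
  rewrite (lfsbm_integralZ (Xm w) _ (trl _ _ tg)).
  by rewrite (lfsbm_integralZ (Xp w) _ (trg _ _ tg)); ring.
- move=> b g tg.
  have h1 := lfsbm_integral_le_fine (Z w) tg.
  have h2 := lfsbm_integral_le_fine (X0 w) tg.
  have h3 := lfsbm_integral_le_fine (Xm w) (trl _ _ tg).
  have h4 := lfsbm_integral_le_fine (Xp w) (trg _ _ tg).
  rewrite (le_trans (ler_normB _ _))//.
  rewrite (le_trans (lerD (lexx _) (ler_normB _ _)))//.
  rewrite (le_trans (lerD (lexx _) (lerD (ler_normD _ _) (lexx _))))//.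
  by rewrite !mulrDl; lra.
- move=> A bA AS.
  have mA : measurable (A : set B_) by exact: bA.1.
  have rA C : r C \1_A = \1_(C `&` A).
    apply/funext => t; rewrite /r !indicE in_setI.
    by case: (t \in A); case: (t \in C); rewrite ?mulr1 ?mulr0.
  have bl : bounded_borel (half_lt ord0 0 `&` A) by exact: bounded_borelI.
  have bg : bounded_borel (half_ge ord0 0 `&` A) by exact: bounded_borelI.
  rewrite !rA !lfsbm_integral_indic//.
  have AE (mu : lfsbm R n.+1) : mu A = mu (half_lt ord0 0 `&` A) + mu (half_ge ord0 0 `&` A).
    rewrite -lfsbmU//; last by rewrite half_geE setIACA setICr set0I.
    by rewrite -setIUl half_geE setUv setTI.
  have [hl _] := hZ w _ bl; have [_ hg] := hZ w _ bg.
  rewrite (AE (Z w)) (AE (X0 w)) (hl (@subIsetl _ _ _)) (hg (@subIsetl _ _ _)).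
  by ring.
Qed.

End fields.

(** * Splitting along a hyperplane *)

Section hierarchy.
Context {R : realType} {n : nat}.
Implicit Types (S : set 'rV[R]_n.+1) (f g : 'rV[R]_n.+1 -> R).
Implicit Types (s l : nat -> R) (U W : ('rV[R]_n.+1 -> R) -> R -> Prop).
Local Notation B_ := (borel_rV R n.+1).

(** Only the first [k] coordinates are restricted. Corners and side lengths are functions on [nat],
    so that one of them can be updated and indices can be shifted by [bump] without casts. *)
Definition box (k : nat) s l : set 'rV[R]_n.+1 :=
  [set t | forall j : 'I_n.+1, (j < k)%N -> s j <= t ord0 j < s j + l j].

(* What remains of [(1,k)]-splittability once a field [X] is replaced by the
   relation [U f x] meaning [E exp (\int f dX) <= exp x]. [W] stands for the
   leak and [zeta] for the change of coordinates between [W] and [U]. The last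
   two clauses are Hoelder's inequality applied to both sides of a split. *)
Fixpoint splits (k : nat) U : Prop :=
  (forall f x y, U f x -> x <= y -> U f y) /\
  match k with
  | 0 => forall a S f, test_fun a S f -> a <= 2^-1 -> U f (16 * a ^+ 2)
  | k'.+1 =>
    (forall s a S f, test_fun a S f -> a <= 2^-1 ->
       (forall t, f t != 0 -> box k'.+1 s (fun=> 1) t) -> U f (16 * a ^+ 2)) /\
    forall (i : 'I_n.+1) (r : R), (i < k'.+1)%N ->
      exists W (zeta : 'rV[R]_n.+1 -> 'rV[R]_n.+1),
        [/\ splits k' W,
            forall t (l j : 'I_n.+1), (l < k')%N -> j = bump i l :> nat ->
              zeta t ord0 j = t ord0 l,
            forall a S f, test_fun a S f -> exists S', test_fun a S' (f \o zeta),
            forall a S f (p q x y z : R), test_fun a S f ->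
              0 < p -> 0 < q -> p^-1 + q^-1 = 1 ->
              U (fun t => p * (f t * \1_(half_lt i r) t)) x ->
              U (fun t => p * (f t * \1_(half_ge i r) t)) y ->
              W (fun t => (- q) * f (zeta t)) z -> U f ((x + y) / p + z / q) &
            forall a S f (p q x z : R), test_fun a S f ->
              0 < p -> 0 < q -> p^-1 + q^-1 = 1 ->
              U (fun t => p * f t) x -> W (fun t => q * f (zeta t)) z ->
              exists y1 y2, [/\ U (fun t => f t * \1_(half_lt i r) t) y1,
                U (fun t => f t * \1_(half_ge i r) t) y2 & y1 + y2 <= x / p + z / q]]
  end.

Lemma splits_mono k U : splits k U -> forall f x y, U f x -> x <= y -> U f y.
Proof. by case: k => [|k] []. Qed.

Lemma measurable_coord_itv (i : 'I_n.+1) (x y : R) :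
  measurable ([set t | x <= t ord0 i < y] : set B_).
Proof.
have mI : measurable (half_ge i x `&` half_lt i y : set B_).
  by apply: (@measurableI _ B_); [exact: measurable_half_ge|exact: measurable_half_lt].
have E : half_ge i x `&` half_lt i y = [set t | x <= t ord0 i < y].
  by apply/seteqP; split=> t /=; [move=> [? ?]; apply/andP; split|move=> /andP[? ?]; split].
exact: (eq_ind _ (fun A : set B_ => measurable A) mI _ E).
Qed.

Lemma boxE k s l : box k s l = \bigcap_(j in [set j : 'I_n.+1 | (j < k)%N])
  [set t | s j <= t ord0 j < s j + l j].
Proof. by apply/seteqP; split=> t h j /= jk; exact: h. Qed.

Lemma measurable_box k s l : measurable (box k s l : set B_).
Proof.
rewrite boxE; apply: (@fin_bigcap_measurable _ B_) => // j _.
exact: measurable_coord_itv.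
Qed.

Lemma box_strip k s : box k s (fun=> 1) = strip (\row_(j < k) s j) :> set 'rV[R]_n.+1.
Proof. by apply/seteqP; split=> t ht j jk; have := ht j jk; rewrite mxE. Qed.

Lemma indic_half_ltE (i : 'I_n.+1) (r : R) (t : 'rV[R]_n.+1) :
  \1_(half_lt i r) t = (t ord0 i < r)%R%:R :> R.
Proof.
rewrite indicE; case: (boolP (t ord0 i < r)) => h; first by rewrite mem_set.
by rewrite memNset//; exact/negP.
Qed.

Lemma indic_half_geE (i : 'I_n.+1) (r : R) (t : 'rV[R]_n.+1) :
  \1_(half_ge i r) t = (r <= t ord0 i)%R%:R :> R.
Proof.
rewrite indicE; case: (boolP (r <= t ord0 i)) => h; first by rewrite mem_set.
by rewrite memNset//; exact/negP.
Qed.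

Section leak.
Context d (T : measurableType d) (P : probability T R) (X : T -> lfsbm R n.+1).
Context d' (T' : measurableType d') (P' : probability T' R) (Y : T' -> lfsbm R n.+1).
Hypotheses (mX : random_field X) (XY : is_leak P X P' Y).
Local Notation lt0 := (half_lt ord0 0).
Local Notation ge0 := (half_ge ord0 0).

(** In the terminal case the definition of splittability provides an exponential moment only, so the
    mean value 0 of a leak is inherited from [X]. *)
Lemma leak_mean0 : mean0 P X -> mean0 P' Y.
Proof.
case: XY => mY [d2 [T2 [P2 [X0 [Xm [Xp [Z [hsplit mZ hZ YZ]]]]]]]] hX A bA.
case: hsplit => -[m0 mm mp] [ind [s0 sm sp]].
have mean (V : T2 -> lfsbm R n.+1) : random_field V -> same_law P2 V P X -> mean0 P2 V.
  move=> mV VX; apply: (same_law_mean0 mX mV) hX.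
  by move=> C mC; rewrite -(VX C mC).
have YZm : mean0 P2 Z.
  move=> C bC; have mC : measurable (C : set B_) by exact: bC.1.
  have mlt := measurable_half_lt ord0 0 : measurable (lt0 : set B_).
  have mge := measurable_half_ge ord0 0 : measurable (ge0 : set B_).
  have bl : bounded_borel (lt0 `&` C) by exact: bounded_borelI.
  have bg : bounded_borel (ge0 `&` C) by exact: bounded_borelI.
  have im (V : T2 -> lfsbm R n.+1) : random_field V -> same_law P2 V P X ->
      forall D, bounded_borel D -> P2.-integrable setT (EFin \o (fun w => V w D)).
    by move=> mV VX D bD; exact: (integrable_mean0 mV (mean _ mV VX) bD).
  have Em (V : T2 -> lfsbm R n.+1) : random_field V -> same_law P2 V P X ->
      forall D, bounded_borel D -> (\int[P2]_w V w D)%R = 0.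
    by move=> mV VX D bD; rewrite /Rintegral (mean _ mV VX _ bD).
  have ZE w : Z w C = Xm w (lt0 `&` C) + Xp w (ge0 `&` C) + (-1) * X0 w C.
    have := leak_integral w hZ (test_fun_indic bC mC (@subset_refl _ C)).
    have rA D : (fun t => \1_C t * \1_D t) = \1_(D `&` C) :> ('rV[R]_n.+1 -> R).
      apply/funext => t; rewrite !indicE in_setI.
      by case: (t \in C); case: (t \in D); rewrite ?mulr1 ?mulr0.
    by rewrite !rA !lfsbm_integral_indic// mulN1r.
  rewrite (_ : (fun w => (Z w C)%:E) = EFin \o (fun w =>
    Xm w (lt0 `&` C) + Xp w (ge0 `&` C) + (-1) * X0 w C)); last first.
    by apply/funext => w /=; rewrite ZE.
  have i1 := im _ mm sm _ bl; have i2 := im _ mp sp _ bg; have i3 := im _ m0 s0 _ bC.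
  have i12 := integrableD_real i1 i2; have i3' := integrableZ_real (-1) i3.
  rewrite (integral_fineK (integrableD_real i12 i3')).
  rewrite (RintegralD measurableT i12 i3') (RintegralD measurableT i1 i2).
  rewrite (RintegralZl _ measurableT i3) (Em _ mm sm _ bl) (Em _ mp sp _ bg).
  by rewrite (Em _ m0 s0 _ bC) mulr0 !addr0.
apply: (same_law_mean0 mZ mY _ YZm bA).
by move=> C mC; rewrite -(YZ C mC).
Qed.

(** In the split, [X0] is the sum of the two independent halves minus the leak. Hoelder's inequality
    separates the leak, and the moment of the halves factorizes by independence. *)
Lemma leak_split_le a S f p q x y z : test_fun a S f ->
  0 < p -> 0 < q -> p^-1 + q^-1 = 1 ->
  mgf_le P X (fun t => p * (f t * \1_lt0 t)) x ->
  mgf_le P X (fun t => p * (f t * \1_ge0 t)) y ->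
  mgf_le P' Y (fun t => (- q) * f t) z -> mgf_le P X f ((x + y) / p + z / q).
Proof.
case: XY => mY [d2 [T2 [P2 [X0 [Xm [Xp [Z [hsplit mZ hZ YZ]]]]]]]].
case: hsplit => -[m0 mm mp] [ind [s0 sm sp]] tf p0 q0 pq hx hy hz.
have tl := test_fun_restr tf (measurable_half_lt ord0 0).
have tg := test_fun_restr tf (measurable_half_ge ord0 0).
apply: (same_law_mgf_le m0 mX s0 tf).
pose U w := lfsbm_integral (Xm w) (fun t => f t * \1_lt0 t) +
            lfsbm_integral (Xp w) (fun t => f t * \1_ge0 t).
pose V w := - lfsbm_integral (Z w) f.
have mU : measurable_fun setT U.
  by apply: measurable_funD; [exact: measurable_field tl|exact: measurable_field tg].
have mV : measurable_fun setT V.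
  by apply: measurableT_comp => //; exact: measurable_field tf.
have UVE : (\int[P2]_w (expR (lfsbm_integral (X0 w) f))%:E =
   \int[P2]_w (expR (U w + V w))%:E)%E.
  apply: eq_integral => w _.
  by rewrite /U /V (leak_integral w hZ tf); congr (expR _)%:E; ring.
rewrite /mgf_le UVE.
have tlp := test_funZ p tl; have tgp := test_funZ p tg.
apply: expR_hoelder => //.
- rewrite (_ : (\int[P2]_w _)%E =
    \int[P2]_w (expR (lfsbm_integral (Xm w) (fun t => p * (f t * \1_lt0 t)) +
       lfsbm_integral (Xp w) (fun t => p * (f t * \1_ge0 t))))%:E)%E; last first.
    apply: eq_integral => w _; rewrite (lfsbm_integralZ _ _ tl).
    by rewrite (lfsbm_integralZ _ _ tg) /U mulrDr.
  rewrite (independent_mgf mm mp ind tlp tgp) expRD EFinM; apply: lee_pmul.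
  + by apply: integral_ge0 => w _; rewrite lee_fin expR_ge0.
  + by apply: integral_ge0 => w _; rewrite lee_fin expR_ge0.
  + by rewrite (same_law_mgf mm mX sm tlp).
  + by rewrite (same_law_mgf mp mX sp tgp).
- have := same_law_mgf_le mY mZ YZ (test_funZ (- q) tf) hz; rewrite /mgf_le.
  apply: le_trans; rewrite le_eqVlt; apply/orP; left; apply/eqP.
  apply: eq_integral => w _; rewrite (lfsbm_integralZ _ _ tf) /V.
  by rewrite mulrN mulNr.
Qed.

(** The same identity read backwards: the independent halves add up to [X0] plus the leak. *)
Lemma leak_split_ge a S f p q x z : test_fun a S f ->
  0 < p -> 0 < q -> p^-1 + q^-1 = 1 ->
  mgf_le P X (fun t => p * f t) x -> mgf_le P' Y (fun t => q * f t) z ->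
  exists y1 y2, [/\ mgf_le P X (fun t => f t * \1_lt0 t) y1,
    mgf_le P X (fun t => f t * \1_ge0 t) y2 & y1 + y2 <= x / p + z / q].
Proof.
case: XY => mY [d2 [T2 [P2 [X0 [Xm [Xp [Z [hsplit mZ hZ YZ]]]]]]]].
case: hsplit => -[m0 mm mp] [ind [s0 sm sp]] tf p0 q0 pq hx hz.
have tl := test_fun_restr tf (measurable_half_lt ord0 0).
have tg := test_fun_restr tf (measurable_half_ge ord0 0).
pose U w := lfsbm_integral (X0 w) f.
pose V w := lfsbm_integral (Z w) f.
have mU : measurable_fun setT U by exact: measurable_field tf.
have mV : measurable_fun setT V by exact: measurable_field tf.
have hU : (\int[P2]_w (expR (p * U w))%:E <= (expR x)%:E)%E.
  have := hx; rewrite /mgf_le -(same_law_mgf m0 mX s0 (test_funZ p tf)).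
  apply: le_trans; rewrite le_eqVlt; apply/orP; left; apply/eqP.
  by apply: eq_integral => w _; rewrite (lfsbm_integralZ _ _ tf).
have hV : (\int[P2]_w (expR (q * V w))%:E <= (expR z)%:E)%E.
  have := hz; rewrite /mgf_le (same_law_mgf mY mZ YZ (test_funZ q tf)).
  apply: le_trans; rewrite le_eqVlt; apply/orP; left; apply/eqP.
  by apply: eq_integral => w _; rewrite (lfsbm_integralZ _ _ tf).
have := expR_hoelder mU mV p0 q0 pq hU hV.
rewrite (_ : (\int[P2]_w _)%E =
    \int[P2]_w (expR (lfsbm_integral (Xm w) (fun t => f t * \1_lt0 t) +
       lfsbm_integral (Xp w) (fun t => f t * \1_ge0 t)))%:E)%E; last first.
  apply: eq_integral => w _; rewrite /U /V (leak_integral w hZ tf).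
  by congr (expR _)%:E; ring.
rewrite (independent_mgf mm mp ind tl tg).
rewrite (same_law_mgf mm mX sm tl) (same_law_mgf mp mX sp tg).
rewrite /mgf_le; have := mgf_gt0 P mX tl; have := mgf_gt0 P mX tg.
set A := (\int[P]_w (expR (lfsbm_integral (X w) (fun t => f t * \1_lt0 t)))%:E)%E.
set B := (\int[P]_w (expR (lfsbm_integral (X w) (fun t => f t * \1_ge0 t)))%:E)%E.
(* Both moments are positive, so a finite bound on their product excludes an infinite factor, and
   their logarithms serve as [y1] and [y2]. *)
case: A => [A||]; case: B => [B||] //; rewrite ?lte_fin.
- move=> B0 A0; rewrite -EFinM lee_fin => h; exists (ln A), (ln B).
  rewrite !lnK ?posrE//; split => //.
  by rewrite -ler_expR expRD !lnK ?posrE.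
- by move=> _ A0; rewrite gt0_muley ?lte_fin.
- by move=> B0 _; rewrite gt0_mulye ?lte_fin.
Qed.

End leak.

Lemma random_field_reparam d (T : measurableType d) (X : T -> lfsbm R n.+1) (s : 'S_n.+1) v :
  random_field X -> random_field (fun w => reparam s v (X w)).
Proof.
move=> mX.
suff mr : measurable_fun setT (reparam s v : lfsbm_space R n.+1 -> lfsbm_space R n.+1).
  exact: (measurableT_comp mr mX).
apply: measurable_lfsbm_map => a S f tf.
pose g := f \o perm_shift s^-1%g (- \row_j v ord0 (s^-1%g j)).
have tg := test_fun_perm_shift s^-1%g (- \row_j v ord0 (s^-1%g j)) tf.
have fE : f = g \o perm_shift s v.
  by apply/funext => t; rewrite /g /= perm_shiftK.
rewrite (_ : (fun _ => _) = (fun mu => lfsbm_integral mu g)).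
  exact: measurable_lfsbm_integral tg.
by apply/funext => mu; have := lfsbm_integral_reparam s v mu tg; rewrite -fE.
Qed.

Lemma mean0_reparam d (T : measurableType d) (P : probability T R)
  (X : T -> lfsbm R n.+1) (s : 'S_n.+1) v : mean0 P X -> mean0 P (fun w => reparam s v (X w)).
Proof. by move=> hX A bA /=; apply: hX; exact: bounded_borel_perm_shift. Qed.

Lemma mgf_le_reparam d (T : measurableType d) (P : probability T R)
    (X : T -> lfsbm R n.+1) (s : 'S_n.+1) v a S f x : test_fun a S f ->
  mgf_le P (fun w => reparam s v (X w)) (f \o perm_shift s v) x = mgf_le P X f x.
Proof.
move=> tf.
have E : (\int[P]_w (expR (lfsbm_integral (reparam s v (X w)) (f \o perm_shift s v)))%:E =
          \int[P]_w (expR (lfsbm_integral (X w) f))%:E)%E.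
  by apply: eq_integral => w _; rewrite (lfsbm_integral_reparam _ _ _ tf).
by rewrite /mgf_le E.
Qed.

Lemma splittable1_splits k d (T : measurableType d) (P : probability T R)
    (X : T -> lfsbm R n.+1) : (k <= n.+1)%N ->
  random_field X -> mean0 P X -> splittable1 k P X -> splits k (mgf_le P X).
Proof.
have bound (S : set 'rV[R]_n.+1) d' (T' : measurableType d') (P' : probability T' R)
    (Y : T' -> lfsbm R n.+1) (D : set 'rV[R]_n.+1) : S `<=` D ->
    (\int[P']_w expeR (lfsbm_variation (Y w) D) <= 2%:E)%E ->
    forall f, test_fun 1 S f ->
    (\int[P']_w (expR `|lfsbm_integral (Y w) f|)%:E <= 2%:E)%E.
  move=> SD h f tf; apply: le_trans h; apply: le_integral_nonmeas => w.
    by rewrite lee_fin expR_ge0.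
  rewrite -[leLHS]/(expeR (`|lfsbm_integral (Y w) f|)%:E) lee_expeR.
  apply: le_trans (lfsbm_integral_le (Y w) tf) _; rewrite mul1e.
  exact: lfsbm_variationS.
elim: k d T P X => [|k ih] d T P X kn mX X0 hX.
  split; first by move=> f x y; exact: mgf_le_mono.
  move=> a S f tf a2; have bS : bounded_borel S by case: tf.
  by apply: (field_unit_bound mX bS X0 _ tf a2); apply: (bound _ _ _ _ _ setT).
case: hX => hunit _ hsplit; split; first by move=> f x y; exact: mgf_le_mono.
split=> [s a S f tf a2 fs|i r ik].
  pose S' := S `&` box k.+1 s (fun=> 1).
  have bS' : bounded_borel S'.
    rewrite /S' setIC; apply: bounded_borelI; last by case: tf.
    exact: measurable_box.
  have tf' : test_fun a S' f.
    case: tf => bS mf fa fS; split=> // t St; apply/eqP; apply: contrapT => /negP ft.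
    by apply: St; split; [apply: contrapT => /fS /eqP; exact/negP|exact: fs].
  apply: (field_unit_bound mX bS' X0 _ tf' a2).
  apply: (bound _ _ _ _ _ (box k.+1 s (fun=> 1))); first exact: subIsetr.
  by rewrite box_strip; exact: hunit.
have [d' [T' [P' [Y [hl hY]]]]] := hsplit i r ik.
set al := lift_perm i ord0 1%g in hl; set be := lift_perm ord0 (inord k) 1%g in hY.
set v := r *: delta_mx ord0 i in hl.
pose Y' w := reparam be 0 (Y w).
(* Counting from 0, [zeta] takes coordinate [i], transverse to the cut, from coordinate [k] of the
   permuted leak, which the splittability of the leak does not restrict. The other ones among the
   first [k + 1] coordinates become the first [k], in order. *)
pose zeta t := perm_shift al v (perm_shift be 0 t).
have mX' := random_field_reparam al v mX.
have mY : random_field Y by case: hl.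
have Y0 := leak_mean0 mX' hl (mean0_reparam al v X0).
exists (mgf_le P' Y'), zeta; split.
- apply: ih; [exact: ltnW|exact: random_field_reparam|exact: mean0_reparam|exact: hY].
- move=> t l j lk jl; rewrite /zeta /perm_shift !mxE.
  have l1 : (l < n)%N by apply: leq_trans lk _.
  pose l' : 'I_n := Ordinal l1.
  have -> : j = lift i l' by apply/val_inj.
  rewrite /al lift_perm_lift perm1.
  rewrite /be lift_perm_lift perm1 /=.
  have -> : (lift i l' == i) = false by rewrite eq_sym (negbTE (neq_lift _ _)).
  rewrite mulr0 !addr0; congr (t ord0 _); apply/val_inj => /=.
  by rewrite inordK// /bump leqNgt lk.
- move=> a S f tf; eexists.
  exact: test_fun_perm_shift (test_fun_perm_shift al v tf).
- move=> a S f p q x y z tf p0 q0 pq hx hy hz.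
  have tl := test_funZ p (test_fun_restr tf (measurable_half_lt i r)).
  have tg := test_funZ p (test_fun_restr tf (measurable_half_ge i r)).
  have tf' := test_fun_perm_shift al v tf.
  (* The cut of [X] at [r] in direction [i] is thus the cut at 0 in the first direction, where
     splits and leaks are defined. *)
  have halE t : perm_shift al v t ord0 i = t ord0 ord0 + r.
    by rewrite /perm_shift !mxE /al lift_perm_id !eqxx mulr1.
  rewrite -(mgf_le_reparam P X al v _ tf).
  apply: (leak_split_le mX' hl tf' p0 q0 pq).
  + move: hx; rewrite -(mgf_le_reparam P X al v _ tl).
    rewrite (_ : _ \o _ = (fun t => p * ((f \o perm_shift al v) t * \1_(half_lt ord0 0) t)))//.
    by apply/funext => t /=; rewrite !indic_half_ltE halE -ltrBrDr subrr.
  + move: hy; rewrite -(mgf_le_reparam P X al v _ tg).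
    rewrite (_ : _ \o _ = (fun t => p * ((f \o perm_shift al v) t * \1_(half_ge ord0 0) t)))//.
    by apply/funext => t /=; rewrite !indic_half_geE halE -lerBlDr subrr.
  + by move: hz; rewrite -(mgf_le_reparam P' Y be 0 _ (test_funZ (- q) tf')).
- move=> a S f p q x z tf p0 q0 pq hx hz.
  have tl := test_fun_restr tf (measurable_half_lt i r).
  have tg := test_fun_restr tf (measurable_half_ge i r).
  have tf' := test_fun_perm_shift al v tf.
  have halE t : perm_shift al v t ord0 i = t ord0 ord0 + r.
    by rewrite /perm_shift !mxE /al lift_perm_id !eqxx mulr1.
  have hx' : mgf_le P (fun w => reparam al v (X w)) (fun t => p * (f \o perm_shift al v) t) x.
    by move: hx; rewrite -(mgf_le_reparam P X al v _ (test_funZ p tf)).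
  have hz' : mgf_le P' Y (fun t => q * (f \o perm_shift al v) t) z.
    by move: hz; rewrite -(mgf_le_reparam P' Y be 0 _ (test_funZ q tf')).
  have [y1 [y2 [h1 h2 h12]]] := leak_split_ge mX' hl tf' p0 q0 pq hx' hz'.
  have El : (fun t => f t * \1_(half_lt i r) t) \o perm_shift al v =
      (fun t => (f \o perm_shift al v) t * \1_(half_lt ord0 0) t).
    by apply/funext => t /=; rewrite !indic_half_ltE halE -ltrBrDr subrr.
  have Eg : (fun t => f t * \1_(half_ge i r) t) \o perm_shift al v =
      (fun t => (f \o perm_shift al v) t * \1_(half_ge ord0 0) t).
    by apply/funext => t /=; rewrite !indic_half_geE halE -lerBlDr subrr.
  exists y1, y2; split; last exact: h12.
    by rewrite -(mgf_le_reparam P X al v _ tl) El; exact: h1.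
  by rewrite -(mgf_le_reparam P X al v _ tg) Eg; exact: h2.
Qed.

End hierarchy.

(** * Dyadic cubes *)

Section boxes.
Context {R : realType} {n : nat}.
Implicit Types (S : set 'rV[R]_n.+1) (f g : 'rV[R]_n.+1 -> R).
Implicit Types (s l : nat -> R) (U W : ('rV[R]_n.+1 -> R) -> R -> Prop).
Local Notation B_ := (borel_rV R n.+1).

Definition upd s (i : nat) (x : R) : nat -> R := fun j => if j == i then x else s j.

Definition restrict_box k f s l : 'rV[R]_n.+1 -> R := fun t => f t * \1_(box k s l) t.

(** The candidates for the logarithmic moment of a box: additive under halving one side, like the
    volume or the integral of a density. The first clause says that only the first [k] values of [s]
    and [l] matter. *)
Definition box_additive k (B : (nat -> R) -> (nat -> R) -> R) : Prop :=
  (forall s l s' l', (forall j, (j < k)%N -> s j = s' j /\ l j = l' j) ->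
     B s l = B s' l') /\
  forall s l i, (i < k)%N -> 0 <= l i -> B s l = B s (upd l i (l i / 2)) +
    B (upd s i (s i + l i / 2)) (upd l i (l i / 2)).

Definition box_volume k l : R := \prod_(j < k) l j.

Lemma box_additive_volume k (c : R) : box_additive k (fun _ l => c * box_volume k l).
Proof.
split=> [s l s' l' h|s l i ik l0].
  by congr (_ * _); apply: eq_bigr => j _; have [] := h j (ltn_ord j).
rewrite -mulrDr; congr (_ * _); rewrite /box_volume.
rewrite (bigD1 (Ordinal ik))//= [in RHS](bigD1 (Ordinal ik))//= /upd eqxx.
rewrite -mulrDl -splitr; congr (_ * _); apply: eq_bigr => j ji.
by rewrite (_ : (j == i :> nat) = false)//; apply: negbTE.
Qed.

Lemma box_additiveD k B B' : box_additive k B -> box_additive k B' ->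
  box_additive k (fun s l => B s l + B' s l).
Proof.
move=> [e1 a1] [e2 a2]; split=> [s l s' l' h|s l i ik l0].
  by rewrite (e1 _ _ _ _ h) (e2 _ _ _ _ h).
by rewrite (a1 s l i)// (a2 s l i)// addrACA.
Qed.

Lemma box_volume_cst k (x : R) : box_volume k (fun=> x) = x ^+ k.
Proof. by rewrite /box_volume prodr_const card_ord. Qed.

Lemma box_ext k s l s' l' : (forall j, (j < k)%N -> s j = s' j /\ l j = l' j) ->
  box k s l = box k s' l' :> set 'rV[R]_n.+1.
Proof.
by move=> h; apply/seteqP; split=> t ht j jk; have := ht j jk; have [-> ->] := h j jk.
Qed.

Lemma restrict_box_test a S f k s l : test_fun a S f ->
  test_fun a S (restrict_box k f s l).
Proof.
move=> tf; have bS : bounded_borel S by case: tf.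
by apply: test_funS (test_fun_restr tf (measurable_box k s l)) _ _ bS => //.
Qed.

Lemma restrict_box_half_lt k f s l (i : 'I_n.+1) : (i < k)%N -> 0 <= l i ->
  (fun t => restrict_box k f s l t * \1_(half_lt i (s i + l i / 2)) t) =
  restrict_box k f s (upd l i (l i / 2)).
Proof.
move=> ik l0; apply/funext => t; rewrite /restrict_box -mulrA; congr (_ * _).
rewrite !indicE -natrM mulnb -in_setI; congr (_%:R); congr (nat_of_bool (t \in _)).
apply/seteqP; split=> {}t /=.
  move=> [tb th] j jk; rewrite /upd; case: ifPn => [/eqP/val_inj ->|_]; last exact: tb.
  by have /andP[-> _] := tb i ik.
move=> tb; split.
  move=> j jk; have := tb j jk; rewrite /upd; case: ifPn => [/eqP/val_inj -> |//].
  by move=> /andP[-> h]/=; lra.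
by have := tb i ik; rewrite /upd eqxx => /andP[].
Qed.

Lemma restrict_box_half_ge k f s l (i : 'I_n.+1) : (i < k)%N -> 0 <= l i ->
  (fun t => restrict_box k f s l t * \1_(half_ge i (s i + l i / 2)) t) =
  restrict_box k f (upd s i (s i + l i / 2)) (upd l i (l i / 2)).
Proof.
move=> ik l0; apply/funext => t; rewrite /restrict_box -mulrA; congr (_ * _).
rewrite !indicE -natrM mulnb -in_setI; congr (_%:R); congr (nat_of_bool (t \in _)).
apply/seteqP; split=> {}t /=.
  move=> [tb th] j jk; rewrite /upd; case: ifPn => [/eqP/val_inj ->|_]; last exact: tb.
  by have /andP[h1 h2] := tb i ik; move: th; rewrite /half_ge/= => ->/=; lra.
move=> tb; split.
  move=> j jk; have := tb j jk; rewrite /upd; case: ifPn => [/eqP/val_inj -> |//].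
  by move=> /andP[h1 h2]/=; apply/andP; split; lra.
by have := tb i ik; rewrite /upd eqxx => /andP[].
Qed.

Lemma eq_fun_pred U f g x : U f x -> (forall t, f t = g t) -> U g x.
Proof. by move=> h /funext <-. Qed.

(* For a cube of side [r = 2 ^ m], the condition on [a] is the moderate
   deviation range [a (log r)^k = O(1)]. *)
Definition cube_bound k (C : R) : Prop :=
  forall U, splits k U -> forall m s a S f, test_fun a S f ->
    (forall t, f t != 0 -> box k s (fun=> 2 ^+ m) t) ->
    C * a * m.+1%:R ^+ k <= 1 -> U f (C * a ^+ 2 * (2 ^+ m) ^+ k).

(** * Passing from cubes of side [2 ^ m] to cubes of side [2 ^ m.+1] *)

Section halving.
Variables (k : nat) (C : R) (U : ('rV[R]_n.+1 -> R) -> R -> Prop).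
Hypotheses (C1 : 1 <= C) (kn : (k < n.+1)%N).
Hypotheses (cb : cube_bound k C) (sU : splits k.+1 U).
Variables (a : R) (S : set 'rV[R]_n.+1) (f : 'rV[R]_n.+1 -> R).
Hypothesis tf : test_fun a S f.
Local Notation K := k.+1.

(** Dropping coordinate [i] turns a box in [K] coordinates into one in [k] coordinates, with corner
    [s (bump i j)] and sides at most [2 ^ m]. It fits into a cube to which the bound for [k]
    applies. *)
Lemma leak_box_test (W : ('rV[R]_n.+1 -> R) -> R -> Prop)
    (zeta : 'rV[R]_n.+1 -> 'rV[R]_n.+1) (i : 'I_n.+1) (c : R) m s l :
  (i < K)%N -> splits k W ->
  (forall t (l j : 'I_n.+1), (l < k)%N -> j = bump i l :> nat ->
     zeta t ord0 j = t ord0 l) ->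
  (forall a S f, test_fun a S f -> exists S', test_fun a S' (f \o zeta)) ->
  (forall j, (j < K)%N -> l j <= 2 ^+ m) ->
  C * (`|c| * a) * m.+1%:R ^+ k <= 1 ->
  W (fun t => c * restrict_box K f s l (zeta t)) (C * (c * a) ^+ 2 * (2 ^+ m) ^+ k).
Proof.
move=> iK sW hz hS hl hC.
have [S' tS'] := hS _ _ _ (restrict_box_test K s l tf).
have tS2 := test_funZ c tS'.
have := cb sW (s := fun j => s (bump i j)) tS2 _ hC.
rewrite exprMn real_normK ?num_real// -exprMn; apply.
move=> t /= h j jk; have jb : (bump i j < n.+1)%N.
  apply: leq_ltn_trans kn; rewrite /bump; case: (i <= j)%N; rewrite ?add1n ?add0n//.
  exact: ltnW.
have tb : box K s l (zeta t).
  apply: contrapT => tb; move/negP: h; apply; apply/eqP.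
  by rewrite /restrict_box indicE memNset// !mulr0.
have jK : (Ordinal jb < K)%N.
  by rewrite /= /bump; case: (i <= j)%N => /=; rewrite ?add1n ?add0n// ltnW.
have := tb (Ordinal jb) jK; rewrite (hz _ j)//= => /andP[-> h2]/=.
by rewrite (lt_le_trans h2)// lerD2l hl.
Qed.

(** Exponents of the form [expR y] turn products over successive cuts into sums of the [y]. For
    [y <= 2] one has [1 - expR (- y) >= y / 3]. *)
Lemma conjugate_exponent (y : R) : 0 < y -> y <= 2 ->
  exists q, [/\ 0 < q, (expR y)^-1 + q^-1 = 1 & q <= 3 / y].
Proof.
move=> y0 y2; exists (1 - expR (- y))^-1.
have h1 : y / 3 <= 1 - expR (- y).
  have : expR (- y) <= (1 + y)^-1.
    by rewrite expRN lef_pV2 ?posrE ?expR_gt0 ?expR_ge1Dx//; lra.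
  have : (1 + y)^-1 <= 1 - y / 3.
    rewrite -div1r ler_pdivrMr; last lra.
    have : 0 <= y * (2 - y) by apply: mulr_ge0; lra.
    by lra.
  lra.
have h2 : 0 < y / 3 by rewrite divr_gt0.
have h3 : 0 < 1 - expR (- y) by exact: lt_le_trans h1.
split.
- by rewrite invr_gt0.
- by rewrite invrK -expRN addrC subrK.
- by rewrite -[3 / y]invf_div lef_pV2.
Qed.

Variables (m : nat) (y Th : R).
Hypotheses (y0 : 0 < y) (y2 : y <= 2).
Hypothesis small : 3 * C * Th * a * m.+2%:R ^+ k <= y.

(** The range condition of [cube_bound] for the leak on a cube of side [2 ^ m.+1], hence the factor
    [m.+2]; this is what [small] is designed for. *)
Lemma small_leak (q phi : R) : 0 < q -> q <= 3 / y -> 0 <= phi -> phi <= Th ->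
  C * (`|q * phi| * a) * m.+2%:R ^+ k <= 1.
Proof.
move=> q0 q3 phi0 phiT; have a0 := test_fun_ge0 tf.
have C0 : 0 <= C by exact: le_trans ler01 C1.
rewrite ger0_norm ?mulr_ge0// ?(ltW q0)//.
apply: (@le_trans _ _ (3 / y * (C * Th * a * m.+2%:R ^+ k))).
  rewrite [leLHS](_ : _ = q * (C * phi * a * m.+2%:R ^+ k)); last by ring.
  apply: ler_pM => //; first exact: ltW.
    by rewrite !mulr_ge0 ?exprn_ge0.
  by do 2 (apply: ler_wpM2r; rewrite ?exprn_ge0//); apply: ler_wpM2l.
rewrite mulrAC ler_pdivrMr// mul1r; apply: le_trans small.
by rewrite le_eqVlt; apply/orP; left; apply/eqP; ring.
Qed.

(* The lengths of the box after [i] of the [K] merging steps. *)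
Let len i : nat -> R := fun j => if (j < i)%N then 2 ^+ m.+1 else 2 ^+ m.

Let lenS i : upd (len i.+1) i (len i.+1 i / 2) = len i.
Proof.
apply/funext => j; rewrite /upd /len; case: ifPn => [/eqP ->|ji].
  by rewrite ltnSn ltnn exprS mulrAC mulfV ?mul1r.
by rewrite ltnS leq_eqVlt (negbTE ji).
Qed.

Let len_gt0 i j : 0 < len i j.
Proof. by rewrite /len; case: ifP; rewrite exprn_gt0. Qed.

Let len_le i j : len i j <= 2 ^+ m.+1.
Proof.
by rewrite /len; case: ifP => // _; rewrite exprS ler_peMl ?exprn_ge0// ler1n.
Qed.

Let len_ge i j : 2 ^+ m <= len i j.
Proof.
by rewrite /len; case: ifP => // _; rewrite exprS ler_peMl ?exprn_ge0// ler1n.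
Qed.

(** The contribution of the leak of one cut per unit of volume: [3 / y] bounds [q], the section has
    measure at most [(2 ^ m.+1) ^ k], and the box has volume at least [(2 ^ m) ^ K]. *)
Let eps := 3 * C * Th * a ^+ 2 * 2 ^+ k / (y * 2 ^+ m).

Let eps_volume i (q phi : R) : 0 < q -> q <= 3 / y -> 0 <= phi -> phi <= Th ->
  C * q * phi * a ^+ 2 * (2 ^+ m.+1) ^+ k <= eps * box_volume K (len i).
Proof.
move=> q0 q3 phi0 phiT; have a0 := test_fun_ge0 tf.
have V : (2 ^+ m) ^+ K <= box_volume K (len i).
  rewrite -box_volume_cst /box_volume; apply: ler_prod => j _.
  by rewrite exprn_ge0//= len_ge.
have C0 : 0 <= C by exact: le_trans ler01 C1.
have eps0 : 0 <= eps.
  by rewrite divr_ge0 ?mulr_ge0 ?exprn_ge0 ?(le_trans phi0 phiT) ?(ltW y0).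
apply: le_trans (ler_wpM2l eps0 V).
rewrite (_ : eps * _ = (3 / y) * (C * Th * a ^+ 2 * (2 ^+ m.+1) ^+ k)); last first.
  rewrite /eps [2 ^+ m.+1]exprS exprMn [(2 ^+ m) ^+ K]exprS.
  by field; rewrite gt_eqF// gt_eqF.
rewrite (_ : C * q * phi * _ * _ = q * (C * phi * a ^+ 2 * (2 ^+ m.+1) ^+ k)); last by ring.
apply: ler_pM => //; first exact: ltW.
  by rewrite !mulr_ge0 ?exprn_ge0.
by do 2 (apply: ler_wpM2r; rewrite ?exprn_ge0//); apply: ler_wpM2l.
Qed.

Lemma merge_upper (B : (nat -> R) -> (nat -> R) -> R) (phi : R) :
  box_additive K B -> 0 < phi -> phi <= Th ->
  (forall s, U (fun t => phi * restrict_box K f s (fun=> 2 ^+ m) t)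
               (phi * B s (fun=> 2 ^+ m))) ->
  forall s, U (fun t => phi * expR (- (K%:R * y)) * restrict_box K f s (fun=> 2 ^+ m.+1) t)
    (phi * expR (- (K%:R * y)) *
     (B s (fun=> 2 ^+ m.+1) + K%:R * eps * box_volume K (fun=> 2 ^+ m.+1))).
Proof.
move=> hB phi0 phiT bot s.
(* Step [i] doubles the boxes in direction [i]. It costs a factor [expR (- y)] in front of the
   function and one more [eps] per unit of volume. *)
have claim i : (i <= K)%N -> forall s,
   U (fun t => phi * expR (- (i%:R * y)) * restrict_box K f s (len i) t)
    (phi * expR (- (i%:R * y)) * (B s (len i) + i%:R * eps * box_volume K (len i))).
  elim: i => [_ {}s|i ih iK {}s].
    by rewrite mul0r oppr0 expR0 mulr1 mul0r mul0r addr0; exact: bot.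
  have i1 : (i < n.+1)%N by apply: leq_trans iK _.
  pose i' := Ordinal i1.
  have [_ [_ /(_ i' (s i + len i.+1 i / 2) iK)]] := sU.
  move=> [W [zeta [sW hz hS hup _]]].
  have [q [q0 pq q3]] := conjugate_exponent y0 y2.
  set th := phi * expR (- (i.+1%:R * y)).
  have th0 : 0 < th by rewrite mulr_gt0// expR_gt0.
  have thT : th <= Th.
    apply: le_trans phiT; rewrite ger_pMr// -[leRHS]expR0 ler_expR oppr_le0.
    by rewrite mulr_ge0// ltW.
  have thS : expR y * th = phi * expR (- (i%:R * y)).
    rewrite mulrCA -expRD; congr (_ * expR _); rewrite -natr1; ring.
  have l0 : 0 <= len i.+1 i by exact: ltW.
  have small' := small_leak q0 q3 (ltW th0) thT.
  have hW := leak_box_test (i := i') (c := - (q * th)) s iK sW hz hS (fun j _ => len_le i.+1 j).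
  rewrite normrN in hW.
  have {}hW := hW small'.
  have tg := test_funZ th (restrict_box_test K s (len i.+1) tf).
  (* The cut is at the midpoint of side [i]. Both halves carry the factor [expR y * th], which is
     the one reached in the previous step. *)
  have := hup _ _ _ (expR y) q
    (expR y * th * (B s (len i) + i%:R * eps * box_volume K (len i)))
    (expR y * th * (B (upd s i (s i + len i.+1 i / 2)) (len i) +
       i%:R * eps * box_volume K (len i)))
    (C * (- (q * th) * a) ^+ 2 * (2 ^+ m.+1) ^+ k) tg (expR_gt0 y) q0 pq.
  move=> /(_ _ _ _)/(splits_mono sU); apply.
  - have := ih (ltnW iK) s; rewrite -thS; congr (U _ _); apply/funext => t.
    rewrite -(lenS i) -(@restrict_box_half_lt K f s (len i.+1) i' iK l0).
    by rewrite -mulrA [X in _ * X]mulrA.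
  - have := ih (ltnW iK) (upd s i (s i + len i.+1 i / 2)); rewrite -thS.
    congr (U _ _); apply/funext => t.
    rewrite -(lenS i) -(@restrict_box_half_ge K f s (len i.+1) i' iK l0).
    by rewrite -mulrA [X in _ * X]mulrA.
  - by apply: (eq_fun_pred hW) => t; ring.
  - have ev := eps_volume i.+1 q0 q3 (ltW th0) thT.
    have [_ /(_ s (len i.+1) i iK l0)] := hB; rewrite lenS => ->.
    have [_ /(_ s (len i.+1) i iK l0)] := box_additive_volume K 1.
    rewrite lenS !mul1r => volE.
    rewrite (_ : (_ + _) / expR y = th * (B s (len i) +
       B (upd s i (s i + len i.+1 i / 2)) (len i) + i%:R * eps * box_volume K (len i.+1))).
      rewrite (_ : _ / q = th * (C * q * th * a ^+ 2 * (2 ^+ m.+1) ^+ k)); last first.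
        by field; rewrite gt_eqF.
      rewrite -mulrDr ler_pM2l// -addrA lerD2l -natr1; lra.
    by rewrite volE; field; rewrite gt_eqF// expR_gt0.
have := claim K (leqnn _) s.
have E j : (j < K)%N -> s j = s j /\ len K j = 2 ^+ m.+1 by rewrite /len => ->.
have -> : B s (len K) = B s (fun=> 2 ^+ m.+1) by apply: hB.1.
have -> : box_volume K (len K) = box_volume K (fun=> 2 ^+ m.+1).
  by apply: eq_bigr => j _; rewrite /len ltn_ord.
have -> : restrict_box K f s (len K) = restrict_box K f s (fun=> 2 ^+ m.+1).
  by apply/funext => t; rewrite /restrict_box (box_ext E).
by [].
Qed.

(** An upper bound [x] for the doubled box yields bounds [x1], [x2] for its halves by the last
    clause of [splits]; the induction hypothesis bounds both from below. Here the factor grows with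
    each step. *)
Lemma merge_lower (B : (nat -> R) -> (nat -> R) -> R) (phi : R) :
  box_additive K B -> 0 < phi -> phi * expR (K%:R * y) <= Th ->
  (forall s x, U (fun t => phi * restrict_box K f s (fun=> 2 ^+ m) t) (phi * x) ->
     B s (fun=> 2 ^+ m) <= x) ->
  forall s x, U (fun t => phi * expR (K%:R * y) *
                   restrict_box K f s (fun=> 2 ^+ m.+1) t) (phi * expR (K%:R * y) * x) ->
    B s (fun=> 2 ^+ m.+1) - K%:R * eps * box_volume K (fun=> 2 ^+ m.+1) <= x.
Proof.
move=> hB phi0 phiT bot s x.
have claim i : (i <= K)%N -> forall s x,
   U (fun t => phi * expR (i%:R * y) * restrict_box K f s (len i) t)
     (phi * expR (i%:R * y) * x) ->
   B s (len i) - i%:R * eps * box_volume K (len i) <= x.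
  elim: i => [_ {}s {}x|i ih iK {}s {}x].
    by rewrite mul0r expR0 mulr1 !mul0r subr0; exact: bot.
  have i1 : (i < n.+1)%N by apply: leq_trans iK _.
  pose i' := Ordinal i1.
  have [_ [_ /(_ i' (s i + len i.+1 i / 2) iK)]] := sU.
  move=> [W [zeta [sW hz hS _ hdown]]].
  have [q [q0 pq q3]] := conjugate_exponent y0 y2.
  set th := phi * expR (i%:R * y).
  have th0 : 0 < th by rewrite mulr_gt0// expR_gt0.
  have thT : th <= Th.
    apply: le_trans phiT; rewrite ler_pM2l// ler_expR ler_pM2r// ler_nat.
    exact: ltnW.
  have thS : phi * expR (i.+1%:R * y) = expR y * th.
    rewrite mulrCA -expRD; congr (_ * expR _); rewrite -natr1; ring.
  have l0 : 0 <= len i.+1 i by exact: ltW.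
  have small' := small_leak q0 q3 (ltW th0) thT.
  have hW := leak_box_test (i := i') (c := q * th) s iK sW hz hS (fun j _ => len_le i.+1 j) small'.
  have tg := test_funZ th (restrict_box_test K s (len i.+1) tf).
  rewrite thS => hx.
  have := hdown _ _ _ (expR y) q (expR y * th * x)
    (C * (q * th * a) ^+ 2 * (2 ^+ m.+1) ^+ k) tg (expR_gt0 y) q0 pq.
  move=> /(_ _ _)[||x1 [x2 [h1 h2 h12]]].
  - by apply: (eq_fun_pred hx) => t; ring.
  - by apply: (eq_fun_pred hW) => t; ring.
  have {}h1 : B s (len i) - i%:R * eps * box_volume K (len i) <= x1 / th.
    apply: ih; first exact: ltnW.
    move: h1; rewrite -/th mulrCA mulfV ?mulr1 ?gt_eqF//.
    congr (U _ _); apply/funext => t.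
    rewrite -(lenS i) -(@restrict_box_half_lt K f s (len i.+1) i' iK l0).
    by rewrite mulrA.
  have {}h2 : B (upd s i (s i + len i.+1 i / 2)) (len i)
      - i%:R * eps * box_volume K (len i) <= x2 / th.
    apply: ih; first exact: ltnW.
    move: h2; rewrite -/th mulrCA mulfV ?mulr1 ?gt_eqF//.
    congr (U _ _); apply/funext => t.
    rewrite -(lenS i) -(@restrict_box_half_ge K f s (len i.+1) i' iK l0).
    by rewrite mulrA.
  have ev := eps_volume i.+1 q0 q3 (ltW th0) thT.
  have [_ /(_ s (len i.+1) i iK l0)] := hB; rewrite lenS => ->.
  have [_ /(_ s (len i.+1) i iK l0)] := box_additive_volume K 1.
  rewrite lenS !mul1r => volE.
  have : (x1 + x2) / th <= x + C * q * th * a ^+ 2 * (2 ^+ m.+1) ^+ k.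
    rewrite ler_pdivrMr//; apply: (le_trans h12).
    rewrite le_eqVlt; apply/orP; left; apply/eqP.
    by field; rewrite gt_eqF//= gt_eqF// expR_gt0.
  have key : i%:R * eps * box_volume K (len i.+1) =
      i%:R * eps * box_volume K (len i) + i%:R * eps * box_volume K (len i).
    by rewrite volE mulrDr.
  rewrite mulrDl -[i.+1%:R]natr1 => h12'; have := lerD h1 h2; move: ev h12' key.
  rewrite [(_ + 1) * eps]mulrDl mul1r [(_ + eps) * _]mulrDl.
  move: (x1 / th) (x2 / th) (C * q * th * a ^+ 2 * (2 ^+ m.+1) ^+ k).
  move: (eps * box_volume K (len i.+1)) (i%:R * eps * box_volume K (len i.+1)).
  move: (i%:R * eps * box_volume K (len i)) (B s (len i)).
  by move: (B (upd s i (s i + len i.+1 i / 2)) (len i)) => *; lra.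
have E j : (j < K)%N -> s j = s j /\ len K j = 2 ^+ m.+1 by rewrite /len => ->.
have := claim K (leqnn _) s x.
have -> : B s (len K) = B s (fun=> 2 ^+ m.+1) by apply: hB.1.
have -> : box_volume K (len K) = box_volume K (fun=> 2 ^+ m.+1).
  by apply: eq_bigr => j _; rewrite /len ltn_ord.
have -> : restrict_box K f s (len K) = restrict_box K f s (fun=> 2 ^+ m.+1).
  by apply/funext => t; rewrite /restrict_box (box_ext E).
by [].
Qed.

End halving.

Lemma geometric_le (x : R) j M : 0 <= x -> x < 1 ->
  \sum_(j <= l < M) x ^+ l <= x ^+ j / (1 - x).
Proof.
move=> x0 x1; have x1' : 0 < 1 - x by rewrite subr_gt0.
rewrite ler_pdivlMr//; have [jM|/ltnW Mj] := leqP j M; last first.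
  by rewrite big_geq// mul0r exprn_ge0.
rewrite (_ : _ * _ = x ^+ j - x ^+ M); first by rewrite gerBl exprn_ge0.
elim: M jM => [|M ih]; first by rewrite leqn0 => /eqP ->; rewrite big_geq// mul0r subrr.
rewrite leq_eqVlt => /orP[/eqP <-|jM]; first by rewrite big_geq// mul0r subrr.
rewrite big_nat_recr//= mulrDl ih// exprS; ring.
Qed.

(** * Iteration over dyadic scales *)

Section levels.
Variables (k : nat) (C : R) (U : ('rV[R]_n.+1 -> R) -> R -> Prop).
Hypotheses (C1 : 1 <= C) (kn : (k < n.+1)%N).
Hypotheses (cb : cube_bound k C) (sU : splits k.+1 U).
Variables (a : R) (S : set 'rV[R]_n.+1) (f : 'rV[R]_n.+1 -> R).
Hypothesis tf : test_fun a S f.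
Variables (j M : nat) (tau : R).
Local Notation K := k.+1.
Local Notation Th := (expR (5 * K%:R)).
Hypotheses (tau0 : 0 <= tau) (Mtau : M%:R * tau <= 1).
Hypothesis small : 3 * C * Th * a * M.+1%:R ^+ k <= tau.

(** The logarithm of the exponent used at scale [2 ^ m]. The geometric term makes the leaks
    summable, and [tau] keeps each leak in the range of [cube_bound]. *)
Let y (m : nat) : R := (3 / 4) ^+ m + tau.
Let Y (m m' : nat) : R := \sum_(m <= l < m') y l.

Let y_gt0 (l : nat) : 0 < y l.
Proof. by rewrite ltr_wpDr// exprn_gt0//; lra. Qed.

Let Y_ge0 m m' : 0 <= Y m m'.
Proof. by apply: sumr_ge0 => l _; exact: ltW. Qed.

Let Y_le m m' : (m' <= M)%N -> Y m m' <= 4 * (3 / 4) ^+ m + M%:R * tau.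
Proof.
move=> mM; rewrite /Y big_split/=; apply: lerD.
  have := @geometric_le (3 / 4) m m'; rewrite (_ : 1 - 3 / 4 = 4^-1); last by field.
  by rewrite invrK => h; rewrite [leRHS]mulrC; apply: h; lra.
rewrite sumr_const_nat -[leLHS]mulr_natl ler_wpM2r// ler_nat.
by rewrite (leq_trans (leq_subr _ _)).
Qed.

(** The origin of the 5 in [Th]: the geometric series contributes at most 4 and [M * tau] at most
    1. *)
Let Y_le5 m m' : (m' <= M)%N -> Y m m' <= 5.
Proof.
move=> mM; apply: le_trans (Y_le m mM) _.
have : (3 / 4) ^+ m <= 1 :> R by apply: exprn_ile1; lra.
by have := Mtau; lra.
Qed.

Let y_le2 (l : nat) : (l < M)%N -> y l <= 2.
Proof.
move=> lM; rewrite /y; have : (3 / 4) ^+ l <= 1 :> R by apply: exprn_ile1; lra.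
have : tau <= M%:R * tau by rewrite ler_peMl// ler1n; case: M lM.
by have := Mtau; lra.
Qed.

Let small_level (l : nat) : (l < M)%N -> 3 * C * Th * a * l.+2%:R ^+ k <= y l.
Proof.
move=> lM; have a0 := test_fun_ge0 tf; have C0 : 0 <= C by exact: le_trans ler01 C1.
apply: (@le_trans _ _ tau); last by rewrite lerDr exprn_ge0//; lra.
apply: le_trans small; apply: ler_wpM2l; first by rewrite !mulr_ge0 ?expR_ge0.
by rewrite lerXn2r ?nnegrE// ler_nat.
Qed.

Let Ceps := 3 * K%:R * C * Th * 2 ^+ k * a ^+ 2.
Let Err m m' := Ceps * \sum_(m <= l < m') (2 / 3) ^+ l.

Let eps_le (l : nat) : K%:R * (3 * C * Th * a ^+ 2 * 2 ^+ k / (y l * 2 ^+ l)) <= Ceps * (2 / 3) ^+ l.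
Proof.
have a0 := test_fun_ge0 tf; have C0 : 0 <= C by exact: le_trans ler01 C1.
rewrite (_ : K%:R * _ = Ceps * (y l * 2 ^+ l)^-1); last by rewrite /Ceps; ring.
apply: ler_wpM2l; first by rewrite /Ceps !mulr_ge0 ?exprn_ge0 ?expR_ge0.
rewrite (_ : (2 / 3) ^+ l = ((3 / 4) ^+ l * 2 ^+ l)^-1); last first.
  by rewrite -exprMn -exprVn; congr (_ ^+ _); field.
have p0 : 0 < (3 / 4 : R) ^+ l by rewrite exprn_gt0//; lra.
rewrite lef_pV2 ?posrE ?mulr_gt0 ?exprn_gt0//.
by rewrite ler_wpM2r ?exprn_ge0// lerDl.
Qed.

Let vol m := box_volume K (fun=> 2 ^+ m : R).

Let vol_ge0 m : 0 <= vol m.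
Proof. by rewrite /vol box_volume_cst !exprn_ge0. Qed.

(** The factor in front of the function decreases to 1 at scale [M]. The error collected so far is
    proportional to the volume, so it joins the additive quantity before the next merging. *)
Lemma levels_upper (B : (nat -> R) -> (nat -> R) -> R) : box_additive K B ->
  (forall s, U (fun t => expR (K%:R * Y j M) * restrict_box K f s (fun=> 2 ^+ j) t)
               (expR (K%:R * Y j M) * B s (fun=> 2 ^+ j))) ->
  forall m, (j <= m <= M)%N -> forall s,
    U (fun t => expR (K%:R * Y m M) * restrict_box K f s (fun=> 2 ^+ m) t)
      (expR (K%:R * Y m M) * (B s (fun=> 2 ^+ m) + Err j m * vol m)).
Proof.
move=> hB bot; elim=> [|m ih] /andP[jm mM] s.
  move: jm; rewrite leqn0 => /eqP j0; move: bot; rewrite /Err j0 big_geq//.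
  by rewrite mulr0 mul0r addr0; exact.
move: jm; rewrite leq_eqVlt => /orP[/eqP jm|].
  by move: bot; rewrite /Err jm big_geq// mulr0 mul0r addr0; exact.
rewrite ltnS => jm.
have {}ih := ih (introT andP (conj jm (ltnW mM))).
have hB' := box_additiveD hB (box_additive_volume K (Err j m)).
have PT : expR (K%:R * Y m M) <= Th.
  by rewrite ler_expR mulrC ler_wpM2r// Y_le5.
have := merge_upper C1 kn cb sU tf (y_gt0 m) (y_le2 mM) (small_level mM) hB'
  (expR_gt0 _) PT ih s.
have YE : expR (K%:R * Y m M) * expR (- (K%:R * y m)) = expR (K%:R * Y m.+1 M).
  by rewrite -expRD /Y (@big_ltn _ _ _ m)//; congr expR; ring.
rewrite YE => h; apply: (splits_mono sU h).
rewrite ler_pM2l ?expR_gt0// -addrA lerD2l -mulrDl ler_wpM2r ?vol_ge0//.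
by rewrite /Err big_nat_recr//= mulrDr lerD2l eps_le.
Qed.

(** Dually, the factor is 1 at scale [j] and grows to its full value at scale [M]. *)
Lemma levels_lower (B : (nat -> R) -> (nat -> R) -> R) : box_additive K B ->
  (forall s x, U (restrict_box K f s (fun=> 2 ^+ j)) x -> B s (fun=> 2 ^+ j) <= x) ->
  forall m, (j <= m <= M)%N -> forall s x,
    U (fun t => expR (K%:R * Y j m) * restrict_box K f s (fun=> 2 ^+ m) t)
      (expR (K%:R * Y j m) * x) ->
    B s (fun=> 2 ^+ m) - Err j m * vol m <= x.
Proof.
move=> hB bot.
have base m : j = m -> forall s x,
    U (fun t => expR (K%:R * Y j m) * restrict_box K f s (fun=> 2 ^+ m) t)
      (expR (K%:R * Y j m) * x) ->
    B s (fun=> 2 ^+ m) - Err j m * vol m <= x.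
  move=> <- s x; rewrite /Err /Y !big_geq// !mulr0 mul0r subr0 expR0 mul1r => h.
  by apply: bot; apply: (eq_fun_pred h) => t; rewrite mul1r.
elim=> [|m ih] /andP[jm mM] s x.
  by apply: base; apply/eqP; rewrite -leqn0.
move: jm; rewrite leq_eqVlt => /orP[/eqP jm|]; first exact: base.
rewrite ltnS => jm.
have {}ih := ih (introT andP (conj jm (ltnW mM))).
have hB' := box_additiveD hB (box_additive_volume K (- Err j m)).
have YE : expR (K%:R * Y j m) * expR (K%:R * y m) = expR (K%:R * Y j m.+1).
  by rewrite -expRD /Y big_nat_recr//=; congr expR; ring.
have PT : expR (K%:R * Y j m) * expR (K%:R * y m) <= Th.
  by rewrite YE ler_expR mulrC ler_wpM2r// Y_le5.
have ih' s' x' : U (fun t => expR (K%:R * Y j m) * restrict_box K f s' (fun=> 2 ^+ m) t)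
      (expR (K%:R * Y j m) * x') ->
    B s' (fun=> 2 ^+ m) + - Err j m * box_volume K (fun=> 2 ^+ m) <= x'.
  by move=> h; rewrite mulNr; exact: ih.
have := merge_lower C1 kn cb sU tf (y_gt0 m) (y_le2 mM) (small_level mM) hB'
  (expR_gt0 _) PT ih' (s := s) (x := x).
rewrite YE => h /h; apply: le_trans.
rewrite -addrA lerD2l -mulNr -mulrBl ler_wpM2r ?vol_ge0//.
by rewrite /Err big_nat_recr//= mulrDr opprD lerD2l lerN2 eps_le.
Qed.

End levels.

(* [p] is the product of the Hoelder exponents spent in assembling a cube of
   side [2 ^ M] from cubes of side [2 ^ j], and the term in [K * a ^+ 2] is the
   total contribution of the leaks. *)
Definition subcube_bounds k (K : R) : Prop :=
  forall j M (a delta : R), (j <= M)%N -> 0 <= a -> delta <= 1 ->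
    K * a * M.+1%:R ^+ k <= delta ->
    exists p, [/\ 1 <= p, p <= expR (K * ((3 / 4) ^+ j + delta)) &
    forall U S f B, splits k U -> test_fun a S f -> box_additive k B ->
    ((forall s, U (fun t => p * restrict_box k f s (fun=> 2 ^+ j) t)
                    (p * B s (fun=> 2 ^+ j))) ->
       forall s, U (restrict_box k f s (fun=> 2 ^+ M))
         (B s (fun=> 2 ^+ M) + K * a ^+ 2 * (2 / 3) ^+ j * (2 ^+ M) ^+ k)) /\
      ((forall s x, U (restrict_box k f s (fun=> 2 ^+ j)) x -> B s (fun=> 2 ^+ j) <= x) ->
       forall s x, U (fun t => p * restrict_box k f s (fun=> 2 ^+ M) t) (p * x) ->
         B s (fun=> 2 ^+ M) - K * a ^+ 2 * (2 / 3) ^+ j * (2 ^+ M) ^+ k <= x)].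

Lemma cube_bound_subcubes k C : 1 <= C -> (k < n.+1)%N -> cube_bound k C ->
  exists2 K, 1 <= K & subcube_bounds k.+1 K.
Proof.
move=> C1 kn cb; pose Th : R := expR (5 * k.+1%:R).
have C0 : 0 <= C by exact: le_trans ler01 C1.
have Th0 : 0 <= Th by exact: expR_ge0.
(* [K1] comes from the range condition on the leaks. [K2] is the constant of the leak errors times
   3, from the sum of the powers of [2 / 3]. *)
pose K1 : R := 3 * C * Th; pose K2 : R := 9 * k.+1%:R * C * Th * 2 ^+ k.
have K10 : 0 <= K1 by rewrite !mulr_ge0.
have K20 : 0 <= K2 by rewrite !mulr_ge0 ?exprn_ge0.
have K30 : 0 <= 4 * k.+1%:R :> R by rewrite mulr_ge0.
exists (1 + K1 + K2 + 4 * k.+1%:R); first lra.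
set K : R := 1 + K1 + K2 + 4 * k.+1%:R.
move=> j M a delta jM a0 d1 hd.
pose tau : R := K1 * a * M.+1%:R ^+ k.
have tau0 : 0 <= tau by rewrite !mulr_ge0 ?exprn_ge0.
(* Summing the same [tau] over the [M] scales produces the additional power of [M.+1]. *)
have Mtau : M%:R * tau <= delta.
  apply: le_trans hd; apply: (@le_trans _ _ (M.+1%:R * tau)).
    by rewrite ler_wpM2r// ler_nat.
  rewrite /tau exprS (_ : M.+1%:R * _ = K1 * (a * (M.+1%:R * M.+1%:R ^+ k))); last by ring.
  rewrite -mulrA ler_wpM2r ?mulr_ge0 ?exprn_ge0//; rewrite /K; lra.
have Mtau1 := le_trans Mtau d1.
pose Y : R := \sum_(j <= l < M) ((3 / 4) ^+ l + tau).
have Y0 : 0 <= Y.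
  by apply: sumr_ge0 => l _; rewrite addr_ge0// exprn_ge0//; lra.
have YY : Y <= 4 * (3 / 4) ^+ j + delta.
  rewrite /Y big_split/=; apply: lerD.
    have := @geometric_le (3 / 4) j M; rewrite (_ : 1 - 3 / 4 = 4^-1); last by field.
    by rewrite invrK => h; rewrite [leRHS]mulrC; apply: h; lra.
  apply: le_trans Mtau; rewrite sumr_const_nat -[leLHS]mulr_natl ler_wpM2r// ler_nat.
  exact: leq_subr.
have E m : 3 * k.+1%:R * C * Th * 2 ^+ k * a ^+ 2 * (\sum_(j <= l < M) (2 / 3) ^+ l) *
    box_volume k.+1 (fun=> 2 ^+ m) <= K * a ^+ 2 * (2 / 3) ^+ j * (2 ^+ m) ^+ k.+1.
  rewrite box_volume_cst ler_wpM2r ?exprn_ge0//.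
  have := @geometric_le (2 / 3) j M; rewrite (_ : 1 - 2 / 3 = 3^-1); last by field.
  rewrite invrK => h; have {}h : \sum_(j <= l < M) (2 / 3) ^+ l <= (2 / 3) ^+ j * 3 :> R.
    by apply: h; lra.
  have c0 : 0 <= 3 * k.+1%:R * C * Th * 2 ^+ k * a ^+ 2.
    by rewrite !mulr_ge0 ?exprn_ge0.
  apply: le_trans (ler_wpM2l c0 h) _.
  rewrite (_ : _ * ((2 / 3) ^+ j * 3) = K2 * (a ^+ 2 * (2 / 3) ^+ j)); last by rewrite /K2; ring.
  rewrite -mulrA ler_wpM2r//; last by rewrite /K; lra.
  by rewrite mulr_ge0 ?exprn_ge0//; lra.
have small : 3 * C * expR (5 * k.+1%:R) * a * M.+1%:R ^+ k <= tau by [].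
exists (expR (k.+1%:R * Y)); split.
- by rewrite -expR0 ler_expR mulr_ge0.
- rewrite ler_expR; apply: (@le_trans _ _ (k.+1%:R * (4 * (3 / 4) ^+ j + delta))).
    by rewrite ler_wpM2l.
  have d0 : 0 <= delta by apply: le_trans Mtau; rewrite mulr_ge0.
  have g0 : 0 <= (3 / 4) ^+ j :> R by rewrite exprn_ge0//; lra.
  rewrite !mulrDr mulrA; apply: lerD; apply: ler_wpM2r => //.
    by rewrite mulrC /K; lra.
  have : 1 <= k.+1%:R :> R by rewrite ler1n.
  by rewrite /K; lra.
move=> U S f B sU tf hB; split=> bot s.
  have := levels_upper C1 kn cb sU tf tau0 Mtau1 small hB bot
    (introT andP (conj jM (leqnn M))) s.
  rewrite [X in _ * X](big_geq (leqnn M)) mulr0 expR0 => h.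
  have {}h : U (restrict_box k.+1 f s (fun=> 2 ^+ M)) _ := eq_fun_pred h (fun t => mul1r _).
  by apply: (splits_mono sU h); rewrite mul1r lerD2l.
move=> x hx.
have := levels_lower C1 kn cb sU tf tau0 Mtau1 small hB bot
    (introT andP (conj jM (leqnn M))) hx.
by apply: le_trans; rewrite lerD2l lerN2.
Qed.

Lemma cube_bound0 : cube_bound 0 16.
Proof.
move=> U [_ hU] m s a S f tf _; rewrite !expr0 !mulr1 => h.
by have a0 := test_fun_ge0 tf; apply: hU tf _; lra.
Qed.

Lemma restrict_box_id k a S f s l : test_fun a S f ->
  (forall t, f t != 0 -> box k s l t) -> restrict_box k f s l = f.
Proof.
move=> _ h; apply/funext => t; rewrite /restrict_box indicE.
have [->|f0] := eqVneq (f t) 0; first by rewrite mul0r.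
by rewrite mem_set ?mulr1//; exact: h.
Qed.

(** The bound for [k] controls the leaks, and assembling the cube from unit cubes gives the bound
    for [k + 1]. *)
Lemma exists_cube_bound k : (k <= n.+1)%N -> exists2 C, 1 <= C & cube_bound k C.
Proof.
elim: k => [_|k ih kn]; first by exists 16; [rewrite ler1n|exact: cube_bound0].
have [C C1 cb] := ih (ltnW kn); have [K K1 hK] := cube_bound_subcubes C1 kn cb.
have K0 : 0 <= K by exact: le_trans ler01 K1.
(* The bound [K * ((3 / 4) ^ 0 + 1)] on the logarithm of [p], for [j = 0] and [delta = 1]. *)
pose Pm : R := expR (K * 2).
have Pm1 : 1 <= Pm by rewrite -[leLHS]expR0 ler_expR mulr_ge0.
exists (16 * Pm + K); first by lra.
move=> U sU m s a S f tf fs small; have a0 := test_fun_ge0 tf.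
have M1 : 1 <= m.+1%:R ^+ k.+1 :> R by rewrite exprn_ege1// ler1n.
have small1 : (16 * Pm + K) * a <= 1.
  by apply: le_trans small; rewrite ler_peMr// mulr_ge0//; lra.
have small2 : K * a * m.+1%:R ^+ k.+1 <= 1.
  apply: le_trans small; rewrite ler_wpM2r ?exprn_ge0// ler_wpM2r//; lra.
have [p [p1 pP hp]] := hK 0 m a 1 (leq0n _) a0 (lexx 1) small2.
have pPm : p <= Pm by move: pP; rewrite expr0 -(natrD _ 1 1).
(* On a unit cube the bound for [p] times the function is [16 * (p * a) ^ 2], that is [p] times this
   density. *)
have [hup _] := hp _ _ _ _ sU tf (box_additive_volume k.+1 (16 * p * a ^+ 2)).
have := hup _ s; rewrite (restrict_box_id tf fs) => h.
have {h} : U f (16 * p * a ^+ 2 * box_volume k.+1 (fun=> 2 ^+ m) +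
    K * a ^+ 2 * (2 / 3) ^+ 0 * (2 ^+ m) ^+ k.+1).
  apply: h => s'; rewrite box_volume_cst expr0 expr1n mulr1.
  have tg := test_funZ p (restrict_box_test k.+1 s' (fun=> 1) tf).
  have [_ [hu _]] := sU; have := hu s' _ _ _ tg.
  rewrite ger0_norm; last by lra.
  rewrite (_ : 16 * (p * a) ^+ 2 = p * (16 * p * a ^+ 2)); last by ring.
  apply.
    have : p * a <= Pm * a by rewrite ler_wpM2r.
    have : 0 <= K * a by rewrite mulr_ge0.
    by move: small1; rewrite mulrDl -mulrA; lra.
  move=> t; apply: contra_neqP => tb.
  by rewrite /restrict_box indicE memNset// !mulr0.
move=> h; apply: (splits_mono sU h); rewrite box_volume_cst expr0 mulr1 -mulrDl.
rewrite ler_wpM2r ?exprn_ge0// -mulrDl ler_wpM2r ?exprn_ge0//.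
by lra.
Qed.

End boxes.

(** * Lebesgue measure of boxes *)

Section rational_boxes.
Context {R : realType} {n : nat}.
Local Notation B_ := (borel_rV R n).

(** A countable base of the topology, through which measurability of vector-valued maps is
    tested. *)
Definition rat_cube (q : 'rV[rat]_n * nat) : set 'rV[R]_n :=
  [set t | forall j, `|t ord0 j - ratr (q.1 ord0 j)| < q.2.+1%:R^-1].

Lemma open_rat_cubes (U : set 'rV[R]_n) : open U ->
  U = \bigcup_(q in [set q | rat_cube q `<=` U]) rat_cube q.
Proof.
move=> oU; apply/seteqP; split=> [t Ut|t [q qU tq]]; last exact: qU.
have /nbhs_ballP[e/= e0 eU] : nbhs t U by exact: open_nbhs_nbhs.
have [N Ne] : exists N : nat, N.+1%:R^-1 < e / 2.
  exists (Num.truncn (2 / e)).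
  by rewrite -[e / 2]invf_div ltf_pV2 ?posrE ?divr_gt0// truncnS_gt.
have N0 : 0 < N.+1%:R^-1 :> R by rewrite invr_gt0.
have hq j : exists q : rat, `|t ord0 j - ratr q| < N.+1%:R^-1.
  have tN : t ord0 j - N.+1%:R^-1 < t ord0 j + N.+1%:R^-1 by rewrite ltrD2l gtrN.
  have [q] := rat_in_itvoo tN.
  by rewrite in_itv/= => h; exists q; rewrite distrC ltr_distl.
have /choice[q {}hq] := hq.
exists (\row_j q j, N); last by move=> j; rewrite mxE.
move=> u hu; apply: eU; rewrite -ball_normE /=.
have -> : `|t - u| = mx_norm (t - u) by [].
rewrite mx_normrE; apply/bigmax_ltP; split=> // -[i j] _ /=.
rewrite !ord1 !mxE; have := hu j; rewrite mxE/= => h1; have := hq j => h2.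
rewrite (_ : t ord0 j - u ord0 j = (t ord0 j - ratr (q j)) - (u ord0 j - ratr (q j))); last by ring.
rewrite (le_lt_trans (ler_normB _ _))// (lt_le_trans (ltrD h2 h1))//.
by rewrite [leRHS]splitr lerD// ltW.
Qed.

Lemma measurable_rat_cubes d (T : measurableType d) (F : T -> 'rV[R]_n) :
  (forall q, measurable (F @^-1` rat_cube q)) ->
  measurable_fun setT (F : T -> B_).
Proof.
move=> hF; apply: (@measurability _ _ T B_ setT F open) => // _ [U oU <-].
rewrite setTI (open_rat_cubes oU) preimage_bigcup.
by rewrite bigcup_mkcond; apply: countable_bigcupT_measurable => // q; case: ifP.
Qed.

End rational_boxes.

Section lebesgue_rV_measure.
Context {R : realType}.

Definition row_cons (m : nat) (p : R * borel_rV R m) : borel_rV R m.+1 :=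
  row_mx (p.1%:M : 'rV[R]_1) (p.2 : 'rV[R]_m).

Lemma row_cons0 m p : row_cons p ord0 (ord0 : 'I_m.+1) = p.1.
Proof. by rewrite /row_cons mxE; case: splitP => // j _; rewrite mxE !ord1 eqxx. Qed.

Lemma row_consS m p (j : 'I_m) : row_cons p ord0 (lift ord0 j) = (p.2 : 'rV[R]_m) ord0 j.
Proof.
rewrite /row_cons mxE; case: splitP => [[[]//]|k] /=.
by rewrite /bump !add1n => -[jk]; congr ((p.2 : 'rV[R]_m) ord0 _); exact/val_inj.
Qed.

Lemma forall_ordS m (P : 'I_m.+1 -> Prop) :
  (forall j, P j) <-> P ord0 /\ forall j, P (lift ord0 j).
Proof.
split=> [h|[h0 hS] j]; first by split.
by case: (unliftP ord0 j) => [j' ->|->].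
Qed.

Lemma measurable_coord_rV m (i : 'I_m) :
  measurable_fun setT (fun t : borel_rV R m => (t : 'rV[R]_m) ord0 i).
Proof. by case: m i => [[]//|m] i; exact: measurable_coord. Qed.

Lemma measurable_row_cons m : measurable_fun setT (@row_cons m).
Proof.
apply: measurable_rat_cubes => q.
rewrite (_ : _ @^-1` _ = [set x | `|x - ratr (q.1 ord0 ord0)| < q.2.+1%:R^-1] `*`
  (\bigcap_(j in [set: 'I_m]) [set v : borel_rV R m |
     `|(v : 'rV[R]_m) ord0 j - ratr (q.1 ord0 (lift ord0 j))| < q.2.+1%:R^-1])).
  apply: measurableX.
    rewrite (_ : [set x | _] = `]ratr (q.1 ord0 ord0) - q.2.+1%:R^-1,
      ratr (q.1 ord0 ord0) + q.2.+1%:R^-1[%classic); first exact: measurable_itv.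
    by apply/seteqP; split=> x /=; rewrite in_itv/= ltr_distl.
  apply: fin_bigcap_measurable => // j _.
  rewrite (_ : [set v | _] = (fun t : borel_rV R m => (t : 'rV[R]_m) ord0 j) @^-1`
    `]ratr (q.1 ord0 (lift ord0 j)) - q.2.+1%:R^-1,
      ratr (q.1 ord0 (lift ord0 j)) + q.2.+1%:R^-1[%classic).
    by rewrite -[X in measurable X]setTI; apply: measurable_coord_rV.
  by apply/seteqP; split=> x /=; rewrite in_itv/= ltr_distl.
apply/seteqP; split=> -[x v].
  move=> /= /forall_ordS[]; rewrite row_cons0/= => h0 hS; split => // j _ /=.
  by have := hS j; rewrite row_consS.
move=> [/= h0 hS]; apply/forall_ordS; rewrite row_cons0/=; split=> // j.
by rewrite row_consS; exact: (hS j).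
Qed.

Definition full_box m (s l : 'I_m -> R) : set 'rV[R]_m :=
  [set t | forall j, s j <= t ord0 j < s j + l j].

Section step.
Variables (m : nat) (mu : {sigma_finite_measure set (borel_rV R m) -> \bar R}).

Definition lebesgue_step : set (borel_rV R m.+1) -> \bar R :=
  pushforward (lebesgue_measure \x mu)%E (@row_cons m).

Let step0 : lebesgue_step set0 = 0%E.
Proof. by rewrite /lebesgue_step /pushforward preimage_set0 measure0. Qed.

Let step_ge0 A : (0 <= lebesgue_step A)%E.
Proof. by rewrite /lebesgue_step /pushforward; exact: measure_ge0. Qed.

Let step_sigma_additive : semi_sigma_additive lebesgue_step.
Proof.
move=> F mF tF mUF; rewrite /lebesgue_step /pushforward preimage_bigcup.
have mc A : measurable A -> measurable (@row_cons m @^-1` A).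
  by move=> mA; rewrite -[X in measurable X]setTI; exact: measurable_row_cons.
apply: measure_semi_sigma_additive; first by move=> i; exact: mc.
  by move=> i j _ _ [x [xi xj]]; apply: tF => //; exists (row_cons x).
by rewrite -preimage_bigcup; exact: mc.
Qed.

HB.instance Definition _ := isMeasure.Build _ (borel_rV R m.+1) R lebesgue_step
  step0 step_ge0 step_sigma_additive.

Lemma lebesgue_step_box (s l : 'I_m.+1 -> R) : (forall j, 0 <= l j) ->
  measurable (full_box (s \o lift ord0) (l \o lift ord0) : set (borel_rV R m)) ->
  mu (full_box (s \o lift ord0) (l \o lift ord0)) = (\prod_j l (lift ord0 j))%:E ->
  lebesgue_step (full_box s l) = (\prod_j l j)%:E.
Proof.
move=> l0 mb muE; rewrite /lebesgue_step /pushforward.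
rewrite (_ : _ @^-1` _ = `[s ord0, s ord0 + l ord0[%classic `*`
  full_box (s \o lift ord0) (l \o lift ord0)); last first.
  apply/seteqP; split=> -[x v].
    move=> /forall_ordS[]; rewrite row_cons0/= => h0 hS; split; first by rewrite /= in_itv.
    by move=> j; have := hS j; rewrite row_consS.
  move=> [/=]; rewrite in_itv/= => h0 hS; apply/forall_ordS; rewrite row_cons0; split=> // j.
  by rewrite row_consS; exact: hS.
rewrite product_measure1E//= muE big_ord_recl EFinM; congr (_ * _)%E.
rewrite lebesgue_measure_itv/= lte_fin ltrDl; case: ltP => h.
  by rewrite -EFinD addrC addKr.
by congr (_%:E); apply/eqP; rewrite eq_le l0 h.
Qed.

End step.

Lemma measurable_full_box m (s l : 'I_m -> R) :
  measurable (full_box s l : set (borel_rV R m)).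
Proof.
rewrite (_ : full_box s l = \bigcap_(j in [set: 'I_m])
    (fun t : borel_rV R m => (t : 'rV[R]_m) ord0 j) @^-1` `[s j, s j + l j[%classic).
  apply: (@fin_bigcap_measurable _ (borel_rV R m)) => // j _.
  by rewrite -[X in measurable X]setTI; apply: measurable_coord_rV.
apply/seteqP; split=> t h j; first by move=> _ /=; rewrite in_itv; exact: h.
by have := h j I; rewrite /= in_itv.
Qed.

Lemma box_sigma_finite m (mu : {measure set (borel_rV R m) -> \bar R}) :
  (forall s l : 'I_m -> R, (forall j, 0 <= l j) -> mu (full_box s l) = (\prod_j l j)%:E) ->
  sigma_finite setT mu.
Proof.
move=> muE; exists (fun N => full_box (fun=> - N%:R) (fun=> N.*2%:R)).
  apply/seteqP; split=> // t _; pose N := (Num.truncn `|t|).+1.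
  exists N => // j /=.
  have tN : `|t ord0 j| < N%:R.
    apply: le_lt_trans (truncnS_gt _).
    have -> : `|t| = mx_norm t by []; rewrite mx_normrE.
    exact: (le_bigmax _ _ (ord0, j)).
  move: tN; rewrite ltr_norml -addnn natrD => /andP[h1 h2].
  by apply/andP; split; lra.
move=> N; split; first exact: measurable_full_box.
by rewrite muE// ltry.
Qed.

(** [lebesgue_rV] is a bare set function. Measure structure and volumes of boxes are established
    together, because the volumes give the sigma-finiteness that the next product needs. *)
Lemma lebesgue_rVP m : exists2 mu : {sigma_finite_measure set (borel_rV R m) -> \bar R},
  @lebesgue_rV R m = mu &
  forall s l : 'I_m -> R, (forall j, 0 <= l j) -> mu (full_box s l) = (\prod_j l j)%:E.
Proof.
elim: m => [|m [mu muE hmu]].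
  exists [the {sigma_finite_measure set (borel_rV R 0) -> \bar R} of
     @dirac _ (borel_rV R 0) (0 : 'rV[R]_0) R] => //.
  move=> s l _; rewrite big_ord0 /= /dirac indicE mem_set//.
  by case.
have vol (s l : 'I_m.+1 -> R) : (forall j, 0 <= l j) ->
    lebesgue_step mu (full_box s l) = (\prod_j l j)%:E.
  move=> l0; apply: lebesgue_step_box => //; first exact: measurable_full_box.
  by rewrite hmu//= => j; exact: l0.
pose sf := Measure_isSigmaFinite.Build _ _ _ (lebesgue_step mu)
  (@box_sigma_finite _ (lebesgue_step mu) vol).
pose M : {sigma_finite_measure set (borel_rV R m.+1) -> \bar R} :=
  HB.pack (lebesgue_step mu) sf.
by exists M => //=; rewrite muE.
Qed.

End lebesgue_rV_measure.

(** * Second order expansions on a bounded set *)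

Section exp_taylor2.
Context {R : realType}.
Implicit Types w x y : R.

Lemma expR_series_le x N : 0 <= x -> \sum_(0 <= i < N) x ^+ i / i`!%:R <= expR x.
Proof.
move=> x0; apply: (@nondecreasing_cvgn_le _ (series (exp_coeff x))); last first.
  exact: is_cvg_series_exp_coeff.
by apply: nondecreasing_series => i _ _; rewrite exp_coeff_ge0.
Qed.

(** The series from its cubic term on is compared term by term with [|w| ^ 3] times the full series,
    using [i! <= (i + 3)!]. *)
Lemma expR_taylor2 w : `|expR w - (1 + w + w ^+ 2 / 2)| <= `|w| ^+ 3 * expR `|w|.
Proof.
have h : series (exp_coeff w) @ \oo --> expR w by exact: is_cvg_series_exp_coeff.
have h3 : (fun N => `|series (exp_coeff w) (N + 3)%N - (1 + w + w ^+ 2 / 2)|) @ \oo -->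
    `|expR w - (1 + w + w ^+ 2 / 2)|.
  apply: cvg_norm; apply: cvgB; last exact: cvg_cst.
  by rewrite (cvg_shiftn 3 (series (exp_coeff w))).
rewrite -(cvg_lim _ h3)//; apply: limr_le; first by apply/cvg_ex; eexists; exact: h3.
apply: nearW => N; rewrite addn3 /series/= !big_nat_recl// /exp_coeff/=.
rewrite !factS fact0 expr0 expr1 !muln1 !divr1.
rewrite (_ : 1 + (w + (w ^+ 2 / 2%:R + _)) - _ =
  \sum_(0 <= i < N) w ^+ i.+3 / i.+3`!%:R); last by ring.
apply: le_trans (ler_norm_sum _ _ _) _.
apply: le_trans (ler_wpM2l (exprn_ge0 3 (normr_ge0 w)) (expR_series_le N (normr_ge0 w))).
rewrite mulr_sumr; apply: ler_sum => i _.
rewrite normrM normrX -addn3 exprD [X in X * _ <= _]mulrC -mulrA ler_wpM2l ?exprn_ge0//.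
rewrite normfV ler_wpM2l ?exprn_ge0// ger0_norm//.
by rewrite lef_pV2 ?posrE ?ltr0n ?fact_gt0// ler_nat addn3 !factS !mulnA leq_pmull.
Qed.

Lemma cube_le_expR x : `|x| ^+ 3 <= 48 * expR (`|x| / 2).
Proof.
have := @expR_ge1Dxn R (`|x| / 2) 2; rewrite divr_ge0// => /(_ isT).
rewrite !factS fact0 expr_div_n; lra.
Qed.

Lemma expR_taylor2_scaled (a c y : R) : 0 <= a -> 0 < c -> a <= c / 2 ->
  `|expR (a * y) - (1 + a * y + (a * y) ^+ 2 / 2)| <= 48 * (a / c) ^+ 3 * expR (c * `|y|).
Proof.
move=> a0 c0 ac; apply: le_trans (expR_taylor2 _) _.
have -> : `|a * y| = a / c * (c * `|y|).
  by rewrite normrM ger0_norm//; field; rewrite gt_eqF.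
have ac0 : 0 <= a / c by rewrite divr_ge0// ltW.
have ac2 : a / c <= 2^-1 by rewrite ler_pdivrMr// mulrC.
set z := c * `|y|; have z0 : 0 <= z by rewrite mulr_ge0// ltW.
rewrite exprMn mulrAC -mulrA [leRHS]mulrAC mulrC ler_wpM2r ?exprn_ge0//.
have h1 : expR (a / c * z) <= expR (z / 2) by rewrite ler_expR mulrC ler_wpM2l.
have h2 : z ^+ 3 <= 48 * expR (z / 2) by have := cube_le_expR z; rewrite ger0_norm.
rewrite [leLHS]mulrC.
apply: (@le_trans _ _ (48 * expR (z / 2) * expR (z / 2))).
  by apply: ler_pM; rewrite ?exprn_ge0 ?expR_ge0.
by rewrite -mulrA -expRD -splitr.
Qed.

Lemma sqr_le_cosh x : x ^+ 2 <= expR x + expR (- x) - 2.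
Proof.
(* With [s = 1 + y + y ^ 2 / 2], which is at most [expR y], the difference [s - s^-1 - 2 * y] equals
   [y ^ 4 / 4] divided by [s]. *)
have h y : 0 <= y -> 2 * y <= expR y - expR (- y).
  move=> y0; set s : R := 1 + y + y ^+ 2 / 2.
  have s0 : 0 < s by rewrite /s -addrA ltr_pwDl// addr_ge0// divr_ge0// exprn_ge0.
  have hs : s <= expR y.
    apply: le_trans (expR_series_le 3 y0); rewrite !big_nat_recl// big_geq//.
    by rewrite !factS fact0 expr0 expr1 !muln1 !divr1 addr0 addrA.
  have : expR (- y) <= s^-1 by rewrite expRN lef_pV2 ?posrE ?expR_gt0.
  suff : 2 * y <= s - s^-1 by lra.
  rewrite -subr_ge0 (_ : _ - _ = (s ^+ 2 - 1 - 2 * y * s) / s); last by field; rewrite gt_eqF.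
  rewrite (_ : _ - _ = y ^+ 4 / 4); last by rewrite /s; field.
  by rewrite !divr_ge0 ?exprn_ge0// ltW.
have -> : expR x + expR (- x) - 2 = (expR (`|x| / 2) - expR (- (`|x| / 2))) ^+ 2.
  have e1 : expR (`|x| / 2) ^+ 2 = expR `|x| by rewrite -expRM_natl mulrC divfK.
  have e2 : expR (- (`|x| / 2)) ^+ 2 = expR (- `|x|).
    by rewrite -expRM_natl mulrN mulrC divfK.
  rewrite sqrrB e1 e2 expRxMexpNx_1.
  have -> : expR x + expR (- x) = expR `|x| + expR (- `|x|).
    by case: ger0P => // _; rewrite opprK addrC.
  by ring.
have x2 : 0 <= `|x| / 2 by rewrite divr_ge0.
have h2 := h _ x2.
by rewrite -(real_normK (num_real x)) ler_sqr ?nnegrE//; lra.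
Qed.

Lemma expR1_le4 : expR 1 <= 4 :> R.
Proof.
have h2 : 2^-1 <= (expR (2^-1 : R))^-1.
  by rewrite -expRN; apply: le_trans (expR_ge1Dx _); lra.
have h3 : expR (2^-1 : R) <= 2 by rewrite -lef_pV2 ?posrE ?expR_gt0.
have -> : expR 1 = expR (2^-1 : R) * expR 2^-1 by rewrite -expRD; congr expR; lra.
by rewrite (_ : 4 = 2 * 2 :> R) ?ler_pM ?expR_ge0//; lra.
Qed.

(** For positive [y] this is [ln (1 + y) >= y - y ^ 2], from [1 - x <= expR (- x) <= (1 + y)^-1].
    For other [y] the left side is not positive. *)
Lemma le_expR_lower x y : 0 <= x -> 1 + y <= expR x -> y - y ^+ 2 <= x.
Proof.
move=> x0 yx; have [y0|y0] := leP y 0; first by have := sqr_ge0 y; lra.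
have h1 : expR (- x) <= (1 + y)^-1.
  by rewrite expRN lef_pV2 ?posrE ?expR_gt0//; lra.
have h2 := expR_ge1Dx (- x).
have h3 : (1 + y)^-1 <= 1 - y + y ^+ 2.
  rewrite -div1r ler_pdivrMr; last lra.
  by have := exprn_ge0 3 (ltW y0); lra.
lra.
Qed.

(** [F] stands for an exponential moment, [U] for a second moment close to [V]. Taking logarithms
    costs [y ^ 2], which is [O(nu ^ 4)] and is absorbed by the last summand of [E]. *)
Lemma expR_second_order (nu V U W E1 E2 om F : R) :
  0 <= nu -> nu <= 1 -> 0 <= E1 -> 0 <= E2 -> 0 <= om -> 0 <= U -> U <= W ->
  `|U - V| <= E1 * om -> `|F - (1 + nu ^+ 2 * U / 2)| <= E2 * nu ^+ 2 * nu ->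
  let E := E1 + E2 + (W + E2) ^+ 2 in
  F <= expR (2^-1 * nu ^+ 2 * V + E * nu ^+ 2 * (om + nu)) /\
  forall x, 0 <= x -> F <= expR x -> 2^-1 * nu ^+ 2 * V - E * nu ^+ 2 * (om + nu) <= x.
Proof.
move=> nu0 nu1 E10 E20 om0 U0 UW UV FU; set E3 := (W + E2) ^+ 2.
have E30 : 0 <= E3 by exact: sqr_ge0.
set q := nu ^+ 2 in FU *; have q0 : 0 <= q by exact: sqr_ge0.
have h1 : `|q * U - q * V| <= q * (E1 * om).
  by rewrite -mulrBr normrM (ger0_norm q0) ler_wpM2l.
have p1 : 0 <= q * (E1 * om) by do 2 apply: mulr_ge0 => //.
have p2 : 0 <= q * (E2 * om) by do 2 apply: mulr_ge0 => //.
have p3 : 0 <= q * (E3 * om) by do 2 apply: mulr_ge0 => //.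
have p4 : 0 <= q * (E1 * nu) by do 2 apply: mulr_ge0 => //.
have p5 : 0 <= q * (E3 * nu) by do 2 apply: mulr_ge0 => //.
move: h1 FU; rewrite !ler_norml => /andP[u1 u2] /andP[f1 f2]; split.
  by apply: le_trans (expR_ge1Dx _); lra.
move=> x x0 Fx; set y := q * U / 2 - E2 * q * nu.
have xy : y - y ^+ 2 <= x by apply: le_expR_lower => //; rewrite /y; lra.
have ya : `|y| <= (W + E2) * q.
  have a1 := ler_wpM2l q0 UW; have a2 := mulr_ge0 q0 U0.
  have q2 : 0 <= E2 * q by rewrite mulr_ge0.
  have a3 : E2 * q * nu <= E2 * q by rewrite ler_piMr.
  have a4 : 0 <= E2 * q * nu by rewrite mulr_ge0.
  by rewrite /y ler_norml; lra.
have y2 : y ^+ 2 <= E3 * q * nu.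
  rewrite -(real_normK (num_real y)).
  apply: (@le_trans _ _ (((W + E2) * q) ^+ 2)).
    by rewrite ler_sqr ?nnegrE// (le_trans _ ya).
  rewrite exprMn -/E3 -mulrA ler_wpM2l// expr2 ler_wpM2l//.
  by rewrite /q expr2 ler_piMr.
by move: xy; rewrite {1}/y; lra.
Qed.

End exp_taylor2.

(** * Moments of a field on a single bounded set *)

Section cell_moments.
Context {R : realType} {n : nat}.
Implicit Types (f g h : 'rV[R]_n.+1 -> R).
Context d (T : measurableType d) (P : probability T R) (X : T -> lfsbm R n.+1).
Hypotheses (mX : random_field X) (X0 : mean0 P X).
Variables (S : set 'rV[R]_n.+1) (c M : R).
Hypotheses (bS : bounded_borel S) (c0 : 0 < c).
Hypothesis hM : forall g, test_fun 1 S g ->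
  (\int[P]_w (expR (c * `|lfsbm_integral (X w) g|))%:E <= M%:E)%E.
Local Notation Z f := (fun w => lfsbm_integral (X w) f).
Local Notation "'EE' F" := (\int[P]_w F w)%R (at level 10, F at level 9).
Local Notation intg F := (P.-integrable setT (EFin \o F)).

Lemma cell_mean0 a f : test_fun a S f -> intg (Z f) /\ EE (Z f) = 0.
Proof. by move=> tf; exact: (field_mean0 mX bS X0 (field_abs_bound mX c0 hM) tf). Qed.

Lemma cell_exp_integrable g : test_fun 1 S g ->
  intg (fun w => expR (c * `|Z g w|)) /\ EE (fun w => expR (c * `|Z g w|)) <= M.
Proof.
move=> tg; have i : intg (fun w => expR (c * `|Z g w|)).
  apply: ge0_integrable (hM tg) => //.
  apply: measurableT_comp => //; apply: measurable_funM => //.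
  by apply: measurableT_comp => //; exact: measurable_field tg.
by split=> //; rewrite -lee_fin -(integral_fineK i); exact: hM.
Qed.

Lemma cell_M_ge0 : 0 <= M.
Proof.
have t0 : test_fun 1 S (\1_(set0) : 'rV[R]_n.+1 -> R) by exact: test_fun_indic.
have [_] := cell_exp_integrable t0; apply: le_trans; apply: Rintegral_ge0 => w _.
exact: expR_ge0.
Qed.

Lemma cell_second_moment a f : test_fun a S f ->
  intg (fun w => Z f w ^+ 2) /\ EE (fun w => Z f w ^+ 2) <= 8 * M / c ^+ 2 * a ^+ 2.
Proof.
move=> tf; have a0 := test_fun_ge0 tf; have [g tg fE] := test_fun_unit tf.
have [ie Ee] := cell_exp_integrable tg.
have k0 : 0 <= 8 / c ^+ 2 * a ^+ 2 by rewrite mulr_ge0 ?exprn_ge0// divr_ge0// exprn_ge0// ltW.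
have h w : Z f w ^+ 2 <= 8 / c ^+ 2 * a ^+ 2 * expR (c * `|Z g w|).
  rewrite fE (lfsbm_integralZ _ _ tg); have := sqr_le_expR (c * Z g w).
  have : expR (`|c * Z g w| / 2) <= expR (c * `|Z g w|).
    rewrite ler_expR normrM gtr0_norm// ler_pdivrMr// ler_peMr ?ler1n//.
    by rewrite mulr_ge0// ltW.
  move=> h1 h2; rewrite exprMn (_ : _ * _ * expR _ = a ^+ 2 * (8 * expR (c * `|Z g w|) / c ^+ 2)); last by ring.
  rewrite ler_wpM2l ?exprn_ge0// ler_pdivlMr ?exprn_gt0// mulrC -exprMn.
  by apply: le_trans h2 _; rewrite ler_pM2l.
have i2 : intg (fun w => Z f w ^+ 2).
  apply: le_integrable_real (integrableZ_real (8 / c ^+ 2 * a ^+ 2) ie) => //.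
    by apply: measurable_funX; exact: measurable_field tf.
  by move=> w; rewrite ger0_norm ?sqr_ge0//; exact: h.
split=> //; apply: (@le_trans _ _ (8 / c ^+ 2 * a ^+ 2 * EE (fun w => expR (c * `|Z g w|)))).
  rewrite -RintegralZl//; apply: le_Rintegral => //; exact: integrableZ_real.
rewrite (_ : 8 * M / _ * _ = 8 / c ^+ 2 * a ^+ 2 * M); last by ring.
exact: ler_wpM2l.
Qed.

(** The linear term vanishes in mean, and the remainder of [expR_taylor2_scaled] is integrated
    against the exponential moment [M]. *)
Lemma cell_taylor a f : test_fun a S f -> a <= c / 2 ->
  intg (fun w => expR (Z f w)) /\
  `|EE (fun w => expR (Z f w)) - (1 + EE (fun w => Z f w ^+ 2) / 2)| <= 48 * M * (a / c) ^+ 3.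
Proof.
move=> tf ac; have a0 := test_fun_ge0 tf; have [g tg fE] := test_fun_unit tf.
have [ie Ee] := cell_exp_integrable tg.
have [i1 E1] := cell_mean0 tf; have [i2 _] := cell_second_moment tf.
have mZ : measurable_fun setT (Z f) by exact: measurable_field tf.
have k0 : 0 <= 48 * (a / c) ^+ 3 by rewrite mulr_ge0 ?exprn_ge0// divr_ge0// ltW.
pose Q w := 1 + Z f w + 2^-1 * Z f w ^+ 2.
pose D w := expR (Z f w) + (-1) * Q w.
have iQ : intg Q.
  apply: integrableD_real; last exact: integrableZ_real.
  by apply: integrableD_real => //; exact: integrable_cst_prob.
have EQ : EE Q = 1 + EE (fun w => Z f w ^+ 2) / 2.
  rewrite RintegralD//; last first.
  - exact: integrableZ_real.
  - by apply: integrableD_real => //; exact: integrable_cst_prob.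
  rewrite RintegralD//; last exact: integrable_cst_prob.
  by rewrite RintegralZl// Rintegral_cst_prob E1 addr0 [_^-1 * _]mulrC.
have hD w : `|D w| <= 48 * (a / c) ^+ 3 * expR (c * `|Z g w|).
  rewrite /D /Q fE (lfsbm_integralZ _ _ tg).
  by have := expR_taylor2_scaled (Z g w) a0 c0 ac; rewrite mulN1r [2^-1 * _]mulrC.
have mD : measurable_fun setT D.
  apply: measurable_funD; first exact: measurableT_comp.
  apply: measurable_funM => //; apply: measurable_funD; first exact: measurable_funD.
  by apply: measurable_funM => //; exact: measurable_funX.
have iD : intg D.
  by apply: le_integrable_real (integrableZ_real _ ie) => //; exact: hD.
have eE : (fun w => expR (Z f w)) = (fun w => D w + Q w).
  by apply/funext => w; rewrite /D; ring.
split; first by rewrite eE; exact: integrableD_real.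
rewrite eE RintegralD// EQ addrK.
apply: le_trans (le_normr_Rintegral _ iD) _ => //.
apply: (@le_trans _ _ (48 * (a / c) ^+ 3 * EE (fun w => expR (c * `|Z g w|)))).
  rewrite -RintegralZl//; apply: le_Rintegral => //; last exact: integrableZ_real.
  by have := integrable_abse iD.
rewrite (_ : 48 * M * _ = 48 * (a / c) ^+ 3 * M); last by ring.
exact: ler_wpM2l.
Qed.

Lemma cell_variance (K b om : R) h : test_fun K S h -> `|b| <= K -> 0 < om -> om <= 1 ->
  (forall t, S t -> `|h t - b| <= om) ->
  `|EE (fun w => Z h w ^+ 2) - b ^+ 2 * EE (fun w => Z \1_S w ^+ 2)| <=
  (2 * K + 1) * (8 * M / c ^+ 2) * om.
Proof.
move=> th bK om0 om1 hb.
have mS : measurable (S : set (borel_rV R n.+1)) by exact: bS.1.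
have t1 : test_fun 1 S \1_S by exact: test_fun_indic.
have K0 := test_fun_ge0 th.
pose D t := h t + (- b) * \1_S t.
have tD : test_fun om S D.
  have [_ mD _ DS] := test_funD th (test_funZ (- b) t1).
  split=> // t; rewrite /D; have [St|St] := pselect (S t).
    by rewrite indicE mem_set// mulr1; exact: hb.
  by rewrite DS// normr0 ltW.
have ZE w : Z h w = b * Z \1_S w + Z D w.
  by rewrite /D (lfsbm_integralD _ th (test_funZ (- b) t1)) (lfsbm_integralZ _ _ t1); ring.
have [i1 E1] := cell_second_moment t1; have [iD ED] := cell_second_moment tD.
have [ih _] := cell_second_moment th.
have omV : 0 < om^-1 by rewrite invr_gt0.
set W := 8 * M / c ^+ 2 in E1 ED *.
have W0 : 0 <= W by rewrite divr_ge0 ?mulr_ge0 ?exprn_ge0 ?cell_M_ge0// ltW.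
pose Df w := Z h w ^+ 2 + (- b ^+ 2) * Z \1_S w ^+ 2.
pose Bd w := K * om * Z \1_S w ^+ 2 + (K / om + 1) * Z D w ^+ 2.
have hDf w : `|Df w| <= Bd w.
  rewrite /Df /Bd ZE.
  rewrite (_ : _ + _ = 2 * b * (Z \1_S w * Z D w) + Z D w ^+ 2); last by ring.
  (* The weight balances both terms: the second moment of the integral of [D] is [O(om ^ 2)], so
     each of them integrates to [O(om)]. *)
  have am : 2 * (`|Z \1_S w| * `|Z D w|) <= om * Z \1_S w ^+ 2 + om^-1 * Z D w ^+ 2.
    rewrite -(real_normK (num_real (Z \1_S w))) -(real_normK (num_real (Z D w))).
    set x := `|Z \1_S w|; set y := `|Z D w|.
    rewrite -subr_ge0 (_ : _ - _ = om^-1 * (om * x - y) ^+ 2); last by field; rewrite gt_eqF.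
    by rewrite mulr_ge0 ?sqr_ge0// ltW.
  have xy0 : 0 <= 2 * (`|Z \1_S w| * `|Z D w|) by rewrite !mulr_ge0.
  have -> : K * om * Z \1_S w ^+ 2 + (K / om + 1) * Z D w ^+ 2 =
    K * (om * Z \1_S w ^+ 2 + om^-1 * Z D w ^+ 2) + Z D w ^+ 2 by ring.
  apply: (le_trans (ler_normD _ _)); apply: lerD; last by rewrite ger0_norm ?sqr_ge0.
  rewrite !normrM (ger0_norm (_ : 0 <= 2))//.
  rewrite (_ : 2 * `|b| * _ = `|b| * (2 * (`|Z \1_S w| * `|Z D w|))); last by ring.
  by apply: ler_pM.
have iDf : intg Df by apply: integrableD_real => //; exact: integrableZ_real.
have iBd : intg Bd by apply: integrableD_real; exact: integrableZ_real.
have -> : EE (fun w => Z h w ^+ 2) - b ^+ 2 * EE (fun w => Z \1_S w ^+ 2) = EE Df.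
  by rewrite RintegralD// ?RintegralZl ?mulNr//; exact: integrableZ_real.
apply: le_trans (le_normr_Rintegral _ iDf) _ => //.
apply: (@le_trans _ _ (EE Bd)).
  by apply: le_Rintegral => //; have := integrable_abse iDf.
rewrite RintegralD//; [|exact: integrableZ_real|exact: integrableZ_real].
rewrite !RintegralZl//.
have k1 : 0 <= K * om by rewrite mulr_ge0// ltW.
have k2 : 0 <= K / om + 1 by rewrite addr_ge0// divr_ge0// ltW.
apply: le_trans (lerD (ler_wpM2l k1 E1) (ler_wpM2l k2 ED)) _.
rewrite expr1n mulr1 [leLHS](_ : _ = (2 * K * W * om) + W * om ^+ 2); last by field; rewrite gt_eqF.
rewrite [leRHS](_ : _ = 2 * K * W * om + W * om); last by ring.
by rewrite lerD2l ler_wpM2l// expr2 ler_piMr// ltW.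
Qed.

End cell_moments.

(** * Cells *)

Section cells.
Context {R : realType} {n : nat}.
Implicit Types (s : nat -> R).
Local Notation dim := n.+1.

Definition cell (j : nat) s : set 'rV[R]_dim := box dim s (fun=> 2 ^+ j).

Lemma bounded_borel_box s l : bounded_borel (box dim s l : set 'rV[R]_dim).
Proof.
split; first exact: measurable_box.
apply/bounded_setP; exists (\sum_(i < dim) (`|s i| + `|l i|)) => t ht.
have -> : `|t| = mx_norm t by [].
rewrite mx_normrE; apply/bigmax_leP; split=> [|[i0 i] _ /=].
  by apply: sumr_ge0 => i _; rewrite addr_ge0.
rewrite ord1; apply: (@le_trans _ _ (`|s i| + `|l i|)).
  have /andP[h1 h2] := ht i (ltn_ord i).
  rewrite ler_norml; apply/andP; split.
    by have := ler_norm (- s i); rewrite normrN; have := normr_ge0 (l i); lra.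
  by have := ler_norm (s i); have := ler_norm (l i); lra.
by rewrite (bigD1 i)//= lerDl sumr_ge0// => k _; rewrite addr_ge0.
Qed.

Lemma bounded_borel_cell j s : bounded_borel (cell j s).
Proof. exact: bounded_borel_box. Qed.

Lemma perm_shiftE (a : 'S_dim) v t i :
  perm_shift a v t ord0 i = t ord0 (a i) + v ord0 i :> R.
Proof. by rewrite !mxE. Qed.

Lemma cell_translate j s : cell j s =
  perm_shift 1%g (\row_(i < dim) s i) @` cell j (fun=> 0).
Proof.
rewrite image_perm_shift; apply/seteqP; split=> t ht i id.
  by have := ht i id; rewrite perm_shiftE !mxE invg1 perm1; lra.
by have := ht i id; rewrite perm_shiftE !mxE invg1 perm1; lra.
Qed.

Context d (T : measurableType d) (P : probability T R) (X : T -> lfsbm R dim).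
Hypotheses (mX : random_field X) (X0 : mean0 P X) (statX : stationary P X).
Hypothesis sX : splits dim (mgf_le P X).
Local Notation "'EE' F" := (\int[P]_w F w)%R (at level 10, F at level 9).

Definition cell_variance0 j : R :=
  \int[P]_w (lfsbm_integral (X w) \1_(cell j (fun=> 0)) ^+ 2).

Lemma cell_variance_stat j s :
  (\int[P]_w (lfsbm_integral (X w) \1_(cell j s) ^+ 2))%R = cell_variance0 j.
Proof.
rewrite /cell_variance0 /Rintegral.
suff -> : (\int[P]_w (lfsbm_integral (X w) \1_(cell j s) ^+ 2)%:E =
    \int[P]_w (lfsbm_integral (X w) \1_(cell j (fun=> 0)) ^+ 2)%:E)%E by [].
under eq_integral do rewrite (lfsbm_integral_indic _ (bounded_borel_cell j s)).
under [RHS]eq_integral do rewrite (lfsbm_integral_indic _ (bounded_borel_cell j _)).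
pose v := \row_(i < dim) s i.
have mr := random_field_reparam 1%g v mX.
have mphi : measurable_fun setT
    (fun mu : lfsbm_space R dim => ((mu : lfsbm R dim) (cell j (fun=> 0)) ^+ 2)%:E).
  apply/measurable_EFinP; apply: measurable_funX.
  exact: (measurable_lfsbm_val (bounded_borel_cell j _)).
by rewrite -(same_law_integral mr mX (statX v) mphi) cell_translate.
Qed.

Lemma cell_exp_moment (C : R) j : 1 <= C -> cube_bound (n := n) dim C ->
  exists c M : R, [/\ 0 < c, C * c * j.+1%:R ^+ dim <= 1 &
    forall s g, test_fun 1 (cell j s) g ->
      (\int[P]_w (expR (c * `|lfsbm_integral (X w) g|))%:E <= M%:E)%E].
Proof.
move=> C1 cb; have C0 : 0 < C by lra.
have J0 : 0 < j.+1%:R ^+ dim :> R by rewrite exprn_gt0.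
(* The largest [c] in the range of [cube_bound] on a cell of side [2 ^ j]. The bound is used at [c]
   and [- c], as [expR |z| <= expR z + expR (- z)]. *)
pose c := (C * j.+1%:R ^+ dim)^-1.
have c0 : 0 < c by rewrite invr_gt0 mulr_gt0.
have hc : C * c * j.+1%:R ^+ dim <= 1.
  by rewrite mulrAC mulfV// gt_eqF// mulr_gt0.
exists c, (2 * expR (C * c ^+ 2 * (2 ^+ j) ^+ dim)); split=> // s g tg.
have gS t : g t != 0 -> cell j s t.
  by case: tg => _ _ _ gS; apply: contra_neqP => /gS.
have U (b : R) : `|b| = c ->
    (\int[P]_w (expR (lfsbm_integral (X w) (fun t => b * g t)))%:E
      <= (expR (C * c ^+ 2 * (2 ^+ j) ^+ dim))%:E)%E.
  move=> bc; apply: (cb _ sX j s c (cell j s)) => //.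
    by have := test_funZ b tg; rewrite bc mulr1.
  by move=> t; rewrite mulf_eq0 negb_or => /andP[_]; exact: gS.
have tc := test_funZ c tg; have tNc := test_funZ (- c) tg.
apply: (@le_trans _ _ (\int[P]_w ((expR (lfsbm_integral (X w) (fun t => c * g t)))%:E +
    (expR (lfsbm_integral (X w) (fun t => (- c) * g t)))%:E))%E).
  apply: le_integral_nonmeas => w; first by rewrite lee_fin expR_ge0.
  rewrite -EFinD lee_fin !(lfsbm_integralZ _ _ tg).
  set z := lfsbm_integral (X w) g; have e1 := expR_ge0 (c * z); have e2 := expR_ge0 (- c * z).
  case: (ger0P z) => z0; first by lra.
  by rewrite mulrN -mulNr; lra.
rewrite ge0_integralD//; [|exact: measurable_field_exp tc|exact: measurable_field_exp tNc].
rewrite mulr_natl mulr2n EFinD; apply: leeD; apply: U.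
  by rewrite gtr0_norm.
by rewrite normrN gtr0_norm.
Qed.

(** A bound per unit of volume that does not depend on [j], from the inequality
    [x ^ 2 <= expR x + expR (- x) - 2]. *)
Lemma cell_variance_bound (C : R) j : 1 <= C -> cube_bound (n := n) dim C ->
  0 <= cell_variance0 j /\ cell_variance0 j <= 8 * C * (2 ^+ j) ^+ dim.
Proof.
move=> C1 cb; have C0 : 0 < C by lra.
split; first by apply: Rintegral_ge0 => w _; exact: sqr_ge0.
have [c [M [c0 hc hM]]] := cell_exp_moment j C1 cb.
set N := (2 ^+ j) ^+ dim : R.
have N1 : 1 <= N by rewrite !exprn_ege1// ler1n.
(* [l <= c] is the range of [cube_bound]; [l <= (C * N)^-1] makes [y = C * l ^ 2 * N] at most 1,
   where [expR y - 1 <= 4 * y]. *)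
pose l : R := Num.min c (C * N)^-1.
have CN1 : 1 <= C * N by rewrite -[leLHS]mulr1 ler_pM.
have l0 : 0 < l by rewrite lt_min c0 invr_gt0; lra.
have lc : l <= c by rewrite ge_min lexx.
have l1 : l <= 1 by rewrite ge_min invf_le1 ?CN1 ?orbT//; lra.
have lCN : C * l ^+ 2 * N <= 1.
  have : l <= (C * N)^-1 by rewrite ge_min lexx orbT.
  move=> h; apply: (@le_trans _ _ (C * N * l)).
    by rewrite mulrAC ler_wpM2l ?mulr_ge0 ?expr2 ?ler_piMr//; lra.
  by rewrite mulrC -ler_pdivlMr ?div1r//; lra.
pose S := cell j (fun=> 0).
have mS : measurable (S : set (borel_rV R dim)) by exact: measurable_box.
have bS : bounded_borel S by exact: bounded_borel_cell.
have t1 : test_fun 1 S \1_S by exact: test_fun_indic.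
have gS t : \1_S t != 0 :> R -> S t.
  by apply: contra_neqP => St; rewrite indicE memNset.
have U (b : R) : `|b| = l ->
    (\int[P]_w (expR (lfsbm_integral (X w) (fun t => b * \1_S t)))%:E
      <= (expR (C * l ^+ 2 * N))%:E)%E.
  move=> bl; apply: (cb _ sX j (fun=> 0) l S) => //.
  - by have := test_funZ b t1; rewrite bl mulr1.
  - by move=> t; rewrite mulf_eq0 negb_or => /andP[_]; exact: gS.
  - apply: le_trans hc; rewrite ler_wpM2r ?exprn_ge0//.
    by rewrite ler_wpM2l// ltW.
have [i2 _] := cell_second_moment mX c0 (hM (fun=> 0)) t1.
have ie (b : R) : `|b| = l -> P.-integrable setT
    (EFin \o (fun w => expR (lfsbm_integral (X w) (fun t => b * \1_S t)))).
  move=> bl; apply: ge0_integrable (U b bl) => //.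
  apply: measurableT_comp => //.
  exact: measurable_field (test_funZ b t1).
have ie1 := ie l (gtr0_norm l0).
have ie2 := ie (- l) (etrans (normrN l) (gtr0_norm l0)).
have h1 : l ^+ 2 * cell_variance0 j <= 2 * expR (C * l ^+ 2 * N) + (-2).
  have -> : l ^+ 2 * cell_variance0 j =
      EE (fun w => l ^+ 2 * lfsbm_integral (X w) \1_S ^+ 2) by rewrite RintegralZl.
  pose F w := (expR (lfsbm_integral (X w) (fun t => l * \1_S t)) +
     expR (lfsbm_integral (X w) (fun t => - l * \1_S t))) + (-2).
  have iF : P.-integrable setT (EFin \o F).
    apply: integrableD_real; last exact: integrable_cst_prob.
    exact: integrableD_real.
  apply: (@le_trans _ _ (EE F)).
    apply: le_Rintegral => //; first exact: integrableZ_real.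
    move=> w _; rewrite /F !(lfsbm_integralZ _ _ t1) -exprMn mulNr.
    exact: sqr_le_cosh.
  rewrite RintegralD//; [|exact: integrableD_real|exact: integrable_cst_prob].
  rewrite Rintegral_cst_prob lerD2r RintegralD// mulr_natl mulr2n.
  by apply: lerD; rewrite -lee_fin -integral_fineK//; apply: U; rewrite ?normrN gtr0_norm.
set y := C * l ^+ 2 * N in lCN h1.
have y0 : 0 <= y by rewrite !mulr_ge0 ?exprn_ge0//; lra.
have e3 : expR y - 1 <= 4 * y.
  have := norm_expRB1 y; rewrite (ger0_norm y0) => h.
  apply: le_trans (ler_norm _) _; apply: le_trans h _.
  rewrite mulrC ler_wpM2r//; apply: (@le_trans _ _ (expR 1)); first by rewrite ler_expR.
  exact: expR1_le4.
have : l ^+ 2 * cell_variance0 j <= l ^+ 2 * (8 * C * N) by rewrite /y in e3 h1; lra.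
by rewrite ler_pM2l// exprn_gt0.
Qed.

(* On a fixed cell, as [mu -> 0], only the variance matters. *)
Lemma cell_estimates (C K : R) j : 1 <= C -> cube_bound (n := n) dim C -> 0 < K ->
  exists E c : R, [/\ 0 < c, 0 <= E & forall s h (b om mu : R),
    test_fun K (cell j s) h -> `|b| <= K -> 0 < om -> om <= 1 ->
    (forall t, cell j s t -> `|h t - b| <= om) -> `|mu| <= c ->
    mgf_le P X (fun t => mu * h t)
      (2^-1 * mu ^+ 2 * b ^+ 2 * cell_variance0 j + E * mu ^+ 2 * (om + `|mu|)) /\
    forall x, mgf_le P X (fun t => mu * h t) x ->
      2^-1 * mu ^+ 2 * b ^+ 2 * cell_variance0 j - E * mu ^+ 2 * (om + `|mu|) <= x].
Proof.
move=> C1 cb K0; have [c [M [c0 hc hM]]] := cell_exp_moment j C1 cb.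
have M0 : 0 <= M.
  exact: (cell_M_ge0 mX (bounded_borel_cell j (fun=> 0)) (hM (fun=> 0))).
set W := 8 * M / c ^+ 2; have W0 : 0 <= W by rewrite divr_ge0 ?mulr_ge0 ?exprn_ge0// ltW.
pose E1 : R := (2 * K + 1) * W; pose E2 : R := 48 * M * (K / c) ^+ 3.
pose E3 : R := (W * K ^+ 2 + E2) ^+ 2.
have E10 : 0 <= E1 by rewrite mulr_ge0// addr_ge0// mulr_ge0// ltW.
have E20 : 0 <= E2 by apply: mulr_ge0; [rewrite mulr_ge0|rewrite exprn_ge0// divr_ge0// ltW].
(* Ensures [|mu| <= 1], for [expR_second_order], and [|mu| * K <= c / 2], for [cell_taylor]. *)
pose c' : R := Num.min 1 (c / (2 * K)).
exists (E1 + E2 + E3), c'; split.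
- by rewrite lt_min ltr01 divr_gt0// mulr_gt0.
- by rewrite !addr_ge0// sqr_ge0.
move=> s h b om mu th bK om0 om1 hb muc.
have bS := bounded_borel_cell j s.
have mu1 : `|mu| <= 1 by apply: le_trans muc _; rewrite ge_min lexx.
have muK : `|mu| * K <= c / 2.
  have : `|mu| <= c / (2 * K) by apply: le_trans muc _; rewrite ge_min lexx orbT.
  rewrite ler_pdivlMr ?mulr_gt0// => h1.
  by rewrite ler_pdivlMr// -mulrA (mulrC K).
have tf := test_funZ mu th.
have [ie Ee] := cell_taylor mX X0 bS c0 (hM s) tf muK.
have := cell_variance mX bS c0 (hM s) th bK om0 om1 hb.
rewrite cell_variance_stat -/W -/E1.
have [i2 V2] := cell_second_moment mX c0 (hM s) th; rewrite -/W in V2.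
set Vh := EE (fun w => lfsbm_integral (X w) h ^+ 2) in V2 *.
have Vh0 : 0 <= Vh by apply: Rintegral_ge0 => w _; exact: sqr_ge0.
have VE : EE (fun w => lfsbm_integral (X w) (fun t => mu * h t) ^+ 2) = mu ^+ 2 * Vh.
  rewrite -RintegralZl//; apply: eq_Rintegral => w _.
  by rewrite (lfsbm_integralZ _ _ th) exprMn.
set V := cell_variance0 j => hV; rewrite VE in Ee.
have m2E : `|mu| ^+ 2 = mu ^+ 2 by rewrite real_normK ?num_real.
have Ee2 : 48 * M * (`|mu| * K / c) ^+ 3 = E2 * `|mu| ^+ 2 * `|mu| by rewrite /E2; ring.
rewrite Ee2 -m2E in Ee; set F := EE (fun w => expR (lfsbm_integral (X w) (fun t => mu * h t))) in Ee.
have [up down] := expR_second_order (normr_ge0 mu) mu1 E10 E20 (ltW om0) Vh0 V2 hV Ee.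
rewrite -m2E -(mulrA _ (b ^+ 2)); split.
  by rewrite /mgf_le (integral_fineK ie) lee_fin.
move=> x; rewrite /mgf_le (integral_fineK ie) lee_fin -/F => Fx.
apply: down => //; have [iZ EZ] := cell_mean0 mX X0 bS c0 (hM s) tf.
(* Jensen's inequality with mean value 0; it gives [0 <= x], as [expR_second_order] requires. *)
have F1 : 1 <= F.
  apply: (@le_trans _ _ (EE (fun w => 1 + lfsbm_integral (X w) (fun t => mu * h t)))).
    by rewrite RintegralD// ?Rintegral_cst_prob ?EZ ?addr0//; exact: integrable_cst_prob.
  apply: le_Rintegral => //.
    by apply: integrableD_real => //; exact: integrable_cst_prob.
  by move=> w _; exact: expR_ge1Dx.
by rewrite -(ler_expR 0) expR0; exact: le_trans F1 Fx.
Qed.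

End cells.

(** * Integrals of a density over boxes *)

Section box_integrals.
Context {R : realType} {n : nat}.
Local Notation dim := n.+1.
Local Notation B_ := (borel_rV R dim).
Implicit Types (s l : nat -> R).

Lemma box_full_box s l : box dim s l =
  full_box (fun i : 'I_dim => s i) (fun i : 'I_dim => l i) :> set 'rV[R]_dim.
Proof. by apply/seteqP; split=> t ht i; [exact: ht|move=> _; exact: ht]. Qed.

Variables (mu : {measure set B_ -> \bar R}) (g : 'rV[R]_dim -> R) (G : R).
Hypothesis mu_box : forall s l : 'I_dim -> R, (forall j, 0 <= l j) ->
  mu (full_box s l) = (\prod_j l j)%:E.
Hypotheses (mg : measurable_fun setT (g : B_ -> R)) (gG : forall t, `|g t| <= G).

Lemma box_measure s l : (forall j, 0 <= l j) -> mu (box dim s l) = (box_volume dim l)%:E.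
Proof. by move=> l0; rewrite box_full_box mu_box. Qed.

Lemma box_integrable s l : mu.-integrable (box dim s l) (EFin \o g).
Proof.
have mB : measurable (box dim s l : set B_) by exact: measurable_box.
apply: measurable_bounded_integrable => //.
- apply: (@le_lt_trans _ _ (mu (box dim s (fun j => `|l j|)))).
    apply: le_measure; rewrite ?inE//; first exact: measurable_box.
    by move=> t ht i id; have := ht i id; have := ler_norm (l i); lra.
  by rewrite box_measure// ltry.
- exact: measurable_funTS.
- exists G; split; first exact: num_real.
  by move=> x Gx t _; exact: le_trans (gG t) (ltW Gx).
Qed.

Lemma box_integral_additive (r : R) : 0 < r ->
  box_additive dim (fun s l => \int[mu]_(t in box dim (fun i => s i / r) (fun i => l i / r)) g t).
Proof.
move=> r0; split=> [s l s' l' h|s l i ik l0].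
  rewrite (@box_ext R n dim _ _ (fun i => s' i / r) (fun i => l' i / r))//.
  by move=> j jk; have [-> ->] := h j jk.
have l0' : 0 <= l i / r by rewrite divr_ge0// ltW.
have e1 : (s i + l i / 2) / r = s i / r + l i / 2 / r by rewrite mulrDl.
have e2 : l i / 2 / r = l i / r / 2 by rewrite mulrAC.
rewrite -Rintegral_setU; [| exact: measurable_box | exact: measurable_box | |].
- congr (Rintegral _ _ _); apply/seteqP; split=> [t ht|t [ht|ht] j jk].
  + have := ht (Ordinal ik) ik => /=.
    have [h1|h1] := ltP (t ord0 (Ordinal ik)) (s i / r + l i / r / 2) => h2.
      left=> j jk; rewrite /upd; case: eqP => [ji|_]; last exact: ht.
      have -> : j = Ordinal ik by exact: val_inj.
      rewrite e2 h1 andbT; have := ht (Ordinal ik) ik => /=; lra.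
    right=> j jk; rewrite /upd; case: eqP => [ji|_]; last exact: ht.
    have -> : j = Ordinal ik by exact: val_inj.
    rewrite e1 e2; have := ht (Ordinal ik) ik => /=; lra.
  + by have := ht j jk; rewrite /upd; case: eqP => [->|//]; rewrite e2; lra.
  + by have := ht j jk; rewrite /upd; case: eqP => [->|//]; rewrite e1 e2; lra.
- apply: (@integrableS _ B_ R mu (box dim (fun i => s i / r) (fun i => l i / r))).
  + exact: measurable_box.
  + by apply: (@measurableU _ B_); exact: measurable_box.
  + move=> t [ht|ht] j jk.
      by have := ht j jk; rewrite /upd; case: eqP => [->|//]; rewrite e2; lra.
    by have := ht j jk; rewrite /upd; case: eqP => [->|//]; rewrite e1 e2; lra.
  + exact: box_integrable.
- apply/disj_setPS => t [h1 h2].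
  have := h1 (Ordinal ik) ik; have := h2 (Ordinal ik) ik.
  by rewrite /= /upd eqxx e1 e2; lra.
Qed.

Lemma box_integral_bounds s l (x y : R) : (forall j, 0 <= l j) ->
  (forall t, box dim s l t -> x <= g t /\ g t <= y) ->
  x * box_volume dim l <= \int[mu]_(t in box dim s l) g t /\
  \int[mu]_(t in box dim s l) g t <= y * box_volume dim l.
Proof.
move=> l0 h; have mB : measurable (box dim s l : set B_) by exact: measurable_box.
have ic (c : R) : mu.-integrable (box dim s l) (EFin \o (fun=> c)).
  apply: measurable_bounded_integrable => //; first by rewrite box_measure// ltry.
  exists `|c|; split; first exact: num_real.
  by move=> x0 cx t _; exact: ltW.
have c c0 : c0 * box_volume dim l = \int[mu]_(t in box dim s l) c0.
  by rewrite Rintegral_cst// box_measure.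
have ig := box_integrable s l.
by rewrite !c; split; apply: le_Rintegral => // t /h[].
Qed.

Lemma box_integral_setT s l : (forall t, g t != 0 -> box dim s l t) ->
  \int[mu]_(t in box dim s l) g t = \int[mu]_t g t.
Proof.
move=> h; rewrite Rintegral_mkcond; apply: eq_Rintegral => t _.
rewrite /patch; case: ifPn => // ht; apply/esym/eqP; apply: contraNT ht => /h ht.
exact: mem_set.
Qed.

End box_integrals.

(** * Uniform continuity and the choice of the dyadic scale *)

Section continuity.
Context {R : realType} {n : nat}.

Lemma cc_uniform_continuous (f : 'rV[R]_n.+1 -> R) (e : R) :
  continuous f -> compactly_supported f -> 0 < e ->
  exists2 d : R, 0 < d & forall t u, `|t - u| < d -> `|f t - f u| < e.
Proof.
move=> cf sf e0; pose K := closure [set t | f t != 0].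
change (compact K) in sf.
have /compact_near_coveringP nc := sf.
pose Q (d : R) (t : 'rV[R]_n.+1) := forall u, `|t - u| < d -> `|f t - f u| < e.
have hQ t : K t -> \forall t' \near t & d \near (0 : R)^'+, Q d t'.
  have e2 : 0 < e / 2 by rewrite divr_gt0.
  move=> Kt; have /cvgrPdist_lt/(_ _ e2)/nbhs_ballP[d /= d0 hd] := cf t.
  have d2 : 0 < d / 2 by rewrite divr_gt0.
  exists (ball t (d / 2), [set x | x < d / 2]) => /=.
    split; first exact: nbhsx_ballx.
    exact: nbhs_right_lt.
  move=> [t' x] /= [tt' xd] u t'u.
  have h1 : `|f t - f t'| < e / 2.
    by apply: hd; apply: le_ball tt'; lra.
  have h2 : `|f t - f u| < e / 2.
    apply: hd; rewrite -ball_normE /= in tt' *.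
    apply: le_lt_trans (ler_distD t' _ _) _; lra.
  apply: le_lt_trans (ler_distD (f t) _ _) _; rewrite distrC; lra.
have [d /= d0 hd] := nc R (0 : R)^'+ Q _ hQ.
have dd : 0 < d / 2 by rewrite divr_gt0.
exists (d / 2) => //.
have h t u : K t -> `|t - u| < d / 2 -> `|f t - f u| < e.
  move=> Kt; apply: (hd (d / 2)) => //=.
  by rewrite sub0r normrN gtr0_norm// ltr_pdivrMr// ltr_pMr// ltr1n.
move=> t u tu; have [f0|f0] := eqVneq (f t) 0; last first.
  by apply: h => //; exact: subset_closure.
have [g0|g0] := eqVneq (f u) 0; first by rewrite f0 g0 subrr normr0.
rewrite distrC; apply: h; last by rewrite distrC.
exact: subset_closure.
Qed.

(** The least [M] with [2 * rho * r <= 2 ^ M]: its cube covers a support of radius [rho] dilated by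
    [r] and is larger only by a constant factor. Minimality and [4 * rho <= r] bound [2 ^ (M - 1)]
    by [r ^ 2], which turns powers of [M] into powers of [ln r]. *)
Lemma dyadic_scale (rho r : R) : 1 <= rho -> 4 * rho <= r ->
  exists M : nat, [/\ 2 * rho * r <= 2 ^+ M, 2 ^+ M <= 4 * rho * r &
    M.+1%:R <= 6 * ln r].
Proof.
move=> rho1 hr; have r4 : 4 <= r by lra.
have ln1 : 1 <= ln r.
  rewrite -[leLHS]expRK ler_ln ?posrE ?expR_gt0//; last by lra.
  by have := @expR1_le4 R; lra.
have ln2 : 1 <= 2 * ln 2 :> R.
  rewrite -[leLHS]expRK mulr_natl -lnXn// ler_ln ?posrE ?expR_gt0//.
  by rewrite expr2; have := @expR1_le4 R; lra.
have [N hN] : exists N : nat, 2 * rho * r <= 2 ^+ N.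
  exists (Num.truncn (2 * rho * r)).+1.
  apply: le_trans (ltW (truncnS_gt _)) _.
  by rewrite -natrX ler_nat ltnW// ltn_expl.
have ex : exists N, 2 * rho * r <= 2 ^+ N by exists N.
case: (ex_minnP ex) => -[|M] h1 hmin.
  have : 1 <= rho * r by rewrite -[leLHS]mulr1 ler_pM//; lra.
  by move: h1; rewrite expr0; lra.
have h2 : 2 ^+ M < 2 * rho * r.
  by rewrite ltNge; apply/negP => /hmin; rewrite ltnn.
exists M.+1; split=> //; first by rewrite exprS; lra.
have : M%:R * ln 2 <= 2%:R * ln r.
  rewrite [leLHS]mulr_natl [leRHS]mulr_natl -!lnXn//; last by lra.
  rewrite ler_ln ?posrE ?exprn_gt0//; last by lra.
  apply: le_trans (ltW h2) _; rewrite expr2; apply: ler_wpM2r; lra.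
have M0 : 0 <= M%:R :> R by [].
have := ler_wpM2l M0 ln2.
rewrite -[M.+2%:R]natr1 -[M.+1%:R]natr1.
move=> a b; lra.
Qed.

End continuity.

Section scaling.
Context {R : realType} {n : nat}.

Lemma lfsbm_eq (mu nu : lfsbm R n) : (forall B, mu B = nu B) -> mu = nu.
Proof.
case: mu nu => [f hf] [g hg] /= /funext fg; case: g / fg hg => hg.
by congr LFSBM; exact: Prop_irrelevance.
Qed.

End scaling.

Section scaling_fields.
Context {R : realType} {n : nat}.

Lemma measurable_scale (c : R) : measurable_fun setT
  (scale_lfsbm c : lfsbm_space R n.+1 -> lfsbm_space R n.+1).
Proof.
apply: measurable_lfsbm_map => a S f tf.
under eq_fun do rewrite (lfsbm_integral_scale _ _ tf).
by apply: measurable_funM => //; exact: measurable_lfsbm_integral tf.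
Qed.

Context d (T : measurableType d) (P : probability T R) (X : T -> lfsbm R n.+1).
Hypothesis mX : random_field X.

Lemma random_field_scale c : random_field (fun w => scale_lfsbm c (X w)).
Proof. exact: (measurableT_comp (measurable_scale c) mX). Qed.

Lemma stationary_scale c : stationary P X ->
  stationary P (fun w => scale_lfsbm c (X w)).
Proof.
move=> stX s A mA; have := measurable_scale c measurableT mA; rewrite setTI => mA'.
rewrite [RHS](_ : _ = P (X @^-1` (scale_lfsbm c @^-1` A)))// -(stX s)//.
congr (P _); apply/seteqP; split=> w /=;
  by rewrite (@lfsbm_eq _ _ (reparam 1%g s (scale_lfsbm c (X w)))
       (scale_lfsbm c (reparam 1%g s (X w)))).
Qed.

End scaling_fields.

(** * Rescaled test functions on a large cube *)

Lemma continuous_dilation (R : realType) n (c : R) (f : 'rV[R]_n.+1 -> R) :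
  continuous f -> continuous (fun t : 'rV[R]_n.+1 => f (c *: t)).
Proof.
move=> cf t; apply: (@continuous_comp _ _ _ (fun t : 'rV[R]_n.+1 => c *: t) f).
  exact: scaler_continuous.
exact: cf.
Qed.

Section scaled_cube.
Context {R : realType} {n : nat}.
Local Notation dim := n.+1.
Local Notation B_ := (borel_rV R dim).
Implicit Types (s l : nat -> R).

Lemma box_additiveZ k (c : R) (B : (nat -> R) -> (nat -> R) -> R) :
  box_additive k B -> box_additive k (fun s l => c * B s l).
Proof.
move=> [e a]; split=> [s l s' l' h|s l i ik l0].
  by rewrite (e _ _ _ _ h).
by rewrite (a s l i)// mulrDr.
Qed.

Context d (T : measurableType d) (P : probability T R) (X : T -> lfsbm R dim).
Hypothesis mX : random_field X.
Variables (mu : {measure set B_ -> \bar R}).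
Hypothesis mu_box : forall s l : 'I_dim -> R, (forall j, 0 <= l j) ->
  mu (full_box s l) = (\prod_j l j)%:E.

Variables (phi : 'rV[R]_dim -> R) (K r om V E c : R) (j : nat).
Hypotheses (cphi : continuous phi) (phiK : forall t, `|phi t| <= K).
Hypotheses (K0 : 0 < K) (r0 : 0 < r) (om0 : 0 < om) (om1 : om <= 1).
Hypotheses (V0 : 0 <= V) (E0 : 0 <= E).
Let N : R := (2 ^+ j) ^+ dim.
Let v : R := V / N.
Let F (t : 'rV[R]_dim) := phi (r^-1 *: t).
Hypothesis estim : forall s h (b om mu : R),
    test_fun K (cell j s) h -> `|b| <= K -> 0 < om -> om <= 1 ->
    (forall t, cell j s t -> `|h t - b| <= om) -> `|mu| <= c ->
    mgf_le P X (fun t => mu * h t)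
      (2^-1 * mu ^+ 2 * b ^+ 2 * V + E * mu ^+ 2 * (om + `|mu|)) /\
    forall x, mgf_le P X (fun t => mu * h t) x ->
      2^-1 * mu ^+ 2 * b ^+ 2 * V - E * mu ^+ 2 * (om + `|mu|) <= x.
Hypothesis osc : forall s t, cell j s t -> `|F t - F (\row_(i < dim) s i)| <= om.

(** Multiplied by [r ^ dim], this is the integral of [F ^ 2] over the box [s], [l], written so that
    no change of variables is needed. *)
Definition sqr_integral s l : R :=
  \int[mu]_(t in box dim (fun i => s i / r) (fun i => l i / r)) (phi t ^+ 2).

Lemma measurable_sqr : measurable_fun setT ((fun t => phi t ^+ 2) : B_ -> R).
Proof. by apply: measurable_funX; exact: continuous_borel. Qed.

Lemma sqr_bound t : `|phi t ^+ 2| <= K ^+ 2.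
Proof. by rewrite normrX ler_sqr ?nnegrE// ltW. Qed.

Lemma sqr_integral_cell s (b := F (\row_(i < dim) s i)) :
  (b ^+ 2 - 2 * K * om) * N <= r ^+ dim * sqr_integral s (fun=> 2 ^+ j) /\
  r ^+ dim * sqr_integral s (fun=> 2 ^+ j) <= (b ^+ 2 + 2 * K * om) * N.
Proof.
have rd : 0 < r ^+ dim by rewrite exprn_gt0.
have [] := @box_integral_bounds R n mu (fun t => phi t ^+ 2) (K ^+ 2) mu_box
  measurable_sqr sqr_bound (fun i => s i / r) (fun=> 2 ^+ j / r)
  (b ^+ 2 - 2 * K * om) (b ^+ 2 + 2 * K * om).
- by move=> _; rewrite divr_ge0 ?exprn_ge0// ltW.
- move=> t ht; have : cell j s (r *: t).
    move=> i id; have := ht i id; rewrite mxE -mulrDl ler_pdivrMr// ltr_pdivlMr//.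
    by rewrite mulrC.
  move=> /osc; rewrite -/b /F scalerA mulVf ?gt_eqF// scale1r => h.
  have : `|phi t ^+ 2 - b ^+ 2| <= 2 * K * om.
    rewrite subr_sqr normrM mulrC; apply: ler_pM => //.
    have bK : `|b| <= K := phiK _.
    by apply: le_trans (ler_normD _ _) _; have := phiK t; lra.
  by rewrite ler_norml; lra.
have NE : box_volume dim (fun=> 2 ^+ j / r) = N / r ^+ dim.
  by rewrite box_volume_cst expr_div_n.
rewrite NE -/(sqr_integral s (fun=> 2 ^+ j)) !mulrA ler_pdivrMr// ler_pdivlMr//.
by rewrite (mulrC (r ^+ dim)).
Qed.

Lemma cell_volume_ge1 : 1 <= N.
Proof. by rewrite exprn_ege1// exprn_ege1// ler1n. Qed.

(** Restates the cell estimate through box-additive quantities, as the iteration over scales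
    demands: the corner value [b ^ 2] is replaced by an integral, at the price of the
    oscillation. *)
Lemma cell_bounds (nu e : R) s : `|nu| <= c -> K * v * om + E * (om + `|nu|) <= e ->
  mgf_le P X (fun t => nu * restrict_box dim F s (fun=> 2 ^+ j) t)
    (2^-1 * nu ^+ 2 * v * (r ^+ dim * sqr_integral s (fun=> 2 ^+ j)) + e * nu ^+ 2 * N) /\
  forall x, mgf_le P X (fun t => nu * restrict_box dim F s (fun=> 2 ^+ j) t) x ->
    2^-1 * nu ^+ 2 * v * (r ^+ dim * sqr_integral s (fun=> 2 ^+ j)) - e * nu ^+ 2 * N <= x.
Proof.
move=> nuc he; have N1 := cell_volume_ge1; have N0 : 0 < N by exact: lt_le_trans N1.
have v0 : 0 <= v by rewrite divr_ge0// ltW.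
have VE : V = v * N by rewrite divfK// gt_eqF.
set h := restrict_box dim F s (fun=> 2 ^+ j); set b := F (\row_(i < dim) s i).
have cF : continuous F := continuous_dilation (c := r^-1) cphi.
have th : test_fun K (cell j s) h.
  split; first exact: bounded_borel_cell.
  - apply: measurable_funM; first exact: continuous_borel.
    by apply: measurable_indic; exact: measurable_box.
  - move=> t; rewrite /h /restrict_box indicE; case: (_ \in _).
      by rewrite mulr1; exact: phiK.
    by rewrite mulr0 normr0 ltW.
  - by move=> t ht; rewrite /h /restrict_box indicE memNset// mulr0.
have bK : `|b| <= K := phiK _.
have hb t : cell j s t -> `|h t - b| <= om.
  by move=> ht; rewrite /h /restrict_box indicE mem_set// mulr1; exact: osc.
have [up down] := estim th bK om0 om1 hb nuc.
have [I1 I2] := sqr_integral_cell s; rewrite -/b in I1 I2.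
set I := r ^+ dim * _ in I1 I2 *.
have nu2 : 0 <= nu ^+ 2 by exact: sqr_ge0.
have k0 : 0 <= 2^-1 * nu ^+ 2 * v by rewrite mulr_ge0// mulr_ge0.
have I1' := ler_wpM2l k0 I1; have I2' := ler_wpM2l k0 I2.
have om_nu : 0 <= E * (om + `|nu|).
  by rewrite mulr_ge0// addr_ge0// ltW.
have h1 : E * (om + `|nu|) <= E * (om + `|nu|) * N by rewrite ler_peMr.
have h2 := ler_wpM2l nu2 h1.
have nuN : 0 <= nu ^+ 2 * N by apply: mulr_ge0 => //; exact: ltW.
have h3 := ler_wpM2l nuN he.
rewrite VE in up down; split.
  by apply: (mgf_le_mono up); lra.
move=> x /down; lra.
Qed.

Variables (L p lambda e a : R) (M : nat) (s0 : nat -> R).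
Hypotheses (L0 : 0 <= L) (p1 : 1 <= p) (jM : (j <= M)%N).
Hypotheses (plc : `|p * lambda| <= c).
Hypothesis he : K * v * om + E * (om + `|p * lambda|) <= e.
Hypothesis aE : a = `|lambda| * K.
Hypothesis supp : forall t, phi t != 0 ->
  box dim (fun i => s0 i / r) (fun=> 2 ^+ M / r) t.
Hypothesis hp : forall S f B, test_fun a S f -> box_additive dim B ->
  ((forall s, mgf_le P X (fun t => p * restrict_box dim f s (fun=> 2 ^+ j) t)
                  (p * B s (fun=> 2 ^+ j))) ->
     forall s, mgf_le P X (restrict_box dim f s (fun=> 2 ^+ M))
       (B s (fun=> 2 ^+ M) + L * a ^+ 2 * (2 / 3) ^+ j * (2 ^+ M) ^+ dim)) /\
  ((forall s x, mgf_le P X (restrict_box dim f s (fun=> 2 ^+ j)) x -> B s (fun=> 2 ^+ j) <= x) ->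
     forall s x, mgf_le P X (fun t => p * restrict_box dim f s (fun=> 2 ^+ M) t) (p * x) ->
       B s (fun=> 2 ^+ M) - L * a ^+ 2 * (2 / 3) ^+ j * (2 ^+ M) ^+ dim <= x).
Let D : R := (2 ^+ M) ^+ dim.
Let sq : R := \int[mu]_t (phi t ^+ 2).

Lemma cube_log_mgf : exists Lam : R,
  [/\ (\int[P]_w (expR (lfsbm_integral (X w) (fun t => lambda * F t)))%:E = (expR Lam)%:E)%E,
   Lam <= 2^-1 * p * lambda ^+ 2 * v * (r ^+ dim * sq) + p * e * lambda ^+ 2 * D +
     L * a ^+ 2 * (2 / 3) ^+ j * D &
   2^-1 * p^-1 * lambda ^+ 2 * v * (r ^+ dim * sq) - p^-1 * e * lambda ^+ 2 * D -
     p * (L * a ^+ 2 * (2 / 3) ^+ j * D) <= Lam].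
Proof.
have p0 : 0 < p by exact: lt_le_trans p1.
pose Q : set 'rV[R]_dim := box dim s0 (fun=> 2 ^+ M).
have cF : continuous F := continuous_dilation (c := r^-1) cphi.
have FQ t : F t != 0 -> Q t.
  move=> /supp ht i id; have := ht i id.
  by rewrite mxE (mulrC _ (t _ _)) -mulrDl ler_pM2r ?ltr_pM2r ?invr_gt0.
have tF : test_fun K Q F.
  split; [exact: bounded_borel_box|exact: continuous_borel|move=> t; exact: phiK|].
  by move=> t; apply: contra_notP => /eqP; exact: FQ.
(* The upper bound has the factor [p] on the cells, the lower bound on the large cube. The latter is
   therefore applied to [f'], for which [p * f'] is [f]. *)
pose f t := lambda * F t; pose f' t := lambda / p * F t.
have tf : test_fun a Q f by rewrite aE; exact: test_funZ.
have tf' : test_fun a Q f'.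
  apply: (test_funS (test_funZ (lambda / p) tF)) => //; last exact: bounded_borel_box.
  rewrite aE ler_wpM2r ?(ltW K0)// normrM normfV (gtr0_norm p0).
  by rewrite ler_pdivrMr// ler_peMr.
have addJ : box_additive dim sqr_integral.
  exact: (box_integral_additive mu_box measurable_sqr sqr_bound r0).
have sqE : sqr_integral s0 (fun=> 2 ^+ M) = sq.
  by apply: box_integral_setT => t; rewrite sqrf_eq0; exact: supp.
have volE m : box_volume dim (fun=> 2 ^+ m) = (2 ^+ m) ^+ dim :> R.
  exact: box_volume_cst.
(* [p * B] has to be the cell bound at [p * lambda]; its square leaves one factor [p] in [B]. *)
pose B s l := 2^-1 * p * lambda ^+ 2 * v * r ^+ dim * sqr_integral s l +
  p * e * lambda ^+ 2 * box_volume dim l.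
have aB : box_additive dim B.
  by apply: box_additiveD; [exact: box_additiveZ|exact: box_additive_volume].
have fE : restrict_box dim f s0 (fun=> 2 ^+ M) = f.
  apply: restrict_box_id tf _ => t; rewrite mulf_eq0 negb_or => /andP[_].
  exact: FQ.
have up : mgf_le P X f (B s0 (fun=> 2 ^+ M) + L * a ^+ 2 * (2 / 3) ^+ j * D).
  rewrite -{1}fE; apply: (hp tf aB).1 => s.
  have [h _] := cell_bounds s plc he.
  rewrite (_ : p * B s _ = 2^-1 * (p * lambda) ^+ 2 * v *
    (r ^+ dim * sqr_integral s (fun=> 2 ^+ j)) + e * (p * lambda) ^+ 2 * N); last first.
    by rewrite /B volE -/N; ring.
  by apply: (eq_fun_pred h) => t; rewrite /restrict_box /f; ring.
(* The upper bound just obtained shows that this moment is finite, so that its logarithm exists. *)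
pose I := (\int[P]_w (expR (lfsbm_integral (X w) f))%:E)%E.
have I0 : (0 < I)%E by exact: mgf_gt0 tf.
have Ioo : I \is a fin_num.
  by rewrite ge0_fin_numE ?(ltW I0)//; apply: le_lt_trans up _; exact: ltry.
pose Lam := ln (fine I).
have I0' : 0 < fine I by rewrite fine_gt0// I0 ltey_eq Ioo.
have IE : I = (expR Lam)%:E by rewrite lnK ?posrE// fineK.
exists Lam; split; first exact: IE.
  have := up; rewrite /mgf_le -/I IE lee_fin ler_expR /B sqE volE -/D.
  by rewrite -!mulrA.
pose B' s l := 2^-1 * (lambda / p) ^+ 2 * v * r ^+ dim * sqr_integral s l +
  (- (e * (lambda / p) ^+ 2)) * box_volume dim l.
have aB' : box_additive dim B'.
  by apply: box_additiveD; [exact: box_additiveZ|exact: box_additive_volume].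
have lpc : `|lambda / p| <= `|p * lambda|.
  rewrite !normrM normfV (gtr0_norm p0) ler_pdivrMr// mulrAC.
  by rewrite ler_peMl// -expr2 exprn_ege1.
have he' : K * v * om + E * (om + `|lambda / p|) <= e.
  apply: le_trans he; rewrite lerD2l; apply: ler_wpM2l => //.
  by rewrite lerD2l.
have h' : B' s0 (fun=> 2 ^+ M) - L * a ^+ 2 * (2 / 3) ^+ j * D <= Lam / p.
  apply: ((hp tf' aB').2 _ s0 (Lam / p)) => [s x hx|].
    have [_ h] := cell_bounds s (le_trans lpc plc) he'.
    have := h x; rewrite /B' volE -/N mulNr -!mulrA; apply.
    by apply: (eq_fun_pred hx) => t; rewrite /restrict_box /f'; ring.
  rewrite mulrC divfK ?gt_eqF//.
  have : mgf_le P X f Lam by rewrite /mgf_le -/I IE.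
  move=> h; apply: (eq_fun_pred h) => t.
  rewrite -[in LHS]fE /restrict_box /f /f'; field.
  by rewrite gt_eqF.
rewrite /B' sqE volE -/D in h'.
rewrite ler_pdivlMr// in h'; apply: le_trans h'.
rewrite le_eqVlt; apply/orP; left; apply/eqP; field.
by rewrite gt_eqF.
Qed.

End scaled_cube.

(** * The limit *)

Section asymptotics.
Context {R : realType} {n : nat}.
Local Notation dim := n.+1.
Local Notation B_ := (borel_rV R dim).

Lemma coord_le_norm (t : 'rV[R]_dim) i : `|t ord0 i| <= `|t|.
Proof.
have -> : `|t| = mx_norm t by []; rewrite mx_normrE.
exact: (le_bigmax _ _ (ord0, i)).
Qed.

Lemma norm_le_coord (t : 'rV[R]_dim) x : 0 <= x -> (forall i, `|t ord0 i| <= x) -> `|t| <= x.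
Proof.
move=> x0 h; have -> : `|t| = mx_norm t by []; rewrite mx_normrE.
by apply/bigmax_leP; split=> // -[i j] _ /=; rewrite ord1.
Qed.

Lemma dist_itv (x y l : R) : x <= y < x + l -> `|y - x| <= l.
Proof. by rewrite ler_norml; lra. Qed.

Lemma symmetric_itv (x y h : R) : `|x| < y -> y <= h -> - h <= x < - h + (h + h).
Proof. by rewrite ltr_norml; lra. Qed.

Lemma two_thirds_le j : (2 / 3) ^+ j <= (3 / 4) ^+ j :> R.
Proof. by rewrite lerXn2r ?nnegrE//; lra. Qed.

Lemma expRB1_le (x y : R) : 0 <= x -> x <= y -> expR x - 1 <= x * expR y.
Proof.
move=> x0 xy; apply: (@le_trans _ _ (x * expR x)); last first.
  by rewrite ler_wpM2l// ler_expR.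
have := expR_ge1Dx (- x); rewrite -(ler_pM2r (expR_gt0 x)) mulrC.
by rewrite -expRD addNr expR0; lra.
Qed.

(** Here [Y] is [r ^ d * lambda ^ 2], [th] is [(3 / 4) ^ j], and [U], [Z] are the error volumes.
    Since [p - 1 = O(th)] and [p^-1 >= 2 - p], the exponents change the main term only by
    [O(th * Y)]. *)
Lemma approx_arith (v sq Y p Pm th W L K C U Z Lam : R) :
  0 <= v -> v <= 8 * C -> 0 <= sq -> 0 <= Y -> 1 <= p -> p <= Pm -> 0 <= L ->
  p - 1 <= 2 * L * th * Pm -> 0 <= th -> U <= W * Y -> 0 <= U -> 0 <= W ->
  Z <= K ^+ 2 * th * W * Y -> 0 <= Z -> 
  Lam <= 2^-1 * p * v * sq * Y + p * (2 * th) * U + L * Z ->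
  2^-1 * p^-1 * v * sq * Y - p^-1 * (2 * th) * U - p * (L * Z) <= Lam ->
  `|Lam - 2^-1 * v * sq * Y| <=
  (8 * C * L * Pm * sq + (2 * Pm + Pm * L * K ^+ 2) * W) * th * Y.
Proof.
move=> v0 vC sq0 Y0 p1 pP L0 pB th0 UW U0 W0 ZW Z0 h1 h2.
have p0 : 0 < p by lra.
have pV1 : p^-1 <= 1 by rewrite invf_le1.
have pV2 : 2 - p <= p^-1.
  rewrite -div1r ler_pdivlMr//; have := sqr_ge0 (p - 1); lra.
have sY : 0 <= sq * Y by rewrite mulr_ge0.
have a1 : 2^-1 * (p - 1) * v * (sq * Y) <= 8 * C * L * Pm * sq * th * Y.
  apply: (@le_trans _ _ (2^-1 * (2 * L * th * Pm) * (8 * C) * (sq * Y))); last lra.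
  apply: ler_wpM2r => //; apply: ler_pM => //; last by apply: ler_wpM2l.
  by rewrite mulr_ge0// subr_ge0.
have tU : 0 <= th * U by rewrite mulr_ge0.
have tUW := ler_wpM2l th0 UW.
have P0 : 0 <= Pm by lra.
have LZ : 0 <= L * Z by rewrite mulr_ge0.
have LZW := ler_wpM2l L0 ZW.
have b1 : p * (th * U) <= Pm * (th * U) by exact: ler_wpM2r.
have b2 := ler_wpM2l P0 tUW.
have b3 : p * (L * Z) <= Pm * (L * Z) by exact: ler_wpM2r.
have b4 := ler_wpM2l P0 LZW.
have b5 : L * Z <= Pm * (L * Z) by rewrite ler_peMl//; lra.
have b6 : p^-1 * (th * U) <= Pm * (th * U) by apply: ler_wpM2r => //; lra.
have vsY : 0 <= v * (sq * Y) by rewrite mulr_ge0.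
have b7 := ler_wpM2r vsY pV2.
by rewrite ler_norml; apply/andP; split; lra.
Qed.

Context d (T : measurableType d) (P : probability T R) (X : T -> lfsbm R dim).
Hypotheses (mX : random_field X) (X0 : mean0 P X) (statX : stationary P X).
Hypothesis sX : splits dim (mgf_le P X).

Definition cell_density j : R := cell_variance0 P X j / (2 ^+ j) ^+ dim.

Lemma cell_density_ge0 j : 0 <= cell_density j.
Proof.
by rewrite divr_ge0 ?exprn_ge0//; apply: Rintegral_ge0 => w _; exact: sqr_ge0.
Qed.

(** [A] is independent of [j]: the constants of the cell estimates and the modulus of continuity,
    which do depend on [j], only restrict [r] and [lambda]. *)
Lemma log_mgf_estimate phi : continuous phi -> compactly_supported phi ->
  exists2 A : R, 0 <= A & forall j : nat, exists R0 delta : R, [/\ 0 < R0, 0 < delta &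
    forall r lambda : R, R0 < r -> 0 < `|lambda| -> `|lambda| < delta ->
    `|lambda| * ln r ^+ dim < delta -> exists2 Lam : R,
    (\int[P]_w (expR (lfsbm_integral (X w) (fun t => lambda * phi (r^-1 *: t))))%:E =
      (expR Lam)%:E)%E &
    `|Lam - 2^-1 * cell_density j * sqnorm_rV phi * (r ^+ dim * lambda ^+ 2)| <=
      A * (3 / 4) ^+ j * (r ^+ dim * lambda ^+ 2)].
Proof.
move=> cphi sphi; have [mu muE mu_box] := @lebesgue_rVP R dim.
have [C' C'1 cb'] := exists_cube_bound (R := R) (n := n) (leqnSn n).
have [L L1 sub] := cube_bound_subcubes C'1 (ltnSn n) cb'.
have [C C1 cb] := exists_cube_bound (R := R) (n := n) (leqnn n.+1).
have [a0 [[_ bS] _ pa pS]] := cc_test_fun cphi sphi.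
have [rho0 hrho0] := (bounded_setP _).1 bS.
pose K : R := `|a0| + 1; pose rho : R := `|rho0| + 1.
have K0 : 0 < K by have := normr_ge0 a0; rewrite /K; lra.
have rho1 : 1 <= rho by have := normr_ge0 rho0; rewrite /rho; lra.
have pK t : `|phi t| <= K by have := pa t; have := ler_norm a0; rewrite /K; lra.
have hrho t : phi t != 0 -> `|t| < rho.
  move=> pt; have : `|t| <= rho0 by apply: hrho0; exact: subset_closure.
  by have := ler_norm rho0; rewrite /rho; lra.
pose sq := sqnorm_rV phi.
have sqE : sq = \int[mu]_t (phi t ^+ 2) by rewrite /sq /sqnorm_rV muE.
have sq0 : 0 <= sq by rewrite sqE; apply: Rintegral_ge0 => t _; exact: sqr_ge0.
pose Pm : R := expR (2 * L); have Pm0 : 0 < Pm by exact: expR_gt0.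
have Pm1 : 1 <= Pm by rewrite -[leLHS]expR0 ler_expR mulr_ge0// (le_trans ler01 L1).
pose W : R := (4 * rho) ^+ dim.
have rho0' : 0 < rho := lt_le_trans ltr01 rho1.
have rho4 : 1 <= 4 * rho by lra.
have W0 : 0 <= W by rewrite exprn_ge0// mulr_ge0// ltW.
have L0 : 0 <= L := le_trans ler01 L1; have C0 : 0 < C := lt_le_trans ltr01 C1.
exists (8 * C * L * Pm * sq + (2 * Pm + Pm * L * K ^+ 2) * W).
  by do !(apply: addr_ge0 || apply: mulr_ge0 || apply: exprn_ge0) => //; exact: ltW.
move=> j; pose th : R := (3 / 4) ^+ j.
have th0 : 0 < th by rewrite exprn_gt0.
have th1 : th <= 1 by rewrite exprn_ile1// ler_pdivrMr ?mul1r ?ler_nat.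
have [E [c [c0 E0 est]]] := cell_estimates mX X0 statX sX j C1 cb K0.
have CK0 : 0 < 8 * C * K by rewrite !mulr_gt0.
have CKE : 0 < 8 * C * K + E + 1 by rewrite ltr_wpDl// addr_ge0// ltW.
(* The admissible oscillation on a cell, small enough that its total effect [(8 * C * K + E) * om]
   is at most [th]. *)
pose om : R := Num.min 1 (th / (8 * C * K + E + 1)).
have om0 : 0 < om by rewrite lt_min ltr01 divr_gt0.
have om1 : om <= 1 by rewrite ge_min lexx.
have omth : (8 * C * K + E) * om <= th.
  apply: (@le_trans _ _ ((8 * C * K + E + 1) * om)).
    by rewrite ler_wpM2r ?(ltW om0)// lerDl.
  by rewrite mulrC -ler_pdivlMr// ge_min lexx orbT.
have [du du0 uc] := cc_uniform_continuous cphi sphi om0.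
have j2 : 0 < 2 ^+ j :> R by rewrite exprn_gt0.
have LK1 : 0 < L * K * 6 ^+ dim + 1.
  by rewrite ltr_wpDl// mulr_ge0 ?exprn_ge0// mulr_ge0// ltW.
have EP1 : 0 < E * Pm + 1 by rewrite ltr_wpDl// mulr_ge0// ltW.
(* For [r]: the summands serve [dyadic_scale], [j <= M], and the oscillation on a cell shrunk by
   [r]. For [lambda]: the three minima keep [p * lambda] in the range of the cell estimates, its
   Taylor error below [th], and [L * a * M.+1 ^ dim] below [th]. *)
exists (4 * rho + 2 ^+ j + 2 ^+ j / du),
  (Num.min (c / Pm) (Num.min (th / (E * Pm + 1)) (th / (L * K * 6 ^+ dim + 1)))).
have jdu : 0 < 2 ^+ j / du by exact: divr_gt0.
split.
- by rewrite !addr_gt0// mulr_gt0.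
- by rewrite !lt_min !divr_gt0.
move=> r lambda rR lam0; rewrite !lt_min => /and3P[lam1 lam2 _] /and3P[_ _ lam3].
have hr : 4 * rho <= r.
  by apply: le_trans (ltW rR); rewrite -addrA lerDl addr_ge0// ltW.
have jr : 2 ^+ j <= r.
  by apply: le_trans (ltW rR); rewrite addrAC lerDr addr_ge0// ltW// mulr_gt0.
have r1 : 1 <= r := le_trans rho4 hr; have r0 : 0 < r := lt_le_trans ltr01 r1.
have [M [M1 M2 M3]] := dyadic_scale rho1 hr.
have jM : (j <= M)%N.
  rewrite -(@ler_eXn2l R 2) ?ltr1n//; apply: le_trans M1.
  by apply: (le_trans jr); rewrite ler_peMl ?(ltW r0)// mulr_ege1// ler1n.
pose a := `|lambda| * K.
have a_ge0 : 0 <= a by rewrite mulr_ge0// ltW.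
(* This allows [delta := th] in [subcube_bounds], so that [p] is at most [expR (2 * L * th)]. *)
have small : L * a * M.+1%:R ^+ dim <= th.
  apply: (@le_trans _ _ (L * a * (6 * ln r) ^+ dim)).
    apply: ler_wpM2l; first by rewrite mulr_ge0.
    by apply: lerXn2r; rewrite ?nnegrE//; exact: le_trans M3.
  have -> : L * a * (6 * ln r) ^+ dim = L * K * 6 ^+ dim * (`|lambda| * ln r ^+ dim).
    by rewrite exprMn /a; ring.
  have l0 : 0 <= `|lambda| * ln r ^+ dim.
    by rewrite mulr_ge0// exprn_ge0// ln_ge0.
  apply: (@le_trans _ _ ((L * K * 6 ^+ dim + 1) * (`|lambda| * ln r ^+ dim))).
    by rewrite ler_wpM2r// lerDl.
  by rewrite mulrC -ler_pdivlMr// ltW.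
have [p [p1 pP hp]] := sub j M a th jM a_ge0 th1 small.
have p0 : 0 < p := lt_le_trans ltr01 p1.
have pE : p <= expR (2 * L * th) 
  by apply: le_trans pP _; rewrite ler_expR -/th -mulrA mulrCA mulr_natl mulr2n.
have Lth : 2 * L * th <= 2 * L by rewrite ler_piMr// mulr_ge0.
have pPm : p <= Pm by apply: le_trans pE _; rewrite ler_expR.
have pB : p - 1 <= 2 * L * th * Pm.
  apply: (@le_trans _ _ (expR (2 * L * th) - 1)); first by rewrite lerB.
  by apply: expRB1_le => //; apply: mulr_ge0; [rewrite mulr_ge0|exact: ltW].
have plam : `|p * lambda| <= Pm * `|lambda| by rewrite normrM gtr0_norm// ler_wpM2r.
have plc : `|p * lambda| <= c.
  by apply: le_trans plam _; rewrite mulrC -ler_pdivlMr// ltW.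
pose v := cell_density j; have v0 : 0 <= v by exact: cell_density_ge0.
have v8 : v <= 8 * C.
  rewrite ler_pdivrMr ?exprn_gt0//.
  by have [_] := cell_variance_bound mX sX j C1 cb.
have he : K * v * om + E * (om + `|p * lambda|) <= 2 * th.
  have e1 : K * v * om <= 8 * C * K * om.
    by rewrite ler_wpM2r ?(ltW om0)// mulrC ler_wpM2r// ltW.
  have e2 : E * `|p * lambda| <= E * Pm * `|lambda| by rewrite -mulrA ler_wpM2l.
  have e3 : (E * Pm + 1) * `|lambda| <= th.
    by rewrite mulrC -ler_pdivlMr// ltW.
  rewrite [leRHS]mulr_natl mulr2n mulrDr addrA; apply: lerD.
    by apply: le_trans omth; rewrite [leRHS]mulrDl; apply: lerD.
  by apply: le_trans (le_trans e2 _) e3; rewrite ler_wpM2r// lerDl.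
have V0 : 0 <= cell_variance0 P X j by apply: Rintegral_ge0 => w _; exact: sqr_ge0.
have osc s t : cell j s t ->
    `|phi (r^-1 *: t) - phi (r^-1 *: (\row_(i < dim) s i))| <= om.
  move=> ht; apply/ltW/uc; rewrite -scalerBr normrZ gtr0_norm ?invr_gt0//.
  apply: (@le_lt_trans _ _ (r^-1 * 2 ^+ j)).
    rewrite ler_wpM2l ?invr_ge0 ?(ltW r0)//; apply: norm_le_coord => [|i]; first exact: ltW.
    by rewrite !mxE; apply: dist_itv; exact: ht.
  rewrite mulrC ltr_pdivrMr// mulrC -ltr_pdivrMr//; apply: le_lt_trans rR.
  by rewrite lerDr addr_ge0 ?(ltW j2)// mulr_ge0// (le_trans _ rho1).
have supp t : phi t != 0 ->
    box dim (fun i : nat => - (2 ^+ M / 2) / r) (fun=> 2 ^+ M / r) t.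
  move=> /hrho ht i id; have -> : 2 ^+ M / r = 2 ^+ M / 2 / r + 2 ^+ M / 2 / r.
    by field; rewrite gt_eqF.
  rewrite mulNr; apply: symmetric_itv (le_lt_trans (coord_le_norm t i) ht) _.
  by rewrite ler_pdivlMr// ler_pdivlMr// mulrC mulrA.
have [|Lam [LamE h1 h2]] := cube_log_mgf mX mu_box cphi pK K0 r0 om0 om1 V0 E0 est osc
  (L := L) (a := a) p1 plc he erefl supp.
  by move=> S f B tf aB; exact: hp sX tf aB.
exists Lam => //; rewrite -/v -/sq -/th.
rewrite -sqE in h1 h2.
set Y := r ^+ dim * lambda ^+ 2.
have Y0 : 0 <= Y by rewrite mulr_ge0 ?sqr_ge0// exprn_ge0// ltW.
pose U := lambda ^+ 2 * (2 ^+ M) ^+ dim.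
pose Z := a ^+ 2 * (2 / 3) ^+ j * (2 ^+ M) ^+ dim.
have DW : (2 ^+ M) ^+ dim <= W * r ^+ dim.
  by rewrite -exprMn; apply: lerXn2r; rewrite ?nnegrE ?exprn_ge0// (le_trans _ M2)// exprn_ge0.
have UW : U <= W * Y.
  rewrite (_ : W * Y = lambda ^+ 2 * (W * r ^+ dim)); last by rewrite /Y; ring.
  by rewrite ler_wpM2l ?sqr_ge0.
have aE : a ^+ 2 = K ^+ 2 * lambda ^+ 2.
  by rewrite /a exprMn real_normK ?num_real// mulrC.
have t23 : (2 / 3) ^+ j <= th := two_thirds_le j.
have U0 : 0 <= U by rewrite mulr_ge0 ?sqr_ge0// !exprn_ge0.
have Z0 : 0 <= Z by rewrite mulr_ge0 ?exprn_ge0// mulr_ge0 ?sqr_ge0// exprn_ge0.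
apply: (approx_arith v0 v8 sq0 Y0 p1 pPm _ pB (ltW th0) UW U0 W0 (Z := Z)) => //.
- rewrite (_ : Z = K ^+ 2 * ((2 / 3) ^+ j * U)); last by rewrite /Z /U aE; ring.
  rewrite (_ : K ^+ 2 * th * W * Y = K ^+ 2 * (th * (W * Y))); last by ring.
  apply: ler_wpM2l; first exact: sqr_ge0.
  by apply: ler_pM => //; exact: exprn_ge0.
- apply: le_trans h1 _; rewrite le_eqVlt; apply/orP; left; apply/eqP.
  by rewrite /Y /U /Z /v /cell_density; ring.
- apply: le_trans h2; rewrite le_eqVlt; apply/orP; left; apply/eqP.
  by rewrite /Y /U /Z /v /cell_density; ring.
Qed.

End asymptotics.

(** * Comparing limits along admissible scales *)

Section limits.
Context {R : realType}.

Lemma geometric_small (B e : R) : 0 < e -> exists j : nat, B * (3 / 4) ^+ j < e.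
Proof.
move=> e0; have [B0|B0] := leP B 0.
  by exists 0; rewrite mulr1; exact: le_lt_trans e0.
have h : `|3 / 4 : R| < 1 by rewrite ger0_norm; lra.
have /cvgrPdist_lt/(_ _ (divr_gt0 e0 B0))[N _ /(_ N (leqnn N))] := cvg_expr h.
rewrite /= sub0r normrN ger0_norm ?exprn_ge0// ltr_pdivlMr// mulrC => hN.
by exists N.
Qed.

(** The range of the limit is not empty, so two estimates can be compared at a common [r] and
    [lambda]. *)
Lemma small_scale (m : nat) (R0 delta : R) : 0 < R0 -> 0 < delta ->
  exists r lambda : R, [/\ R0 < r, 0 < r, 0 < lambda, lambda < delta &
    lambda * ln r ^+ m < delta].
Proof.
move=> R00 d0; pose r := R0 + 1; have r1 : 1 <= r by rewrite /r; lra.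
have l0 : 0 <= ln r ^+ m by rewrite exprn_ge0// ln_ge0.
pose lambda := delta / (2 * (1 + ln r ^+ m)).
have D0 : 0 < 2 * (1 + ln r ^+ m) by lra.
have lam0 : 0 < lambda by rewrite divr_gt0.
have lamE : lambda * (2 * (1 + ln r ^+ m)) = delta by rewrite divfK// gt_eqF.
exists r, lambda; have := mulr_ge0 (ltW lam0) l0.
by split=> //; rewrite /r; lra.
Qed.

Lemma limit_of_approx (v : nat -> R) (D : R) : 0 <= D -> (forall j, 0 <= v j) ->
  (forall i j, `|v i - v j| <= D * ((3 / 4) ^+ i + (3 / 4) ^+ j)) ->
  exists2 l, 0 <= l & forall j, `|v j - l| <= D * (3 / 4) ^+ j.
Proof.
(* Every [v j + D * (3 / 4) ^ j] bounds this set of lower ends from above, so its supremum lies in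
   all the intervals at once. *)
move=> D0 v0 vD; pose S := [set v j - D * (3 / 4) ^+ j | j in setT].
have ubS j : ubound S (v j + D * (3 / 4) ^+ j).
  by move=> _ [i _ <-]; have := vD i j; rewrite ler_norml; lra.
have S0 : S !=set0 by exists (v 0%N - D * (3 / 4) ^+ 0); exists 0%N.
have supS : has_sup S by split=> //; exists (v 0%N + D * (3 / 4) ^+ 0); exact: ubS.
have hl j : `|v j - sup S| <= D * (3 / 4) ^+ j.
  have h1 : sup S <= v j + D * (3 / 4) ^+ j by apply: ge_sup => //; exact: ubS.
  have h2 : v j - D * (3 / 4) ^+ j <= sup S by apply: ub_le_sup; [exact: supS.2|exists j].
  by rewrite ler_norml; lra.
exists (sup S) => //; rewrite leNgt; apply/negP => l0.
have l0' : 0 < - sup S by rewrite oppr_gt0.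
have [j hj] := geometric_small D l0'.
by have := hl j; have := v0 j; rewrite ler_norml; lra.
Qed.

Lemma ereal_dist_le (e : \bar R) (x y eta : R) : (`|e - x%:E| < eta%:E)%E ->
  (`|e - y%:E| < eta%:E)%E -> `|x - y| < 2 * eta.
Proof.
case: e => [e| |] //; rewrite -!EFinB !abse_EFin !lte_fin !ltr_norml; lra.
Qed.

End limits.

(** * A test function of positive norm *)

Section tent.
Context {R : realType} {n : nat}.
Local Notation dim := n.+1.
Local Notation B_ := (borel_rV R dim).

(** A positive [sqnorm_rV] has to be divided by, both for the Cauchy property of the densities and
    for the uniqueness of [sigma]. *)
Definition tent (t : 'rV[R]_dim) : R := Num.max 0 (1 - `|t|).

Lemma continuous_tent : continuous tent.
Proof.
move=> t; apply: (@continuous_max _ _ (fun=> 0) (fun t : 'rV[R]_dim => 1 - `|t|)).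
  exact: cst_continuous.
apply: continuousB; first exact: cst_continuous.
exact: norm_continuous.
Qed.

Lemma tent_supp t : tent t != 0 -> `|t| < 1.
Proof.
by rewrite /tent; have [|h _] := leP (1 - `|t|) 0; [rewrite eqxx|move: h; rewrite subr_gt0].
Qed.

Lemma compactly_supported_tent : compactly_supported tent.
Proof.
apply: bounded_closed_compact; last exact: closed_closure.
apply/bounded_setP; exists 1 => t ht.
have : closed [set t : 'rV[R]_dim | `|t| <= 1].
  apply: (@closed_comp _ _ (fun t : 'rV[R]_dim => `|t|) [set x | x <= 1]).
    by move=> u _; exact: norm_continuous.
  exact: closed_le.
move=> /closure_id E; suff : closure [set t : 'rV[R]_dim | `|t| <= 1] t by rewrite -E.
by apply: closureS ht => u /tent_supp /ltW.
Qed.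

Lemma tent_norm t : `|tent t| <= 1.
Proof.
rewrite ger0_norm /tent; last by rewrite le_max lexx.
by rewrite ge_max ler01 gerBl normr_ge0.
Qed.

Lemma sqnorm_tent_gt0 : 0 < sqnorm_rV tent.
Proof.
have [mu muE mu_box] := @lebesgue_rVP R dim.
have mt : measurable_fun setT (tent : B_ -> R) by exact: continuous_borel continuous_tent.
have mt2 : measurable_fun setT ((fun t => tent t ^+ 2) : B_ -> R) by exact: measurable_funX.
have b2 t : `|tent t ^+ 2| <= 1 by rewrite normrX exprn_ile1// tent_norm.
rewrite /sqnorm_rV muE -/(Rintegral mu setT (fun t => tent t ^+ 2)).
pose Q : set 'rV[R]_dim := box dim (fun=> - 2^-1) (fun=> 1).
pose Q2 : set 'rV[R]_dim := box dim (fun=> - 1) (fun=> 2).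
have mQ : measurable (Q : set B_) by exact: measurable_box.
have bQ : bounded_borel Q by exact: bounded_borel_box.
have bQ2 : bounded_borel Q2 by exact: bounded_borel_box.
have tQ2 : test_fun 1 Q2 (fun t => tent t ^+ 2).
  split=> // t Qt; apply/eqP; rewrite sqrf_eq0; apply: contra_notT Qt => /tent_supp t1 i _.
  by have := le_lt_trans (coord_le_norm t i) t1; rewrite ltr_norml; lra.
(* On the unit cube [Q] centred at 0 the tent is at least 1/2. *)
pose g := fun t : 'rV[R]_dim => 4^-1 * \1_Q t : R.
have tg : test_fun (`|4^-1 : R| * 1) Q g by exact/test_funZ/test_fun_indic.
have gle t : g t <= tent t ^+ 2.
  rewrite /g indicE; have [Qt|Qt] := pselect (Q t); last by rewrite memNset// mulr0 sqr_ge0.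
  rewrite mem_set// mulr1.
  have : `|t| <= 2^-1.
    by apply: norm_le_coord => // i; rewrite ler_norml; have := Qt i (ltn_ord i); lra.
  move=> h; have : 2^-1 <= tent t by rewrite le_max; apply/orP; right; lra.
  move=> h2; rewrite (_ : 4^-1 = 2^-1 ^+ 2 :> R); last by field.
  by rewrite lerXn2r ?nnegrE//; lra.
have Qv : mu Q = 1%:E.
  rewrite /Q (box_measure mu_box)// box_volume_cst expr1n//.
have Q2v : (mu Q2 < +oo)%E by rewrite /Q2 (box_measure mu_box)// ltry.
have Qoo : (mu Q < +oo)%E by rewrite Qv ltry.
apply: (@lt_le_trans _ _ (\int[mu]_t g t)).
  have iQ : mu.-integrable setT (EFin \o \1_Q).
    by apply: test_fun_integrable Qoo; exact: test_fun_indic.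
  rewrite /g (RintegralZl _ measurableT iQ).
  rewrite (_ : \int[mu]_x \1_Q x = 1); first by rewrite mulr1 invr_gt0.
  by rewrite /Rintegral integral_indic// setIT; exact: (congr1 fine Qv).
apply: le_Rintegral => //; first exact: test_fun_integrable tg Qoo.
exact: test_fun_integrable tQ2 Q2v.
Qed.

End tent.

(** * Existence of the limiting variance *)

Section limit_variance.
Context {R : realType} {n : nat}.
Local Notation dim := n.+1.
Context d (T : measurableType d) (P : probability T R) (X : T -> lfsbm R dim).
Hypotheses (mX : random_field X) (X0 : mean0 P X) (statX : stationary P X).
Hypothesis sX : splits dim (mgf_le P X).

(** At a common [r] and [lambda] the estimates for [i] and [j] concern the same logarithm; dividing
    by half the squared norm of the tent gives [D]. *)
Lemma cell_density_cauchy : exists2 D : R, 0 <= D & forall i j,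
  `|cell_density P X i - cell_density P X j| <= D * ((3 / 4) ^+ i + (3 / 4) ^+ j).
Proof.
have [A A0 hA] := log_mgf_estimate mX X0 statX sX continuous_tent compactly_supported_tent.
set sq := sqnorm_rV _ in hA; have sq0 : 0 < sq by exact: sqnorm_tent_gt0.
exists (2 * A / sq) => [|i j]; first by rewrite divr_ge0 ?mulr_ge0// ltW.
have [Ri [di [Ri0 di0 hi]]] := hA i; have [Rj [dj [Rj0 dj0 hj]]] := hA j.
have [||r [l [rR r0 l0 l1 l2]]] := @small_scale R dim (Num.max Ri Rj) (Num.min di dj).
- by rewrite lt_max Ri0.
- by rewrite lt_min di0.
move: rR l1 l2; rewrite gt_max !lt_min => /andP[ri rj] /andP[li lj] /andP[ki kj].
have nl : `|l| = l by rewrite gtr0_norm.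
have [||||Li Ei] := hi r l; rewrite ?nl//.
have [||||Lj Ej] := hj r l; rewrite ?nl//.
move: Ej; rewrite Ei => -[/expR_inj ->] {Ei}.
set Y := r ^+ dim * l ^+ 2; have Y0 : 0 < Y by rewrite mulr_gt0// exprn_gt0.
set vi := cell_density P X i; set vj := cell_density P X j.
move=> h1 h2; have : `|2^-1 * vi * sq * Y - 2^-1 * vj * sq * Y| <=
    A * (3 / 4) ^+ i * Y + A * (3 / 4) ^+ j * Y.
  by apply: le_trans (ler_distD Lj _ _) _; apply: lerD; first rewrite distrC.
rewrite (_ : _ - _ = 2^-1 * sq * Y * (vi - vj)); last by ring.
have k0 : 0 < 2^-1 * sq * Y by apply: mulr_gt0 => //; exact: mulr_gt0.
rewrite normrM (gtr0_norm k0) => h3.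
rewrite mulrAC ler_pdivlMr//.
rewrite -(ler_pM2r Y0); lra.
Qed.

Lemma log_mgf_limit : exists2 s2 : R, 0 <= s2 &
  forall phi, continuous phi -> compactly_supported phi -> forall eta : R, 0 < eta ->
  exists R0 delta : R, [/\ 0 < R0, 0 < delta &
    forall r lambda : R, R0 < r -> 0 < `|lambda| -> `|lambda| < delta ->
    `|lambda| * ln r ^+ dim < delta -> exists2 Lam : R,
    (\int[P]_w (expR (lfsbm_integral (X w) (fun t => lambda * phi (r^-1 *: t))))%:E =
      (expR Lam)%:E)%E &
    `|(r ^+ dim * lambda ^+ 2)^-1 * Lam - 2^-1 * sqnorm_rV phi * s2| < eta].
Proof.
have [D D0 hD] := cell_density_cauchy.
have [s2 s20 hs2] := limit_of_approx D0 (cell_density_ge0 P X) hD.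
exists s2 => // phi cphi sphi eta eta0.
have [A A0 hA] := log_mgf_estimate mX X0 statX sX cphi sphi.
set sq := sqnorm_rV _ in hA *.
have sq0 : 0 <= sq.
  have [mu muE _] := @lebesgue_rVP R dim.
  by rewrite /sq /sqnorm_rV muE; apply: Rintegral_ge0 => t _; exact: sqr_ge0.
(* [A] accounts for the distance to the density of scale [j], the second summand for the distance of
   that density to [s2]. *)
have [j hj] := geometric_small (A + 2^-1 * sq * D) eta0.
have [R0 [delta [R00 d0 h]]] := hA j; exists R0, delta; split=> // r l rR l0 l1 l2.
have [Lam LamE hL] := h r l rR l0 l1 l2; exists Lam => //.
move: hL; set Y := r ^+ dim * l ^+ 2; set v := cell_density P X j => hL.
have Y0 : 0 < Y.
  apply: mulr_gt0; first by rewrite exprn_gt0// (lt_trans R00).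
  by rewrite -(real_normK (num_real l)) exprn_gt0.
apply: le_lt_trans hj.
apply: le_trans (ler_distD (2^-1 * v * sq) _ _) _; rewrite mulrDl; apply: lerD.
  rewrite -(ler_pM2r Y0) -[X in _ * X <= _](gtr0_norm Y0) -normrM.
  by rewrite mulrBl mulrAC mulVf ?gt_eqF// mul1r.
rewrite (_ : _ - _ = 2^-1 * sq * (v - s2)); last by ring.
rewrite normrM ger0_norm ?mulr_ge0// -[leRHS]mulrA.
by apply: ler_wpM2l; [rewrite mulr_ge0|exact: hs2].
Qed.

End limit_variance.

Lemma test_fun_dilation (R : realType) n (c a : R) S (f : 'rV[R]_n.+1 -> R) :
  0 < c -> continuous f -> test_fun a S f ->
  exists S', test_fun a S' (fun t => f (c *: t)).
Proof.
move=> c0 cf [[_ bS] _ fa fS]; have [rho hrho] := (bounded_setP _).1 bS.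
have mf := continuous_borel (continuous_dilation (c := c) cf).
pose h := `|rho| / c; exists (box n.+1 (fun=> - h) (fun=> h + h + 1)).
split=> //; first exact: bounded_borel_box.
move=> t; apply: contra_notP => /eqP ft i _.
have St : S (c *: t) by apply: contrapT => /fS; exact/eqP.
have : `|t| <= h.
  rewrite ler_pdivlMr// mulrC -(gtr0_norm c0) -normrZ.
  by apply: le_trans (hrho _ St) _; exact: ler_norm.
by move=> /(le_trans (coord_le_norm t i)); rewrite ler_norml; lra.
Qed.

Theorem theorem1p5 (R : realType) (n : nat) (disp : measure_display)
    (Omega : measurableType disp) (P : probability Omega R)
    (X : Omega -> lfsbm R n.+1)
    (Xfield : random_field X) (Xstat : stationary P X)
    (Xsplit : splittable P X) :
  exists! sigma : R, 0 <= sigma /\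
    forall phi : 'rV[R]_n.+1 -> R, continuous phi -> compactly_supported phi ->
      forall eta : R, 0 < eta ->
        exists R0 delta : R, 0 < R0 /\ 0 < delta /\
          forall r lambda : R, R0 < r -> 0 < `|lambda| < delta ->
            `|lambda| * ln r ^+ n.+1 < delta ->
            (`| ((r ^+ n.+1 * lambda ^+ 2)^-1)%:E *
                  lne 'E_P[fun w => expR (lambda *
                    lfsbm_integral (X w) (fun t => phi (r^-1 *: t)))] -
                (2^-1 * sqnorm_rV phi * sigma ^+ 2)%:E | < eta%:E)%E.
Proof.
(* The estimates hold for the rescaled field [X'], whose limiting variance is that of [X] divided by
   [C ^ 2]. *)
have [C C0 CX] := Xsplit; pose X' w := scale_lfsbm C^-1 (X w).
have mX' : random_field X' by exact: random_field_scale.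
have X'0 : mean0 P X'.
  case: CX => _ h _ A bA; have := h A bA; by rewrite unlock.
have sX' : splits n.+1 (mgf_le P X') := splittable1_splits (leqnn _) mX' X'0 CX.
have [s2 s20 hs2] := log_mgf_limit mX' X'0 (stationary_scale _ Xstat) sX'.
pose sigma := C * Num.sqrt s2.
have sigma0 : 0 <= sigma by rewrite mulr_ge0 ?sqrtr_ge0// ltW.
suff hsigma : forall phi : 'rV[R]_n.+1 -> R, continuous phi -> compactly_supported phi ->
      forall eta : R, 0 < eta ->
        exists R0 delta : R, 0 < R0 /\ 0 < delta /\
          forall r lambda : R, R0 < r -> 0 < `|lambda| < delta ->
            `|lambda| * ln r ^+ n.+1 < delta ->
            (`| ((r ^+ n.+1 * lambda ^+ 2)^-1)%:E *
                  lne 'E_P[fun w => expR (lambda *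
                    lfsbm_integral (X w) (fun t => phi (r^-1 *: t)))] -
                (2^-1 * sqnorm_rV phi * sigma ^+ 2)%:E | < eta%:E)%E.
  (* With the tent function, both limits are approached at a common [r] and [lambda], so the squares
     of [sigma] and [tau] differ by less than any [e]; both numbers are nonnegative. *)
  exists sigma; split=> // tau [tau0 htau]; apply/eqP.
  rewrite -(eqrXn2 (n := 2))//; apply/eqP; set sq := sqnorm_rV (@tent R n).
  have sq0 : 0 < sq by exact: sqnorm_tent_gt0.
  apply/eqP; rewrite -subr_eq0 -normr_le0; apply/ler_addgt0Pr => e e0; rewrite add0r.
  (* The two limits then differ by less than [sq * e / 2], and they carry the factor [sq / 2]. *)
  have e1 : 0 < sq * e / 4 by rewrite divr_gt0// mulr_gt0.
  have [R1 [d1 [R10 [d10 h1]]]] := hsigma _ continuous_tent compactly_supported_tent _ e1.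
  have [R2 [d2 [R20 [d20 h2]]]] := htau _ continuous_tent compactly_supported_tent _ e1.
  have [||r [l [rR _ l0 l1 l2]]] := @small_scale R n.+1 (Num.max R1 R2) (Num.min d1 d2).
  - by rewrite lt_max R10.
  - by rewrite lt_min d10.
  move: rR l1 l2; rewrite gt_max !lt_min => /andP[r1 r2] /andP[l1 l1'] /andP[l2 l2'].
  have nl : `|l| = l by rewrite gtr0_norm.
  have := ereal_dist_le (h1 r l r1 _ _) (h2 r l r2 _ _); rewrite nl l0.
  move=> /(_ l1 l2 l1' l2'); rewrite -/sq -mulrBr normrM gtr0_norm ?mulr_gt0// => h.
  by apply/ltW; rewrite -(ltr_pM2l sq0); lra.
move=> phi cphi sphi eta eta0.
(* The parameter [lambda] for [X] is [lambda * C] for [X'], and normalizing by [lambda ^ 2] instead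
   of [(lambda * C) ^ 2] multiplies errors by [C ^ 2]. *)
have [R0 [delta [R00 d0 h]]] := hs2 phi cphi sphi (eta / C ^+ 2)
  (divr_gt0 eta0 (exprn_gt0 2 C0)).
exists R0, (delta / C); split=> //; split; first by rewrite divr_gt0.
move=> r lambda rR /andP[l0 l1] l2; have r0 : 0 < r by exact: lt_trans rR.
have nl : `|lambda * C| = `|lambda| * C by rewrite normrM (gtr0_norm C0).
have [|||Lam LamE hL] := h r (lambda * C) rR; rewrite ?nl.
- by rewrite mulr_gt0.
- by rewrite -ltr_pdivlMr.
- by rewrite mulrAC -ltr_pdivlMr.
have [a /(test_fun_dilation (c := r^-1) _ cphi)[|S ta]] := cc_test_fun cphi sphi.
  by rewrite invr_gt0.
have -> : ('E_P[fun w => expR (lambda * lfsbm_integral (X w) (fun t => phi (r^-1 *: t)))] =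
    (expR Lam)%:E)%E.
  rewrite unlock -LamE; apply: eq_integral => w _; congr (expR _)%:E.
  rewrite (lfsbm_integralZ _ _ ta) (lfsbm_integral_scale _ _ ta).
  by field; rewrite gt_eqF.
rewrite lne_EFin ?expR_gt0// expRK -EFinM -EFinB abse_EFin lte_fin.
rewrite exprMn sqr_sqrtr//.
have C20 : 0 < C ^+ 2 by rewrite exprn_gt0.
rewrite ltr_pdivlMr// in hL; apply: le_lt_trans hL.
rewrite -[X in _ <= _ * X](gtr0_norm C20) -normrM le_eqVlt; apply/orP; left; apply/eqP.
congr `|_|; rewrite exprMn; field.
by apply/and3P; split; [rewrite gt_eqF|rewrite -normr_gt0|rewrite gt_eqF// exprn_gt0].
Qed.
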